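(* Let $\mathcal{H}$ be a Hardy field and $f_1,\ldots,f_k:[1,\infty)\to\mathbb{R}$ in $\mathcal{H}$. Put $f(t)=(f_1(t),\ldots,f_k(t))$ and $E(t)=\min\{|f_1(t)|,\ldots,|f_k(t)|\}$. Suppose: (i) for each $i$ there is $j\in\mathbb{N}$ with $t^{j-1}\prec f_i(t)\prec t^j$; (ii) $\log_2(t)\prec \log(f_i(t))$ for all $i$; (iii) after reordering $f_1,\ldots,f_k$ if necessary, $\frac{f_{i+1}(t)}{f_i(t)}\succ\log_2^4(t)$ for all $i=1,\ldots,k-1$. Then there is a constant $C>0$ such that for all $N\in\mathbb{N}$, all $r,s\in\left[1,\min\left\{N,\frac{E(N)}{\log^5(N)}\right\}\right]$ with $r\ge s$, and all $\tau\in[-\log_2^2(N),\log_2^2(N)]^k\cap\mathbb{Z}^k$ with $\tau\ne(0,\ldots,0)$, $$\left|\sum_{n=1}^{N} e\left(\tfrac1r\langle f(sn),\tau\rangle\right)\right|\le\frac{CN}{\log(N)}.$$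
   Context: A Hardy field is a subfield of the ring of germs at $\infty$ of real-valued functions on $[1,\infty)$ that is closed under differentiation; a function belongs to $\mathcal{H}$ if its germ does. $\log_2(t)=\log\log t$. We write $f(t)\prec g(t)$ if $g(t)/f(t)\to\infty$ as $t\to\infty$. $e(x)=e^{2\pi i x}$ and $\langle\cdot,\cdot\rangle$ is the standard inner product on $\mathbb{R}^k$. *)

(* Defs.v *)
From HB Require Import structures.
From mathcomp Require Import all_boot all_order all_fingroup all_algebra.
From mathcomp Require Import generic_quotient ring_quotient complex.
From mathcomp Require Import all_classical all_reals all_analysis.

Set Implicit Arguments.
Unset Strict Implicit.
Unset Printing Implicit Defensive.

Import Order.TTheory GRing.Theory Num.Theory.
Import numFieldNormedType.Exports.

Local Open Scope classical_set_scope.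
Local Open Scope ring_scope.

(* The ring of germs at +oo: real functions modulo the ideal of those that
   vanish eventually. A function on [1, +oo[ is represented by a total function
   R -> R; its germ does not depend on the values outside [1, +oo[. *)
Section Germs.
Variable R : realType.

Definition evzero (f : R -> R) : bool := `[< \forall t \near +oo, f t = 0 >].

Lemma evzero_idealr_closed : idealr_closed evzero.
Proof.
split.
- by apply/asboolP; near=> t.
- apply/negP => /asboolP h; have [t /eqP] : exists t : R, (1 : R -> R) t = 0.
    exact: (@filter_ex _ (pinfty_nbhs R)).
  by rewrite oner_eq0.
- move=> a u v /asboolP hu /asboolP hv; apply/asboolP.
  near=> t.
  rewrite addrfctE mulrfctE/=.
  have -> : u t = 0 by near: t.
  have -> : v t = 0 by near: t.
  by rewrite mulr0 addr0.
Unshelve. all: by end_near. Qed.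

HB.instance Definition _ := isIdealr.Build (R -> R) evzero evzero_idealr_closed.

Definition germ := {ideal_quot (evzero : idealr (R -> R))}.

Definition germ_of (f : R -> R) : germ := (\pi_germ f)%qT.

Lemma germ_ofP (f g : R -> R) :
  germ_of f = germ_of g <-> \forall t \near +oo, f t = g t.
Proof.
rewrite /germ_of; split=> [/eqP|h].
  rewrite -Quotient.idealrBE => /asboolP; apply: filterS => t.
  exact: subr0_eq.
apply/eqP; rewrite -Quotient.idealrBE; apply/asboolP.
by apply: filterS h => t ftgt; rewrite -[LHS]/(f t - g t) ftgt subrr.
Qed.

(* Differentiation is only a partial operation on germs, so closure under
   differentiation includes that every element is eventually differentiable. *)
Record hardy_field (H : set germ) : Prop := HardyField {
  hardy_subring : subring_closed (mem H);
  hardy_inv : forall x, x \in H -> x != 0 -> exists2 y, y \in H & x * y = 1;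
  hardy_derive : forall f : R -> R, germ_of f \in H ->
    (\forall t \near +oo, derivable f t 1) /\ germ_of (derive1 f) \in H
}.

End Germs.

Section Notions.
Variable R : realType.

Definition prec (f g : R -> R) : Prop := g t / f t @[t --> +oo] --> +oo.

Definition log2 (t : R) : R := ln (ln t).

Definition e (x : R) : R[i] := Complex (cos (2 * pi * x)) (sin (2 * pi * x)).

(* The index ord0 serves only as the initial value of the iterated minimum. *)
Definition minabs k (f : 'I_k.+1 -> R -> R) (t : R) : R :=
  \big[Num.min/`|f ord0 t|]_(i < k.+1) `|f i t|.

Definition inner k (u : 'I_k -> R) (v : 'I_k -> int) : R :=
  \sum_(i < k) u i * (v i)%:~R.

End Notions.

Infix "≺" := prec (at level 70, no associativity).

(* Main.v *)
(* Let m be the largest index, in the order of growth, with tau_m <> 0, and put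
   F(t) = <f(s t), tau> / r. All the functions are placed in a Hardy field that
   also contains t, log t, log log t and log log log t; such an extension by a
   primitive y exists because a monic polynomial in y has a derivative of smaller
   degree, hence of constant sign, and is therefore monotone. In this field
   L'Hopital's rule applies to every derivative, and shows two things: the l-th
   derivative of f_m dominates log log^2 times the l-th derivatives of the smaller
   f_i, and it is f_m(t) / t^l up to powers of log t. Hence, on
   [N / log N, 2N], the l-th derivative of F has constant sign and size Y / N^l up
   to powers of log N, where Y = |tau_m| f_m(s N) / r >= log^5 N.

   If Y^2 <= N, the first derivative is small and the Kusmin-Landau inequality
   gives the bound; this is the only place where the exponent 5 matters. Otherwise
   N^(2l-3) <= Y^2 <= N^(2l-1) for some bounded l >= 2, and l - 1 steps of van der
   Corput differencing followed by Kusmin-Landau save any power of log N. The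
   finite differences of the sequence F(n) play the role of the derivatives. *)

Require Import Defs.
From mathcomp Require Import all_boot all_order all_fingroup all_algebra.
From mathcomp Require Import generic_quotient ring_quotient complex ring lra zify.
From mathcomp Require Import all_classical all_reals all_analysis.

Set Implicit Arguments.
Unset Strict Implicit.
Unset Printing Implicit Defensive.

Import Order.TTheory GRing.Theory Num.Theory.
Import numFieldNormedType.Exports.

Local Open Scope classical_set_scope.
Local Open Scope ring_scope.
Local Open Scope complex_scope.

(** * Exponential sums *)

(** Uniformity in s, r and tau shapes the proof. Eventual statements are made about the f_i alone,
    beyond one threshold T; since s >= 1, they apply at every s t with t >= N / log N once N is
    large. The terms before this window number at most N / log N and are estimated trivially.

    Up to logarithms, the test of order l needs N^(l-2) <= Y <= N^l. Cutting at half-integer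
    exponents leaves a factor sqrt N of room at either end, and this absorbs every power of log N.

    The lower bound for the first derivative has no such room, and there 5 = 2 + 2 + 1: passing from
    f_m(s N) to f_m(s t) loses at most log^2 N, because the growth type is at most 2; the bound
    f_m'(u) >= f_m(u) / (u log u) loses log u <= log^2 N at u = s t; the last logarithm is the
    saving. Assumption (ii) is what yields this bound with a single log u. In assumption (iii), two
    of the four factors log_2 pay for the coefficients tau_i and the others for the powers of log_3
    lost in differentiating. *)

Section ComplexModulus.
Variable R : realType.
Implicit Types (x y : R) (z w : R[i]).

Definition cmod z : R := Normc.normc z.

Lemma cmodE z : `|z| = (cmod z)%:C.
Proof. by []. Qed.

Lemma cmodM z w : cmod (z * w) = cmod z * cmod w.
Proof. exact: Normc.normcM. Qed.

Lemma cmodV z : cmod z^-1 = (cmod z)^-1.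
Proof. exact: Normc.normcV. Qed.

Lemma cmodD z w : cmod (z + w) <= cmod z + cmod w.
Proof. by rewrite -lecR rmorphD -!cmodE ler_normD. Qed.

Lemma cmodN z : cmod (- z) = cmod z.
Proof. by apply: complexI; rewrite -!cmodE normrN. Qed.

Lemma cmod_ge0 z : 0 <= cmod z.
Proof. by rewrite -lecR -cmodE normr_ge0. Qed.

Lemma cmod0 : cmod 0 = 0.
Proof. by apply: complexI; rewrite -cmodE normr0. Qed.

Lemma cmodR x : 0 <= x -> cmod x%:C = x.
Proof. by move=> x0; apply: complexI; rewrite -cmodE ger0_norm// lecR. Qed.

Lemma cmod_conj z : cmod (Num.conj z) = cmod z.
Proof. by apply: complexI; rewrite -!cmodE norm_conjC. Qed.

Lemma cmod_sum (I : Type) (r : seq I) (P : pred I) (F : I -> R[i]) :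
  cmod (\sum_(i <- r | P i) F i) <= \sum_(i <- r | P i) cmod (F i).
Proof.
elim/big_ind2: _ => // [|z1 x1 z2 x2 h1 h2]; first by rewrite cmod0.
by apply: le_trans (cmodD _ _) _; exact: lerD.
Qed.

Lemma cmod_Im z : `|complex.Im z| <= cmod z.
Proof.
case: z => a b; rewrite /cmod /= -sqrtr_sqr ler_wsqrtr//.
by rewrite lerDr sqr_ge0.
Qed.

Lemma cmod_ReIm z : cmod z <= `|complex.Re z| + `|complex.Im z|.
Proof.
case: z => a b; rewrite /cmod /=.
rewrite -[leRHS]ger0_norm ?addr_ge0// -sqrtr_sqr ler_wsqrtr//.
rewrite sqrrD !real_normK ?num_real// lerD2r lerDl.
by rewrite mulrn_wge0// mulr_ge0.
Qed.

Lemma eD x y : e (x + y) = e x * e y.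
Proof.
rewrite /e mulrDr cosD sinD.
by apply/eqP; rewrite eq_complex/= [X in _ && (X == _)]addrC !eqxx.
Qed.

Lemma cmod_e x : cmod (e x) = 1.
Proof. by rewrite /cmod/= cos2Dsin2 sqrtr1. Qed.

Lemma conj_e x : Num.conj (e x) = e (- x).
Proof. by rewrite /e mulrN cosN sinN. Qed.

Lemma cos_lipschitz x y : `|cos x - cos y| <= `|x - y|.
Proof.
wlog xy : x y / y <= x.
  move=> h; have [/h//|/ltW/h] := leP y x.
  by rewrite distrC [leRHS]distrC.
have [c _ ->] := MVT_segment xy (fun t _ => is_derive_cos t)
  (continuous_subspaceT (@continuous_cos R)).
by rewrite normrM normrN ler_piMl// sin_max.
Qed.

Lemma sin_lipschitz x y : `|sin x - sin y| <= `|x - y|.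
Proof.
wlog xy : x y / y <= x.
  move=> h; have [/h//|/ltW/h] := leP y x.
  by rewrite distrC [leRHS]distrC.
have [c _ ->] := MVT_segment xy (fun t _ => is_derive_sin t)
  (continuous_subspaceT (@continuous_sin R)).
by rewrite normrM ler_piMl// cos_max.
Qed.

(** Each coordinate is Lipschitz with constant 2 pi <= 8, and the modulus is at most the sum of the
    two. *)
Lemma e_lipschitz x y : cmod (e x - e y) <= 16 * `|x - y|.
Proof.
apply: le_trans (cmod_ReIm _) _; rewrite /e/=.
have pi4 : (pi : R) <= 4 by have := pihalf_lt2 R; lra.
have h : `|2 * pi * x - 2 * pi * y| <= 8 * `|x - y|.
  rewrite -mulrBr normrM ger0_norm; last by rewrite mulr_ge0// pi_ge0.
  by apply: ler_wpM2r => //; lra.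
apply: le_trans (lerD (cos_lipschitz _ _) (sin_lipschitz _ _)) _; lra.
Qed.

(** The imaginary part suffices: for x <= 1/16 the angle y = 2 pi x is at most 1/2, where the cosine
    is at least 1/2, so sin y >= y / 2 >= 2 x. *)
Lemma cmod_1Be x : 0 <= x <= 16^-1 -> 2 * x <= cmod (1 - e x).
Proof.
move=> /andP[x0 x1]; apply: le_trans (cmod_Im _); rewrite /e/= sub0r normrN.
have pi4 : (pi : R) <= 4 by have := pihalf_lt2 R; lra.
have pi2 := pi_ge2 R.
set y := 2 * pi * x.
have y4 : 4 * x <= y by rewrite /y; nra.
have y2 : y <= 2^-1 by rewrite /y; nra.
have y0 : 0 <= y by lra.
have [c] := MVT_segment y0 (fun t _ => is_derive_sin t)
  (continuous_subspaceT (@continuous_sin R)).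
rewrite in_itv/= => /andP[c0 cy]; rewrite sin0 !subr0 => ->.
apply: le_trans (ler_norm _).
have : `|cos c - cos 0| <= `|c - 0| by exact: cos_lipschitz.
rewrite cos0 subr0 (ger0_norm c0) ler_norml => /andP[+ _] => cc.
have : 2^-1 <= cos c by lra.
by nra.
Qed.

End ComplexModulus.

(** * Finite differences and the Kusmin-Landau inequality *)

Section Differences.
Variable R : realType.
Implicit Types (g : nat -> R) (l n m d : nat).

Definition fdiff g m : R := g m.+1 - g m.

Lemma iter_fdiff_shift l g d m :
  iter l fdiff (fun i => g (i + d)%N - g i) m =
  iter l fdiff g (m + d)%N - iter l fdiff g m.
Proof.
elim: l m => // l IH m; rewrite !iterS /fdiff !IH addSn /=; ring.
Qed.

Lemma shift_fdiff g m d :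
  g (m + d)%N - g m = \sum_(0 <= j < d) fdiff g (m + j)%N.
Proof.
have := @telescope_sumr R 0 d (fun j => g (m + j)%N) (leq0n _).
rewrite addn0 => <-; apply: eq_bigr => j _.
by rewrite /fdiff addnS.
Qed.

Definition expsum g n : R[i] := \sum_(0 <= m < n) e (g m).

Lemma expsum_le g n : cmod (expsum g n) <= n%:R.
Proof.
apply: le_trans (cmod_sum _ _ _) _.
under eq_bigr do rewrite cmod_e.
by rewrite sumr_const_nat subn0.
Qed.

(** Applied to a difference of order l + 1, this expresses monotonicity of the difference of order
    l. *)
Definition same_sign n g :=
  (forall m, (m < n)%N -> 0 <= g m) \/ (forall m, (m < n)%N -> g m <= 0).

(** By conjugation; thus the sign of a phase can be chosen freely. *)
Lemma cmod_expsumN g n : cmod (expsum (fun m => - g m) n) = cmod (expsum g n).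
Proof.
rewrite -cmod_conj /expsum rmorph_sum/=; congr cmod.
by apply: eq_bigr => i _; rewrite conj_e opprK.
Qed.

(* With d m = g (m+1) - g m and c m = 1 / (1 - e (d m)), the sums
   T m = sum_(i <= m) e (g i) + e (g (m+1)) c m satisfy
   T (m+1) - T m = e (g (m+1)) (c (m+1) - c m), and the increments of c are
   controlled by those of 1/d, which telescope since d is monotone. *)
Lemma kusmin_landau g n (th : R) : 0 < th ->
  (forall m, (m < n)%N -> th <= fdiff g m <= 16^-1) ->
  same_sign n (fdiff (fdiff g)) ->
  cmod (expsum g n) <= 5 / th.
Proof.
move=> th0; case: n => [|n] hd hs.
  by rewrite /expsum big_geq// cmod0 divr_ge0// ltW.
pose d := fdiff g; pose c m : R[i] := (1 - e (d m))^-1.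
have dpos m : (m < n.+1)%N -> 0 < d m.
  by move=> /hd/andP[h _]; exact: lt_le_trans h.
have nz m : (m < n.+1)%N -> 2 * d m <= cmod (1 - e (d m)).
  move=> mn; apply: cmod_1Be; case/andP: (hd _ mn) => h1 h2.
  by rewrite h2 (ltW (dpos _ mn)).
have nz0 m : (m < n.+1)%N -> 0 < cmod (1 - e (d m)).
  move=> mn; apply: lt_le_trans (nz _ mn); by rewrite mulr_gt0// dpos.
have nzC m : (m < n.+1)%N -> 1 - e (d m) != 0.
  by move=> /nz0; apply: contraTneq => ->; rewrite cmod0 ltxx.
have gS m : g m.+1 = g m + d m by rewrite /d /fdiff; ring.
have cb m : (m < n.+1)%N -> cmod (c m) <= 2^-1 / th.
  move=> mn; rewrite /c cmodV -invfM lef_pV2 ?posrE ?nz0 ?mulr_gt0//.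
  apply: le_trans (nz _ mn); rewrite ler_pM2l//.
  by case/andP: (hd _ mn).
(* The constant is 16 / (2 * 2): the Lipschitz constant of [e] over the two lower bounds [2 * d]. *)
have cl m : (m.+1 < n.+1)%N ->
    cmod (c m.+1 - c m) <= 4 * `|(d m.+1)^-1 - (d m)^-1|.
  move=> mn; have mn' := ltnW mn.
  have -> : c m.+1 - c m =
      (e (d m.+1) - e (d m)) * (c m * c m.+1).
    by rewrite /c; field; rewrite !nzC.
  have -> : (d m.+1)^-1 - (d m)^-1 = (d m - d m.+1) * ((d m)^-1 * (d m.+1)^-1).
    by field; rewrite !gt_eqF ?dpos.
  rewrite normrM !cmodM (ger0_norm (x := _ * _)); last first.
    by rewrite mulr_ge0// invr_ge0 ltW// dpos.
  have -> : 4 * (`|d m - d m.+1| * ((d m)^-1 * (d m.+1)^-1)) =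
     (16 * `|d m - d m.+1|) * ((2 * d m)^-1 * (2 * d m.+1)^-1) :> R.
    by field; rewrite !gt_eqF ?dpos.
  rewrite ler_pM ?cmod_ge0// ?mulr_ge0 ?cmod_ge0//.
    by rewrite distrC e_lipschitz.
  rewrite /c !cmodV ler_pM ?invr_ge0 ?cmod_ge0//.
    by rewrite lef_pV2 ?posrE ?nz ?nz0 ?mulr_gt0 ?dpos.
  by rewrite lef_pV2 ?posrE ?nz ?nz0 ?mulr_gt0 ?dpos.
have T m : (m < n.+1)%N -> cmod (expsum g m.+1 + e (g m.+1) * c m) <=
    2^-1 / th + 4 * `|(d m)^-1 - (d 0%N)^-1|.
  elim: m => [_|m IH mn].
    rewrite subrr normr0 mulr0 addr0 /expsum big_nat1.
    have -> : e (g 0%N) + e (g 1%N) * c 0%N = e (g 0%N) * c 0%N.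
      by rewrite gS eD /c; field; rewrite nzC.
    by rewrite cmodM cmod_e mul1r cb.
  have -> : expsum g m.+2 + e (g m.+2) * c m.+1 =
      (expsum g m.+1 + e (g m.+1) * c m) + e (g m.+1) * (c m.+1 - c m).
    rewrite /expsum [X in X + _ = _]big_nat_recr//= (gS m.+1) eD /c.
    by field; rewrite !nzC// ltnW.
  apply: le_trans (cmodD _ _) _; rewrite cmodM cmod_e mul1r.
  apply: le_trans (lerD (IH (ltnW mn)) (cl _ mn)) _.
  rewrite -addrA lerD2l -mulrDr ler_pM2l//.
  have inv_mono i j : (i < n.+1)%N -> (j < n.+1)%N ->
      d i <= d j -> (d j)^-1 <= (d i)^-1.
    by move=> hi hj; rewrite lef_pV2 ?posrE ?dpos.
  case: hs => hs.
    have dm i j : (i <= j)%N -> (j < n.+1)%N -> d i <= d j.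
      elim: j => [|j IHj]; first by rewrite leqn0 => /eqP->.
      rewrite leq_eqVlt => /predU1P[->//|]; rewrite ltnS => ij jn.
      apply: le_trans (IHj ij (ltnW jn)) _.
      by have := hs _ (ltnW jn); rewrite {1}/fdiff subr_ge0.
    have h1 := inv_mono _ _ (ltnW mn) mn (dm _ _ (leqnSn m) mn).
    have h2 := inv_mono _ _ (ltn0Sn _) (ltnW mn) (dm _ _ (leq0n m) (ltnW mn)).
    rewrite !ler0_norm ?subr_le0//; first lra.
    exact: le_trans h1 h2.
  have dm i j : (i <= j)%N -> (j < n.+1)%N -> d j <= d i.
    elim: j => [|j IHj]; first by rewrite leqn0 => /eqP->.
    rewrite leq_eqVlt => /predU1P[->//|]; rewrite ltnS => ij jn.
    apply: le_trans (IHj ij (ltnW jn)).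
    by have := hs _ (ltnW jn); rewrite {1}/fdiff subr_le0.
  have h1 := inv_mono _ _ mn (ltnW mn) (dm _ _ (leqnSn m) mn).
  have h2 := inv_mono _ _ (ltnW mn) (ltn0Sn _) (dm _ _ (leq0n m) (ltnW mn)).
  rewrite !ger0_norm ?subr_ge0//; first lra.
  exact: le_trans h2 h1.
have hT := T _ (ltnSn n).
(* Removing the correction term costs a second 1 / (2 th), and the variation of 1/d is at most 1 /
   th: 1/2 + 4 + 1/2 = 5. *)
have -> : expsum g n.+1 =
  (expsum g n.+1 + e (g n.+1) * c n) - e (g n.+1) * c n by ring.
apply: le_trans (cmodD _ _) _; rewrite cmodN cmodM cmod_e mul1r.
have dinv m : (m < n.+1)%N -> 0 <= (d m)^-1 <= th^-1.
  move=> mn; rewrite invr_ge0 (ltW (dpos _ mn))/= lef_pV2 ?posrE ?dpos//.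
  by case/andP: (hd _ mn).
have h1 := cb _ (ltnSn n).
have h2 : `|(d n)^-1 - (d 0%N)^-1| <= th^-1.
  have /andP[? ?] := dinv _ (ltnSn n); have /andP[? ?] := dinv _ (ltn0Sn n).
  by rewrite ler_norml; apply/andP; split; lra.
apply: le_trans (lerD hT h1) _.
by move: h2; set A := `|_ - _|; set B := th^-1; lra.
Qed.

End Differences.

(** * Van der Corput's inequality *)

Section VanDerCorput.
Variable R : realType.

Lemma sum_shift_support (V : zmodType) (G : nat -> V) a b h Q :
  (h <= a)%N -> (b <= Q + h)%N ->
  (forall x, ~~ (a <= x < b)%N -> G x = 0) ->
  \sum_(0 <= m < Q) G (m + h)%N = \sum_(0 <= y < b - a) G (y + a)%N.
Proof.
move=> ha bQ G0.
have -> : \sum_(0 <= m < Q) G (m + h)%N = \sum_(h <= x < Q + h) G x.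
  by rewrite -{2}[h]add0n big_addn addnK.
have [ab|ba] := leqP a b; last first.
  rewrite (eqP (ltnW ba : b - a == 0)%N) [RHS]big_geq// big1// => x _.
  by apply: G0; apply/negP; lia.
rewrite (@big_cat_nat _ _ _ a)//=; last by lia.
rewrite big_nat big1 ?add0r; last by move=> x hx; apply: G0; lia.
rewrite (@big_cat_nat _ _ _ b)//=.
rewrite [X in _ + X]big_nat [X in _ + X]big1 ?addr0; last first.
  by move=> x hx; apply: G0; lia.
by rewrite -{1}[a]add0n big_addn.
Qed.

(** Cauchy-Schwarz against a constant sequence. In the induction, [S^2 <= a * T] gives
    [2 * S * a * y <= a * T + (a * y)^2]. *)
Lemma sqr_sum_le (x : nat -> R) n :
  (\sum_(0 <= m < n) x m) ^+ 2 <= n%:R * \sum_(0 <= m < n) x m ^+ 2.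
Proof.
elim: n => [|n IH]; first by rewrite !big_geq// expr0n mul0r.
rewrite !big_nat_recr//=.
case: n IH => [|n] IH; first by rewrite !big_geq// !add0r mul1r.
move: IH; set S := \sum_(_ <= _ < _) x _; set T := \sum_(_ <= _ < _) _ ^+ 2.
set y := x n.+1; rewrite -[n.+2%:R]natr1; set a : R := n.+1%:R => IH.
have a0 : 0 < a by rewrite ltr0n.
have : 2 * S * y <= T + a * y ^+ 2; last by nra.
rewrite -(ler_pM2l a0); have := sqr_ge0 (S - a * y); nra.
Qed.

(** The sequence is extended by zero; its window sums [w m] of length [H] add up to [H] times the
    sum, over [Q = n + H <= 2N] windows. Cauchy-Schwarz and expansion of the squares produce
    correlations at the lags |h - h'|. For fixed h, lag 0 occurs once and every other lag at most
    twice. *)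
Lemma vdc_inequality (z : nat -> R[i]) n N H : (n <= N)%N -> (0 < H <= N)%N ->
  (forall m, cmod (z m) <= 1) ->
  cmod (\sum_(0 <= m < n) z m) ^+ 2 <= 2 * N%:R / H%:R *
    (N%:R + 2 * \sum_(1 <= d < H)
       cmod (\sum_(0 <= m < n - d) z (m + d)%N * Num.conj (z m))).
Proof.
move=> nN /andP[H0 HN] z1.
(* The sequence is placed at [H], so that windows starting at natural numbers also cover its
   beginning completely. *)
pose Z m := if (H <= m < H + n)%N then z (m - H)%N else 0.
pose corr d := \sum_(0 <= m < n - d) z (m + d)%N * Num.conj (z m).
pose Q := (n + H)%N; pose w m := \sum_(0 <= h < H) Z (m + h)%N.
set S := \sum_(0 <= m < n) z m.
have Zout x : ~~ (H <= x < H + n)%N -> Z x = 0 by rewrite /Z => /negbTE ->.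
have SE h : (h < H)%N -> \sum_(0 <= m < Q) Z (m + h)%N = S.
  move=> hH; rewrite (@sum_shift_support _ Z H (H + n)%N)//; try by rewrite /Q; lia.
  rewrite addKn; apply: eq_big_nat => i /andP[_ ilt].
  by rewrite /Z addnK ifT//; lia.
have HS : \sum_(0 <= m < Q) w m = S *+ H.
  rewrite exchange_big_nat//= big_nat.
  under eq_bigr do [rewrite SE; last by lia].
  by rewrite -big_nat sumr_const_nat subn0.
have corrE h' d : (h' + d < H)%N ->
    \sum_(0 <= m < Q) Z (m + h' + d)%N * Num.conj (Z (m + h')%N) = corr d.
  move=> hd; pose G x := Z (x + d)%N * Num.conj (Z x).
  have Gout x : ~~ (H <= x < H + (n - d))%N -> G x = 0.
    move=> hx; rewrite /G; have [h1|h1] := boolP (H <= x < H + n)%N.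
      by rewrite (Zout (x + d)%N) ?mul0r//; lia.
    by rewrite (Zout x)// rmorph0 mulr0.
  rewrite (@sum_shift_support _ G H (H + (n - d))%N)//; try by rewrite /Q; lia.
  rewrite addKn; apply: eq_big_nat => i /andP[_ ilt].
  rewrite /G /Z !ifT; [|lia..].
  by rewrite addnAC !addnK.
have w2 : \sum_(0 <= m < Q) cmod (w m) ^+ 2 <=
    \sum_(0 <= h < H) \sum_(0 <= h' < H) cmod (corr (maxn h h' - minn h h')%N).
  have -> : \sum_(0 <= m < Q) cmod (w m) ^+ 2 =
      cmod (\sum_(0 <= m < Q) w m * Num.conj (w m)).
    rewrite -[LHS]cmodR; last by apply: sumr_ge0 => m _; rewrite sqr_ge0.
    rewrite rmorph_sum/=; congr cmod; apply: eq_bigr => m _.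
    by rewrite rmorphXn/= -cmodE normCK.
  have -> : \sum_(0 <= m < Q) w m * Num.conj (w m) =
      \sum_(0 <= h < H) \sum_(0 <= h' < H)
        \sum_(0 <= m < Q) Z (m + h)%N * Num.conj (Z (m + h')%N).
    under [RHS]eq_bigr do rewrite exchange_big_nat//=.
    rewrite [RHS]exchange_big_nat//=; apply: eq_bigr => m _.
    rewrite /w mulr_suml; apply: eq_bigr => h _.
    by rewrite rmorph_sum mulr_sumr.
  apply: le_trans (cmod_sum _ _ _) _; rewrite !big_nat; apply: ler_sum => h hH.
  apply: le_trans (cmod_sum _ _ _) _; rewrite !big_nat; apply: ler_sum => h' h'H.
  have [hh|/ltnW hh] := leqP h' h.
    rewrite -(corrE h' (h - h')%N); last by lia.
    by under [in leRHS]eq_bigr do rewrite -addnA subnKC//.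
  rewrite -(corrE h (h' - h)%N); last by lia.
  rewrite -cmod_conj rmorph_sum/=.
  under eq_bigr do rewrite rmorphM/= conjCK mulrC.
  by under [in leRHS]eq_bigr do rewrite -addnA subnKC//.
set Sg := \sum_(1 <= d < H) _.
have corr0 : cmod (corr 0%N) <= N%:R.
  apply: le_trans (cmod_sum _ _ _) _.
  apply: le_trans (_ : \sum_(0 <= m < n - 0) 1 <= _); last first.
    by rewrite sumr_const_nat !subn0 ler_nat.
  apply: ler_sum => m _; rewrite cmodM cmod_conj.
  by apply: mulr_ile1 => //; rewrite ?cmod_ge0 ?z1.
have inner_le h : (h < H)%N ->
    \sum_(0 <= h' < H) cmod (corr (maxn h h' - minn h h')%N) <= N%:R + 2 * Sg.
  move=> hH; rewrite (@big_cat_nat _ _ _ h)//=; last exact: ltnW.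
  rewrite [X in _ + X]big_ltn// maxnn minnn subnn.
  have A : \sum_(0 <= i < h) cmod (corr (maxn h i - minn h i)%N) <= Sg.
    have -> : \sum_(0 <= i < h) cmod (corr (maxn h i - minn h i)%N) =
        \sum_(1 <= d < h.+1) cmod (corr d).
      rewrite big_nat_rev/= add0n big_add1/=; apply: eq_big_nat => i ih.
      by congr (cmod (corr _)); lia.
    rewrite /Sg [leRHS](@big_cat_nat _ _ _ h.+1)//= lerDl.
    by apply: sumr_ge0 => i _; exact: cmod_ge0.
  have B : \sum_(h.+1 <= i < H) cmod (corr (maxn h i - minn h i)%N) <= Sg.
    have -> : \sum_(h.+1 <= i < H) cmod (corr (maxn h i - minn h i)%N) =
        \sum_(1 <= d < H - h) cmod (corr d).
      rewrite -{1}[h.+1]add1n big_addn; apply: eq_big_nat => i ih.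
      by congr (cmod (corr _)); lia.
    rewrite /Sg [leRHS](@big_cat_nat _ _ _ (H - h)%N)//=; [|lia..].
    rewrite lerDl.
    by apply: sumr_ge0 => i _; exact: cmod_ge0.
  by lra.
have HR : 0 < (H%:R : R) by rewrite ltr0n.
have T0 : 0 <= N%:R + 2 * Sg.
  rewrite addr_ge0// mulr_ge0//.
  by apply: sumr_ge0 => i _; exact: cmod_ge0.
have main : (H%:R * cmod S) ^+ 2 <= Q%:R * (H%:R * (N%:R + 2 * Sg)).
  have -> : H%:R * cmod S = cmod (\sum_(0 <= m < Q) w m).
    by rewrite HS -[S *+ H]mulr_natl cmodM -(rmorph_nat (real_complex R)) cmodR.
  apply: le_trans (_ : (\sum_(0 <= m < Q) cmod (w m)) ^+ 2 <= _).
    rewrite ler_sqr ?nnegrE ?cmod_ge0 ?cmod_sum//.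
    by apply: sumr_ge0 => i _; exact: cmod_ge0.
  apply: le_trans (sqr_sum_le _ _) _; apply: ler_wpM2l => //.
  apply: le_trans w2 _.
  apply: le_trans (_ : \sum_(0 <= h < H) (N%:R + 2 * Sg) <= _).
    by rewrite !big_nat; apply: ler_sum => h hH; apply: inner_le; lia.
  by rewrite sumr_const_nat subn0 -[leLHS]mulr_natl.
have QN : (Q%:R : R) <= 2 * N%:R.
  by rewrite -natrM ler_nat /Q; lia.
rewrite -(ler_pM2l (_ : 0 < H%:R ^+ 2)) ?exprn_gt0// -exprMn.
apply: le_trans main _.
have -> : H%:R ^+ 2 * (2 * N%:R / H%:R * (N%:R + 2 * Sg)) =
  2 * N%:R * (H%:R * (N%:R + 2 * Sg)) by field; rewrite gt_eqF.
by apply: ler_wpM2r => //; rewrite mulr_ge0// ltW.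
Qed.

End VanDerCorput.

(** * Derivative tests of all orders, for finite differences *)

Section DerivativeTest.
Variable R : realType.
Implicit Types (g : nat -> R) (K lam Lam : R).

Lemma le_sqr_le (x y : R) : 0 <= y -> x ^+ 2 <= y ^+ 2 -> x <= y.
Proof. by move=> y0 xy; rewrite leNgt; apply/negP => yx; nra. Qed.

Lemma expsum_corr g n d :
  \sum_(0 <= m < n - d) e (g (m + d)%N) * Num.conj (e (g m)) =
  expsum (fun i => g (i + d)%N - g i) (n - d).
Proof. by apply: eq_bigr => m _; rewrite conj_e -eD. Qed.

Lemma iter_fdiff_shift_sum l g d m :
  iter l (@fdiff R) (fun i => g (i + d)%N - g i) m =
  \sum_(0 <= j < d) iter l.+1 (@fdiff R) g (m + j)%N.
Proof. by rewrite iter_fdiff_shift shift_fdiff. Qed.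

Lemma iter_fdiff_shift_bounds l g d n lam Lam :
  (forall m, (m < n)%N -> lam <= iter l.+1 (@fdiff R) g m <= Lam) ->
  forall m, (m < n - d)%N ->
  d%:R * lam <= iter l (@fdiff R) (fun i => g (i + d)%N - g i) m <= d%:R * Lam.
Proof.
move=> hg m mn; rewrite iter_fdiff_shift_sum.
have cst x : d%:R * x = \sum_(0 <= j < d) x.
  by rewrite sumr_const_nat subn0 mulr_natl.
rewrite !cst !big_nat; apply/andP; split; apply: ler_sum => j jd.
  by have /andP[] := hg (m + j)%N ltac:(lia).
by have /andP[] := hg (m + j)%N ltac:(lia).
Qed.

Lemma iter_fdiff_shift_sign l g d n :
  same_sign n (iter l.+1 (@fdiff R) g) ->
  same_sign (n - d) (iter l (@fdiff R) (fun i => g (i + d)%N - g i)).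
Proof.
case=> hg; [left|right] => m mn; rewrite iter_fdiff_shift_sum big_nat.
  by apply: sumr_ge0 => j jd; apply: hg; lia.
by apply: sumr_le0 => j jd; apply: hg; lia.
Qed.

Lemma vdc_expsum g n N H : (n <= N)%N -> (0 < H <= N)%N ->
  cmod (expsum g n) ^+ 2 <= 2 * N%:R / H%:R * (N%:R +
    2 * \sum_(1 <= d < H) cmod (expsum (fun i => g (i + d)%N - g i) (n - d))).
Proof.
move=> nN HN; under eq_bigr do rewrite -expsum_corr.
by apply: vdc_inequality => // m; rewrite cmod_e.
Qed.

(** Here [a] counts the shifts and [b] those bounded trivially. The diagonal, the short shifts and
    the long shifts contribute at most 2, 4 and 80 times n^2 / K^2, together less than 100. *)
Lemma vdc_arith (n a b K lam S : R) : 0 <= n -> 0 < b -> 0 < K -> 0 < lam ->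
  K ^+ 2 <= a -> b * K ^+ 2 <= a -> a <= 2 * b * K ^+ 2 ->
  K ^+ 4 <= 2 * a * n * lam -> S <= b * n + a * (5 / (b * lam)) ->
  2 * n / a * (n + 2 * S) <= (10 * n / K) ^+ 2.
Proof.
move=> N0 b0 K0 lam0 Ka baK abK aNl Sle.
have KK0 : 0 < K ^+ 2 by exact: exprn_gt0.
have a0 : 0 < a by exact: lt_le_trans Ka.
apply: le_trans (_ : 2 * n / a * (n + 2 * (b * n + a * (5 / (b * lam)))) <= _).
  apply: ler_wpM2l; first by rewrite divr_ge0 ?mulr_ge0// ltW.
  by lra.
have -> : 2 * n / a * (n + 2 * (b * n + a * (5 / (b * lam)))) =
  2 * n ^+ 2 / a + 4 * n ^+ 2 * (b / a) + 20 * n / (b * lam).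
  by field; rewrite !gt_eqF.
have ia : a^-1 <= (K ^+ 2)^-1 by rewrite lef_pV2 ?posrE//; lra.
have iba : b / a <= (K ^+ 2)^-1.
  by rewrite ler_pdivrMr// mulrC ler_pdivlMr//; lra.
have ibl : (b * lam)^-1 <= 4 * n / K ^+ 2.
  rewrite -[leLHS]mul1r ler_pdivrMr ?mulr_gt0//.
  have -> : 4 * n / K ^+ 2 * (b * lam) =
    2 * (2 * b * K ^+ 2) * n * lam / K ^+ 4 by field; rewrite gt_eqF.
  rewrite ler_pdivlMr ?exprn_gt0// mul1r; apply: le_trans aNl _.
  by rewrite !ler_wpM2r ?ler_wpM2l// ltW.
have -> : (10 * n / K) ^+ 2 = 100 * n ^+ 2 * (K ^+ 2)^-1.
  by field; rewrite gt_eqF.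
have NN : 0 <= n ^+ 2 by exact: sqr_ge0.
have t1 : 2 * n ^+ 2 / a <= 2 * n ^+ 2 * (K ^+ 2)^-1.
  by apply: ler_wpM2l => //; lra.
have t2 : 4 * n ^+ 2 * (b / a) <= 4 * n ^+ 2 * (K ^+ 2)^-1.
  by apply: ler_wpM2l => //; lra.
have t3 : 20 * n / (b * lam) <= 80 * n ^+ 2 * (K ^+ 2)^-1.
  have -> : 80 * n ^+ 2 * (K ^+ 2)^-1 = 20 * n * (4 * n / K ^+ 2) by ring.
  by apply: ler_wpM2l => //; lra.
have : 0 <= n ^+ 2 * (K ^+ 2)^-1 by rewrite mulr_ge0// invr_ge0; lra.
move: t1 t2 t3; rewrite -!(mulrA _ (n ^+ 2) (K ^+ 2)^-1); lra.
Qed.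

(* H is the integer part of Lam^(-1/2); after one differencing step, the shifts
   below D = H / K^2 are bounded trivially and the others by Kusmin-Landau. *)
Lemma second_derivative_test g n N K lam Lam : 2 <= K -> (n <= N)%N ->
  0 < lam -> lam <= Lam -> K ^+ 8 * Lam <= 1 ->
  K ^+ 8 * Lam <= (N%:R * lam) ^+ 2 ->
  (forall m, (m < n)%N -> lam <= iter 2 (@fdiff R) g m <= Lam) ->
  same_sign n (iter 3 (@fdiff R) g) ->
  cmod (expsum g n) <= 10 * N%:R / K.
Proof.
move=> K2 nN lam0 lamL K1 KN hg hs.
have L0 : 0 < Lam by exact: lt_le_trans lamL.
have K0 : 0 < K by lra.
have K4 : 4 <= K ^+ 2 by nra.
have K16 : 4 * K ^+ 2 <= K ^+ 4 by rewrite [K ^+ 4](exprM K 2 2); nra.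
have K8 : K ^+ 8 = (K ^+ 4) ^+ 2 by rewrite -exprM.
have K16' : 16 <= K ^+ 4 by lra.
have K256 : 256 <= K ^+ 8 by rewrite K8; nra.
(* The power K^8 >= 2^8 makes [Lam] at most (1/16)^2. As a^2 Lam <= 1, the shifted phases then have
   first differences at most a Lam <= 1/16, as Kusmin-Landau requires. *)
have L256 : Lam <= 256^-1.
  by have := ler_wpM2r (ltW L0) K256; lra.
pose x := Num.sqrt Lam^-1.
have x2 : x ^+ 2 * Lam = 1 by rewrite sqr_sqrtr ?invr_ge0 ?ltW// mulVf ?gt_eqF.
have x0 : 0 <= x by exact: sqrtr_ge0.
have x1 : 1 <= x by nra.
pose H := Num.truncn x; pose a : R := H%:R.
have /andP[ax xa] : a <= x < a + 1 by rewrite natr1; exact: truncn_itv.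
have H0 : (0 < H)%N by rewrite truncn_gt0.
have a1 : 1 <= a by rewrite ler1n.
have aL : a ^+ 2 * Lam <= 1 by rewrite -x2 ler_pM2r// ler_sqr ?nnegrE//; lra.
have aL' : 1 <= 4 * a ^+ 2 * Lam.
  have : x ^+ 2 <= (2 * a) ^+ 2 by rewrite ler_sqr ?nnegrE//; lra.
  have -> : (2 * a) ^+ 2 = 4 * a ^+ 2 by ring.
  by move=> /(ler_wpM2r (ltW L0)); rewrite x2.
have K4a : K ^+ 4 <= 2 * a.
  apply: le_sqr_le; first lra.
  by rewrite -K8 -(ler_pM2r L0); apply: le_trans K1 _; rewrite exprMn; lra.
have N0 : (0 : R) <= N%:R by [].
have NL : 1 <= N%:R ^+ 2 * Lam.
  have : K ^+ 8 * Lam <= N%:R ^+ 2 * Lam * Lam.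
    apply: le_trans KN _; rewrite exprMn -mulrA ler_wpM2l ?exprn_ge0//.
    by rewrite -expr2 ler_sqr ?nnegrE// ltW.
  rewrite ler_pM2r//; apply: le_trans.
  by rewrite -{1}(expr1n _ 8) lerXn2r ?nnegrE//; lra.
have aN : a <= N%:R.
  apply: le_sqr_le => //.
  by rewrite -(ler_pM2r L0); exact: le_trans NL.
have HN : (H <= N)%N by rewrite -(ler_nat R).
have aL16 : a * Lam <= 16^-1.
  apply: le_sqr_le; first lra.
  have -> : 16^-1 ^+ 2 = 256^-1 :> R by field.
  apply: le_trans L256; have -> : (a * Lam) ^+ 2 = a ^+ 2 * Lam * Lam by ring.
  by rewrite ler_piMl// ltW.
have aNl : K ^+ 4 <= 2 * a * N%:R * lam.
  apply: le_sqr_le; first by rewrite !mulr_ge0//; lra.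
  rewrite -K8 -mulrA exprMn.
  apply: le_trans (_ : (2 * a) ^+ 2 * (K ^+ 8 * Lam) <= _); last first.
    by apply: ler_wpM2l => //; rewrite sqr_ge0.
  have K80 : 0 <= K ^+ 8 by lra.
  have := ler_wpM2l K80 aL'; rewrite mulr1 => h; apply: le_trans h _.
  by rewrite le_eqVlt; apply/orP; left; apply/eqP; ring.
pose D := Num.truncn (a / K ^+ 2); pose b : R := D%:R.
have aK1 : 1 <= a / K ^+ 2 by rewrite ler_pdivlMr; lra.
have /andP[ba ab] : b <= a / K ^+ 2 < b + 1 by rewrite natr1; apply: truncn_itv; lra.
have D0 : (0 < D)%N by rewrite truncn_gt0.
have b1 : 1 <= b by rewrite ler1n.
have baK : b * K ^+ 2 <= a by rewrite -ler_pdivlMr//; lra.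
have abK : a <= 2 * b * K ^+ 2 by rewrite -ler_pdivrMr//; lra.
have ba' : b <= a by nra.
have DH : (D <= H)%N by rewrite -(ler_nat R).
have Sd d : (D <= d < H)%N ->
    cmod (expsum (fun i => g (i + d)%N - g i) (n - d)) <= 5 / (b * lam).
  move=> /andP[Dd dH].
  have d0 : (0 : R) < d%:R by rewrite ltr0n (leq_trans D0 Dd).
  have bd : b <= d%:R by rewrite ler_nat.
  have da : d%:R <= a by rewrite ler_nat ltnW.
  apply: le_trans (_ : 5 / (d%:R * lam) <= _); last first.
    rewrite ler_pM2l// lef_pV2 ?posrE ?mulr_gt0//; last lra.
    by rewrite ler_pM2r.
  apply: kusmin_landau; first by rewrite mulr_gt0.
    move=> m mn; have /andP[h1 h2] :=
      @iter_fdiff_shift_bounds 1 g d n lam Lam hg m mn.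
    rewrite h1/=; apply: le_trans h2 _; apply: le_trans aL16.
    by rewrite ler_pM2r.
  exact: (@iter_fdiff_shift_sign 2 g d n hs).
have := @vdc_expsum g n N H nN (introT andP (conj H0 HN)).
set S := \sum_(_ <= _ < _) _ => hS.
have Sle : S <= b * N%:R + a * (5 / (b * lam)).
  rewrite /S (@big_cat_nat _ _ _ D)//=; apply: lerD.
    apply: le_trans (_ : \sum_(1 <= d < D) N%:R <= _).
      apply: ler_sum => d _; apply: le_trans (expsum_le _ _) _.
      by rewrite ler_nat (leq_trans (leq_subr _ _)).
    by rewrite sumr_const_nat -[leLHS]mulr_natl ler_wpM2r// ler_nat leq_subr.
  apply: le_trans (_ : \sum_(D <= d < H) 5 / (b * lam) <= _).
    by rewrite !big_nat; apply: ler_sum => d hd; exact: Sd.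
  rewrite sumr_const_nat -[leLHS]mulr_natl ler_wpM2r// ?ler_nat ?leq_subr//.
  by rewrite divr_ge0// mulr_ge0//; lra.
apply: le_sqr_le; first by rewrite divr_ge0 ?mulr_ge0//; lra.
apply: le_trans hS _; apply: (@vdc_arith _ a b K lam) => //.
- by lra.
- by lra.
Qed.

(* Each differencing step uses about K^2 shifts and requires a saving K^2 from
   the previous order. *)
Lemma derivative_test l : exists (q : nat) (c : R), 0 <= c /\
  forall g n N K lam Lam, 2 <= K -> (n <= N)%N -> 0 < lam -> lam <= Lam ->
    K ^+ q * Lam <= 1 -> K ^+ q * Lam <= (N%:R * lam) ^+ 2 ->
    (forall m, (m < n)%N -> lam <= iter l.+2 (@fdiff R) g m <= Lam) ->
    same_sign n (iter l.+3 (@fdiff R) g) ->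
    cmod (expsum g n) <= c * N%:R / K.
Proof.
elim: l => [|l [q [c [c0 IH]]]].
  by exists 8%N, 10; split=> // *; apply: second_derivative_test; eassumption.
(* [2 * q] and a factor [a <= K^3] serve the inductive hypothesis at [K^2] and [a * Lam]; the full 6
   gives [K^6 <= N^2], so that there are at most [N] shifts. *)
exists (2 * q + 6)%N, (2 + 4 * c); split; first lra.
move=> g n N K lam Lam K2 nN lam0 lamL K1 KN hg hs.
have L0 : 0 < Lam by exact: lt_le_trans lamL.
have K0 : 0 < K by lra.
have K4 : 4 <= K ^+ 2 by nra.
have Kge1 : 1 <= K by lra.
pose H := (Num.truncn (K ^+ 2)).+1; pose a : R := H%:R.
have /andP[aK Ka] : (a - 1 <= K ^+ 2 < a).
  by rewrite /a /H -natr1 addrK natr1; apply: truncn_itv; lra.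
have aK3 : a <= K ^+ 3 by rewrite [K ^+ 3]exprS; nra.
have a1 : 1 <= a by rewrite ler1n.
have Lle1 : Lam <= 1.
  apply: le_trans K1; rewrite ler_peMl ?exprn_ege1//; exact: ltW.
have KqL x : (x <= 2 * q + 6)%N -> K ^+ x <= K ^+ (2 * q + 6).
  by move=> hx; rewrite ler_weXn2l.
have N0 : (0 : R) <= N%:R by [].
have KN2 : K ^+ (2 * q + 6) <= N%:R ^+ 2.
  rewrite -(ler_pM2r L0); apply: le_trans KN _.
  rewrite exprMn ler_wpM2l ?exprn_ge0//; nra.
have K3N : K ^+ 3 <= N%:R.
  apply: le_sqr_le => //.
  by rewrite -exprM; apply: le_trans KN2; apply: KqL; exact: leq_addl.
have HN : (0 < H <= N)%N.
  by apply/andP; split => //; rewrite -(ler_nat R); exact: le_trans aK3 K3N.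
have KaL : (K ^+ 2) ^+ q * (a * Lam) <= K ^+ (2 * q + 6) * Lam.
  rewrite mulrA ler_pM2r// -exprM.
  apply: le_trans (_ : K ^+ (2 * q + 3) <= _); last by apply: KqL; rewrite leq_add2l.
  by rewrite exprD ler_pM2l// exprn_gt0.
have Sd d : (0 < d < H)%N ->
    cmod (expsum (fun i => g (i + d)%N - g i) (n - d)) <= c * N%:R / K ^+ 2.
  move=> /andP[d0 dH].
  have d1 : (1 : R) <= d%:R by rewrite ler1n.
  have da : d%:R <= a by rewrite ler_nat ltnW.
  (* A shift by [d] multiplies both bounds by [d]; the values 1 <= d <= a are covered at once by
     [lam] and [a * Lam]. *)
  apply: (IH _ _ N _ lam (a * Lam)) => //.
  - by lra.
  - exact: leq_trans (leq_subr _ _) nN.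
  - by nra.
  - exact: le_trans K1.
  - exact: le_trans KN.
  - move=> m mn; have /andP[h1 h2] :=
      @iter_fdiff_shift_bounds l.+2 g d n lam Lam hg m mn.
    apply/andP; split; first by apply: le_trans h1; nra.
    by apply: le_trans h2 _; rewrite ler_pM2r.
  - exact: (@iter_fdiff_shift_sign l.+3 g d n hs).
have := @vdc_expsum g n N H nN HN.
set S := \sum_(_ <= _ < _) _ => hS.
have Sle : S <= a * (c * N%:R / K ^+ 2).
  apply: le_trans (_ : \sum_(1 <= d < H) c * N%:R / K ^+ 2 <= _).
    by rewrite /S !big_nat; apply: ler_sum => d hd; exact: Sd.
  rewrite sumr_const_nat -[leLHS]mulr_natl ler_wpM2r// ?ler_nat ?leq_subr//.
  by rewrite divr_ge0 ?mulr_ge0//; lra.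
apply: le_sqr_le; first by rewrite divr_ge0 ?mulr_ge0//; lra.
apply: le_trans hS _.
have a0 : 0 < a by lra.
apply: le_trans (_ : 2 * N%:R / a * (N%:R + 2 * (a * (c * N%:R / K ^+ 2))) <= _).
  apply: ler_wpM2l; first by rewrite divr_ge0 ?mulr_ge0//; lra.
  by lra.
have -> : 2 * N%:R / a * (N%:R + 2 * (a * (c * N%:R / K ^+ 2))) =
  2 * N%:R ^+ 2 / a + 4 * c * (N%:R ^+ 2 / K ^+ 2).
  by field; rewrite !gt_eqF.
have -> : ((2 + 4 * c) * N%:R / K) ^+ 2 = (2 + 4 * c) ^+ 2 * (N%:R ^+ 2 / K ^+ 2).
  by field; rewrite gt_eqF.
set T := N%:R ^+ 2 / K ^+ 2.
have T0 : 0 <= T by rewrite divr_ge0 ?exprn_ge0//; lra.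
have -> : 2 * N%:R ^+ 2 / a = 2 * (N%:R ^+ 2 / a) by ring.
have : N%:R ^+ 2 / a <= T.
  by rewrite ler_wpM2l ?exprn_ge0// lef_pV2 ?posrE//; lra.
have : (2 + 4 * c) * T <= (2 + 4 * c) ^+ 2 * T by rewrite ler_wpM2r//; nra.
by lra.
Qed.

End DerivativeTest.

(** * Hardy fields of functions *)

Section HardyFieldOfFunctions.
Variable R : realType.
Implicit Types (f g h u v y : R -> R) (K : set (R -> R)).

(* Closure under pointwise inversion also covers germs that vanish, as 0^-1 = 0. *)
Record hfield K : Prop := HField {
  hf_ev : forall f g, K f -> (\forall t \near +oo, f t = g t) -> K g;
  hf_1 : K (fun=> 1);
  hf_B : forall f g, K f -> K g -> K (fun t => f t - g t);
  hf_M : forall f g, K f -> K g -> K (fun t => f t * g t);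
  hf_V : forall f, K f -> K (fun t => (f t)^-1);
  hf_D : forall f, K f -> K (derive1 f);
  hf_dv : forall f, K f -> \forall t \near +oo, is_derive t (1 : R) f (derive1 f t);
  hf_sgn : forall f, K f -> [\/ \forall t \near +oo, f t = 0,
    \forall t \near +oo, 0 < f t | \forall t \near +oo, f t < 0] }.

Lemma near_pinfty (P : R -> Prop) :
  (\forall t \near +oo, P t) <-> exists T, forall t, T <= t -> P t.
Proof.
split=> [[M [_ hM]]|[T hT]].
  by exists (M + 1) => t Mt; apply: hM; rewrite (lt_le_trans _ Mt)// ltrDl.
by exists T; split; rewrite ?num_real// => t /ltW; exact: hT.
Qed.

Lemma nbhs_gt (a t : R) : a < t -> \forall s \near t, a < s.
Proof.
rewrite -ltrN2 => /Nlt_nbhsl; apply: filterS => s.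
by rewrite ltrN2.
Qed.

Lemma derive1E_is f t a : is_derive t (1 : R) f a -> derive1 f t = a.
Proof. by move=> h; rewrite derive1E; exact: (@derive_val _ _ _ _ _ _ _ h). Qed.

Lemma is_derive_near_eq f g t a : (\near t, f t = g t) ->
  is_derive t (1 : R) f a -> is_derive t (1 : R) g a.
Proof. exact: near_eq_is_derive. Qed.

Lemma near_is_derive_eq f g (a : R -> R) : (\forall t \near +oo, f t = g t) ->
  (\forall t \near +oo, is_derive t (1 : R) f (a t)) ->
  \forall t \near +oo, is_derive t (1 : R) g (a t).
Proof.
move/near_pinfty => [T hT] /near_pinfty[T' hT'].
(* Beyond T + 1, the functions agree on a whole neighbourhood of t, as a statement on derivatives
   requires. *)
apply/near_pinfty; exists (Num.max (T + 1) T') => t; rewrite ge_max => /andP[h1 h2].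
apply: is_derive_near_eq (hT' _ h2).
near=> s; apply: hT; apply/ltW.
near: s; apply: nbhs_gt; rewrite (lt_le_trans _ h1)// ltrDl//.
Unshelve. all: by end_near. Qed.

Lemma is_deriveE f t a b : is_derive t (1 : R) f a -> a = b -> is_derive t (1 : R) f b.
Proof. by move=> h <-. Qed.

Lemma is_derive_cst1 (c t : R) : is_derive t (1 : R) (fun=> c) 0.
Proof. exact: is_derive_cst. Qed.

Lemma is_derive_B1 f g t a b : is_derive t (1 : R) f a ->
  is_derive t (1 : R) g b -> is_derive t (1 : R) (fun s => f s - g s) (a - b).
Proof. by move=> hf hg; exact: is_deriveB. Qed.

Lemma is_derive_N1 f t a : is_derive t (1 : R) f a ->
  is_derive t (1 : R) (fun s => - f s) (- a).
Proof. by move=> hf; exact: is_deriveN. Qed.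

Lemma is_derive_D1 f g t a b : is_derive t (1 : R) f a ->
  is_derive t (1 : R) g b -> is_derive t (1 : R) (fun s => f s + g s) (a + b).
Proof. by move=> hf hg; exact: is_deriveD. Qed.

Lemma is_derive_M1 f g t a b : is_derive t (1 : R) f a ->
  is_derive t (1 : R) g b ->
  is_derive t (1 : R) (fun s => f s * g s) (a * g t + f t * b).
Proof.
move=> hf hg; apply: is_deriveE (is_deriveM hf hg) _.
by rewrite /GRing.scale/=; ring.
Qed.

Lemma is_derive_X1 f n t a : is_derive t (1 : R) f a ->
  is_derive t (1 : R) (fun s => f s ^+ n.+1) (n.+1%:R * a * f t ^+ n).
Proof.
move=> hf; elim: n => [|n IH].
  by rewrite mul1r expr0 mulr1.
have -> : (fun s => f s ^+ n.+2) = (fun s => f s * f s ^+ n.+1).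
  by apply/funext => s; rewrite exprS.
apply: is_deriveE (is_derive_M1 hf IH) _.
by rewrite -[n.+2%:R]natr1 !exprS; ring.
Qed.

Lemma is_derive_V1 f t a : f t != 0 -> is_derive t (1 : R) f a ->
  is_derive t (1 : R) (fun s => (f s)^-1) (- a / f t ^+ 2).
Proof.
move=> f0 hf; apply: is_deriveE (is_deriveV f0 hf) _.
by rewrite /GRing.scale/=; ring.
Qed.

Lemma MVT_is_derive f g (s t : R) : s <= t ->
  (forall x : R, s <= x <= t -> is_derive x (1 : R) f (g x)) ->
  exists2 c, s <= c <= t & f t - f s = g c * (t - s).
Proof.
move=> st hf; have [||c] := @MVT_segment R f g s t st.
- by move=> x; rewrite in_itv/= => /andP[h1 h2]; apply: hf; rewrite !ltW.
- apply: derivable_within_continuous => x; rewrite in_itv/= => /hf h.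
  exact: ex_derive.
- by rewrite in_itv/=; exists c.
Qed.

Lemma near_nondecreasing f g :
  (\forall t \near +oo, is_derive t (1 : R) f (g t)) ->
  (\forall t \near +oo, 0 <= g t) ->
  exists T, forall s t, T <= s -> s <= t -> f s <= f t.
Proof.
move=> /near_pinfty[T hT] /near_pinfty[T' hT'].
exists (Num.max T T') => s t; rewrite ge_max => /andP[Ts T's] st.
rewrite -subr_ge0; have [x /andP[sx _]|c /andP[sc _] ->] := @MVT_is_derive f g _ _ st.
  by apply: hT; exact: le_trans Ts sx.
by rewrite mulr_ge0 ?subr_ge0// hT'// (le_trans T's).
Qed.

Definition near_sgn f := [\/ \forall t \near +oo, f t = 0,
    \forall t \near +oo, 0 < f t | \forall t \near +oo, f t < 0].

Lemma near_sgnN f : near_sgn (fun t => - f t) -> near_sgn f.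
Proof.
case=> h; [apply: Or31|apply: Or33|apply: Or32]; apply: filterS h => t.
- by move/eqP; rewrite oppr_eq0 => /eqP.
- by rewrite oppr_gt0.
- by rewrite oppr_lt0.
Qed.

Lemma near_sgnM f g : near_sgn f -> near_sgn g -> near_sgn (fun t => f t * g t).
Proof.
case=> hf; first by move=> _; apply: Or31; apply: filterS hf => t ->; rewrite mul0r.
  case=> hg; [apply: Or31|apply: Or32|apply: Or33]; apply: filterS2 hf hg => t f0.
  - by move=> ->; rewrite mulr0.
  - by rewrite pmulr_rgt0.
  - by rewrite pmulr_rlt0.
case=> hg; [apply: Or31|apply: Or33|apply: Or32]; apply: filterS2 hf hg => t f0.
- by move=> ->; rewrite mulr0.
- by rewrite nmulr_rlt0.
- by rewrite nmulr_rgt0.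
Qed.

Lemma near_sgnV f : near_sgn f -> near_sgn (fun t => (f t)^-1).
Proof.
case=> h; [apply: Or31|apply: Or32|apply: Or33]; apply: filterS h => t.
- by move=> ->; rewrite invr0.
- by rewrite invr_gt0.
- by rewrite invr_lt0.
Qed.

Lemma near_sgn_eq f g : (\forall t \near +oo, f t = g t) -> near_sgn f -> near_sgn g.
Proof.
move=> fg; case=> h; [apply: Or31|apply: Or32|apply: Or33]; near=> t.
all: by rewrite -(near fg t)//; apply: (near h t).
Unshelve. all: by end_near. Qed.

(** Once positive, f stays positive. If it is never positive, a single zero forces zeros ever after,
    and without zeros it is negative throughout. *)
Lemma nondecreasing_near_sgn f T :
  (forall s t, T <= s -> s <= t -> f s <= f t) -> near_sgn f.
Proof.
move=> hf; have [[s Ts fs]|h] := pselect (exists2 s, T <= s & 0 < f s).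
  apply: Or32; apply/near_pinfty; exists s => t st.
  exact: lt_le_trans fs (hf _ _ Ts st).
have hle t : T <= t -> f t <= 0.
  by move=> Tt; rewrite leNgt; apply/negP => ft; apply: h; exists t.
have [[s Ts fs]|h'] := pselect (exists2 s, T <= s & f s = 0).
  apply: Or31; apply/near_pinfty; exists s => t st; apply/eqP.
  by rewrite eq_le hle ?(le_trans Ts)//= -fs hf.
apply: Or33; apply/near_pinfty; exists T => t Tt.
by rewrite lt_neqAle hle// andbT; apply/eqP => ft; apply: h'; exists t.
Qed.

Lemma derive_near_sgn f g :
  (\forall t \near +oo, is_derive t (1 : R) f (g t)) -> near_sgn g -> near_sgn f.
Proof.
move=> fg; case=> h.
- have [|T hT] := near_nondecreasing fg; last exact: nondecreasing_near_sgn hT.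
  by apply: filterS h => t ->.
- have [|T hT] := near_nondecreasing fg; last exact: nondecreasing_near_sgn hT.
  by apply: filterS h => t; exact: ltW.
- apply: near_sgnN; have := @near_nondecreasing (fun t => - f t) (fun t => - g t).
  case=> [||T hT]; last exact: nondecreasing_near_sgn hT.
    apply: filterS fg => t ht.
    exact: is_derive_N1.
  by apply: filterS h => t; rewrite oppr_ge0; exact: ltW.
Qed.

Section Closure.
Variables (K : set (R -> R)) (HK : hfield K).

Lemma hf_0 : K (fun=> 0).
Proof.
apply: (hf_ev HK) (hf_B HK (hf_1 HK) (hf_1 HK)) _.
by near=> t; rewrite subrr.
Unshelve. all: by end_near. Qed.

Lemma hf_N f : K f -> K (fun t => - f t).
Proof.
move=> Kf; apply: (hf_ev HK) (hf_B HK hf_0 Kf) _.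
by near=> t; rewrite sub0r.
Unshelve. all: by end_near. Qed.

Lemma hf_add f g : K f -> K g -> K (fun t => f t + g t).
Proof.
move=> Kf Kg; apply: (hf_ev HK) (hf_B HK Kf (hf_N Kg)) _.
by near=> t; rewrite opprK.
Unshelve. all: by end_near. Qed.

Lemma hf_nat n : K (fun=> n%:R).
Proof.
elim: n => [|n IH]; first exact: hf_0.
apply: (hf_ev HK) (hf_add IH (hf_1 HK)) _.
by near=> t; rewrite natr1.
Unshelve. all: by end_near. Qed.

Lemma hf_X f n : K f -> K (fun t => f t ^+ n).
Proof.
move=> Kf; elim: n => [|n IH].
  by apply: (hf_ev HK) (hf_1 HK) _; near=> t; rewrite expr0.
apply: (hf_ev HK) (hf_M HK Kf IH) _.
by near=> t; rewrite exprS.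
Unshelve. all: by end_near. Qed.

Lemma hf_Dn f n : K f -> K (derive1n n f).
Proof. by move=> Kf; elim: n => // n IH; rewrite derive1nS; exact: hf_D. Qed.

End Closure.

(** * Adjoining a primitive to a Hardy field *)

Section PrimitiveExtension.
Variables (K : set (R -> R)) (HK : hfield K) (y a : R -> R).
Hypotheses (Ka : K a) (ya : \forall t \near +oo, is_derive t (1 : R) y (a t)).

(** Polynomials in [y] of degree at most [n] over [K], taken as functions near infinity: [y] may be
    algebraic over [K], and the leading coefficient may vanish. *)
Fixpoint primpoly n g : Prop := if n is n'.+1 then
  exists h c, [/\ primpoly n' h, K c & \forall t \near +oo, g t = h t + c t * y t ^+ n'.+1]
  else K g.

Lemma primpoly_ev n f g : (\forall t \near +oo, f t = g t) -> primpoly n f -> primpoly n g.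
Proof.
case: n => [|n] fg; first by move=> Kf; exact: (hf_ev HK) Kf fg.
move=> [h [c [Ph Kc E]]]; exists h, c; split => //.
by apply: filterS2 fg E => t <-.
Qed.

Lemma primpolyS n f : primpoly n f -> primpoly n.+1 f.
Proof.
move=> Pf; exists f, (fun=> 0); split => //; first exact: (hf_0 HK).
by near=> t; rewrite mul0r addr0.
Unshelve. all: by end_near. Qed.

Lemma primpolyD n f g : primpoly n f -> primpoly n g -> primpoly n (fun t => f t + g t).
Proof.
elim: n f g => [|n IH] f g; first exact: (hf_add HK).
move=> [h [c [Ph Kc E]]] [h' [c' [Ph' Kc' E']]].
exists (fun t => h t + h' t), (fun t => c t + c' t); split.
- exact: IH.
- exact: (hf_add HK).
- by apply: filterS2 E E' => t -> ->; ring.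
Qed.

Lemma primpolyKM n c f : K c -> primpoly n f -> primpoly n (fun t => c t * f t).
Proof.
move=> Kc; elim: n f => [|n IH] f; first exact: (hf_M HK).
move=> [h [d [Ph Kd E]]].
exists (fun t => c t * h t), (fun t => c t * d t); split.
- exact: IH.
- exact: (hf_M HK).
- by apply: filterS E => t ->; ring.
Qed.

Lemma primpoly_My n f : primpoly n f -> primpoly n.+1 (fun t => f t * y t).
Proof.
elim: n f => [|n IH] f.
  move=> Kf; exists (fun=> 0), f; split => //; first exact: (hf_0 HK).
  by near=> t; rewrite add0r expr1.
move=> [h [c [Ph Kc E]]].
exists (fun t => h t * y t), c; split => //; first exact: IH.
by apply: filterS E => t ->; rewrite exprS [in RHS]exprS exprS; ring.
Unshelve. all: by end_near. Qed.

Lemma primpoly_MyX n f k : primpoly n f -> primpoly (n + k) (fun t => f t * y t ^+ k).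
Proof.
move=> Pf; elim: k => [|k IH].
  by rewrite addn0; apply: primpoly_ev Pf; near=> t; rewrite mulr1.
rewrite addnS; apply: primpoly_ev (primpoly_My IH).
by near=> t; rewrite exprSr mulrA.
Unshelve. all: by end_near. Qed.

Lemma primpolyM m n f g : primpoly m f -> primpoly n g -> primpoly (m + n) (fun t => f t * g t).
Proof.
move=> Pf; elim: n g => [|n IH] g.
  move=> Kg; rewrite addn0; apply: primpoly_ev (primpolyKM Kg Pf).
  by near=> t; rewrite mulrC.
move=> [h [c [Ph Kc E]]].
have P1 : primpoly (m + n.+1) (fun t => f t * h t) by rewrite addnS; apply/primpolyS/IH.
apply: primpoly_ev (primpolyD P1 (primpolyKM Kc (primpoly_MyX n.+1 Pf))).
by apply: filterS E => t ->; ring.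
Unshelve. all: by end_near. Qed.

Lemma primpoly_X n c : K c -> primpoly n (fun t => c t * y t ^+ n).
Proof. by move=> Kc; rewrite -[X in primpoly X]add0n; exact: primpoly_MyX. Qed.

Lemma primpoly_derive_monomial n c : K c ->
  primpoly n (fun t => c t * (n.+1%:R * a t * y t ^+ n)).
Proof.
move=> Kc; apply: primpoly_ev (primpoly_X n (hf_M HK Kc (hf_M HK (hf_nat HK n.+1) Ka))).
by near=> t; ring.
Unshelve. all: by end_near. Qed.

(** Differentiating a power of [y] brings out [a], which lies in [K], so the degree does not
    grow. *)
Lemma primpoly_derive n f : primpoly n f ->
  exists2 f', primpoly n f' & \forall t \near +oo, is_derive t (1 : R) f (f' t).
Proof.
elim: n f => [|n IH] f.
  by move=> Kf; exists (derive1 f); [exact: (hf_D HK)|exact: (hf_dv HK)].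
move=> [h [c [Ph Kc E]]]; have [h' Ph' Dh] := IH _ Ph.
exists (fun t => h' t + (derive1 c t * y t ^+ n.+1 +
                         c t * (n.+1%:R * a t * y t ^+ n))).
  apply: primpolyD; first exact: primpolyS.
  apply: primpolyD; first by apply: primpoly_X; exact: (hf_D HK).
  by apply: primpolyS; exact: primpoly_derive_monomial.
apply: (@near_is_derive_eq (fun t => h t + c t * y t ^+ n.+1)).
  by apply: filterS E => t ->.
have Dc := hf_dv HK Kc.
near=> t; apply: is_derive_D1; first exact: (near Dh t).
apply: is_derive_M1; first exact: (near Dc t).
by apply: is_derive_X1; exact: (near ya t).
Unshelve. all: by end_near. Qed.

(* Dividing by the leading coefficient leaves a monic polynomial in y, whose
   derivative has smaller degree. *)
Lemma primpoly_sgn n f : primpoly n f -> near_sgn f.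
Proof.
elim: n f => [|n IH] f; first exact: (hf_sgn HK).
move=> [h [c [Ph Kc E]]].
have c_neq0 : (\forall t \near +oo, c t != 0) -> near_sgn f.
  move=> c0; pose u t := (c t)^-1 * h t + y t ^+ n.+1.
  have [v Pv Dv] := primpoly_derive (primpolyKM (hf_V HK Kc) Ph).
  have Du : \forall t \near +oo, is_derive t (1 : R) u (v t + n.+1%:R * a t * y t ^+ n).
    near=> t; apply: is_derive_D1; first exact: (near Dv t).
    by apply: is_derive_X1; exact: (near ya t).
  have su : near_sgn u.
    apply: derive_near_sgn Du _; apply: IH; apply: primpolyD => //.
    apply: primpoly_ev (primpoly_derive_monomial n (hf_1 HK)).
    by near=> t; rewrite mul1r.
  apply: near_sgn_eq (near_sgnM (hf_sgn HK Kc) su).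
  by apply: filterS2 c0 E => t c0 ->; rewrite /u; field.
case: (hf_sgn HK Kc) => sc.
- apply: (near_sgn_eq _ (IH _ Ph)).
  by apply: filterS2 sc E => t -> ->; rewrite mul0r addr0.
- by apply: c_neq0; apply: filterS sc => t; rewrite lt0r => /andP[].
- by apply: c_neq0; apply: filterS sc => t; rewrite lt_neqAle => /andP[].
Unshelve. all: by end_near. Qed.

Definition adjoin : set (R -> R) := [set f | exists n p q, [/\ primpoly n p, primpoly n q,
  \forall t \near +oo, q t != 0 & \forall t \near +oo, f t = p t / q t]].

Lemma adjoin_sub : K `<=` adjoin.
Proof.
move=> f Kf; exists 0%N, f, (fun=> 1); split => //; first exact: (hf_1 HK).
  by near=> t; rewrite oner_eq0.
by near=> t; rewrite divr1.
Unshelve. all: by end_near. Qed.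

Lemma adjoin_gen : adjoin y.
Proof.
exists 1%N, y, (fun=> 1); split.
- exists (fun=> 0), (fun=> 1); split; [exact: (hf_0 HK)|exact: (hf_1 HK)|].
  by near=> t; rewrite add0r mul1r expr1.
- by apply: primpolyS; exact: (hf_1 HK).
- by near=> t; rewrite oner_eq0.
- by near=> t; rewrite divr1.
Unshelve. all: by end_near. Qed.

Lemma primpolyB n f g : primpoly n f -> primpoly n g -> primpoly n (fun t => f t - g t).
Proof.
move=> Pf Pg; have K1 := hf_N HK (hf_1 HK).
apply: primpoly_ev (primpolyD Pf (primpolyKM K1 Pg)).
by near=> t; rewrite mulN1r.
Unshelve. all: by end_near. Qed.

Lemma adjoin_derive f : adjoin f ->
  exists2 f', adjoin f' & \forall t \near +oo, is_derive t (1 : R) f (f' t).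
Proof.
move=> [n [p [q [Pp Pq q0 E]]]].
have [p' Pp' Dp] := primpoly_derive Pp; have [q' Pq' Dq] := primpoly_derive Pq.
exists (fun t => (p' t * q t - p t * q' t) / (q t * q t)).
  exists (n + n)%N, (fun t => p' t * q t - p t * q' t), (fun t => q t * q t).
  split.
  - by apply: primpolyB; exact: primpolyM.
  - exact: primpolyM.
  - by apply: filterS q0 => t; rewrite mulf_eq0 orbb.
  - by near=> t.
apply: (@near_is_derive_eq (fun t => p t * (q t)^-1)).
  by apply: filterS E => t ->.
near=> t; have qt0 : q t != 0 by exact: (near q0 t).
apply: (is_deriveE (is_derive_M1 (near Dp t _) (is_derive_V1 qt0 (near Dq t _)))) => //.
by field.
Unshelve. all: by end_near. Qed.

Lemma adjoin_ev f g : adjoin f -> (\forall t \near +oo, f t = g t) -> adjoin g.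
Proof.
move=> [n [p [q [Pp Pq q0 E]]]] fg; exists n, p, q; split => //.
by apply: filterS2 E fg => t <-.
Qed.

Lemma hfield_adjoin : hfield adjoin.
Proof.
split.
- exact: adjoin_ev.
- exact/adjoin_sub/(hf_1 HK).
- move=> f g [n [p [q [Pp Pq q0 E]]]] [n' [p' [q' [Pp' Pq' q0' E']]]].
  exists (n + n')%N, (fun t => p t * q' t - q t * p' t), (fun t => q t * q' t).
  split; [by apply: primpolyB; exact: primpolyM|exact: primpolyM| |].
    by apply: filterS2 q0 q0' => t; exact: mulf_neq0.
  near=> t; rewrite (near E t)// (near E' t)//; field.
  by rewrite (near q0 t)// (near q0' t).
- move=> f g [n [p [q [Pp Pq q0 E]]]] [n' [p' [q' [Pp' Pq' q0' E']]]].
  exists (n + n')%N, (fun t => p t * p' t), (fun t => q t * q' t).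
  split; [exact: primpolyM|exact: primpolyM| |].
    by apply: filterS2 q0 q0' => t; exact: mulf_neq0.
  near=> t; rewrite (near E t)// (near E' t)//; field.
  by rewrite (near q0 t)// (near q0' t).
- move=> f [n [p [q [Pp Pq q0 E]]]].
  (* A numerator with arbitrarily large zeros that is not eventually zero would obstruct inversion;
     [primpoly_sgn] excludes it. *)
  have inv : (\forall t \near +oo, p t != 0) -> adjoin (fun t => (f t)^-1).
    move=> p0; exists n, q, p; split => //.
    by apply: filterS E => t ->; rewrite invf_div.
  case: (primpoly_sgn Pp) => sp.
  + apply: adjoin_ev (adjoin_sub (hf_0 HK)) _.
    by apply: filterS2 sp E => t -> ->; rewrite mul0r invr0.
  + by apply: inv; apply: filterS sp => t; rewrite lt0r => /andP[].
  + by apply: inv; apply: filterS sp => t; rewrite lt_neqAle => /andP[].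
- move=> f /adjoin_derive[f' Af' Df]; apply: adjoin_ev Af' _.
  by apply: filterS Df => t; move/derive1E_is.
- move=> f /adjoin_derive[f' Af' Df].
  by apply: filterS Df => t ht; rewrite (derive1E_is ht).
- move=> f [n [p [q [Pp Pq q0 E]]]].
  apply: near_sgn_eq (near_sgnM (primpoly_sgn Pp) (near_sgnV (primpoly_sgn Pq))).
  by apply: filterS E => t ->.
Unshelve. all: by end_near. Qed.

End PrimitiveExtension.

Lemma hfield_primitive K y a : hfield K -> K a ->
  (\forall t \near +oo, is_derive t (1 : R) y (a t)) ->
  exists L, [/\ hfield L, K `<=` L & L y].
Proof.
move=> HK Ka ya; exists (adjoin K y); split.
- exact: (hfield_adjoin HK Ka ya).
- exact: adjoin_sub.
- exact: adjoin_gen.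
Qed.

End HardyFieldOfFunctions.

(** * From derivatives to finite differences *)

Section FiniteDifferences.
Variable R : realType.

Lemma iter_fdiff_addn (g : nat -> R) M l m :
  iter l (@fdiff R) (fun i => g (i + M)%N) m = iter l (@fdiff R) g (m + M)%N.
Proof. by elim: l m => // l IH m; rewrite !iterS /fdiff !IH. Qed.

(** The difference of order l is a value of the derivative of order l on [m, m + l]; a predicate [P]
    serves size and sign alike. The induction passes to the increments [D i (t + 1) - D i t], the
    last of which is a value of the next derivative by the mean value theorem. *)
Lemma iter_fdiff_derive (D : nat -> R -> R) l m (P : R -> Prop) :
  (forall i (t : R), (i < l)%N -> m%:R <= t <= (m + l)%:R ->
     is_derive t (1 : R) (D i) (D i.+1 t)) ->
  (forall t : R, m%:R <= t <= (m + l)%:R -> P (D l t)) ->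
  P (iter l (@fdiff R) (fun n => D 0%N n%:R) m).
Proof.
elim: l D => [|l IH] D hD hb; first by apply: hb; rewrite addn0 lexx.
rewrite iterSr.
have -> : fdiff (fun n => D 0%N n%:R) = (fun n => D 0%N (n%:R + 1) - D 0%N n%:R).
  by apply/funext => n; rewrite /fdiff natr1.
have tl1 (t : R) : m%:R <= t <= (m + l)%:R -> m%:R <= t + 1 <= (m + l.+1)%:R.
  by rewrite addnS -[(m + l).+1%:R]natr1; lra.
have tl (t : R) : m%:R <= t <= (m + l)%:R -> m%:R <= t <= (m + l.+1)%:R.
  by rewrite addnS -[(m + l).+1%:R]natr1; lra.
apply: (IH (fun i t => D i (t + 1) - D i t)).
  move=> i t il ht; apply: is_deriveB; last first.
    by apply: hD; [exact: ltnW|exact: tl].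
  have h := hD i (t + 1) (ltnW il) (tl1 _ ht).
  have s : is_derive t (1 : R) (fun t : R => t + 1) 1.
    have := is_derive_D1 (is_derive_id t (1 : R)) (is_derive_cst1 1 t).
    by move=> s; apply: is_deriveE s _; rewrite addr0.
  have := @is_derive1_comp R (D i) (fun t => t + 1) t _ _ h s.
  by rewrite mulr1.
move=> t ht; have t1 : t <= t + 1 by lra.
have [x hx|c hc ->] := @MVT_is_derive R (D l) (D l.+1) _ _ t1.
  apply: hD => //; move: ht (tl1 _ ht); lra.
rewrite addrAC subrr add0r mulr1; apply: hb; move: ht (tl1 _ ht); lra.
Qed.

End FiniteDifferences.

(** * Comparison of derivatives *)

Section Asymptotics.
Variable R : realType.
Implicit Types (f g h u v w y : R -> R).

Lemma near_ge (A : R) : \forall t \near +oo, A <= t.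
Proof. by apply/near_pinfty; exists A. Qed.

Lemma near_ln (P : R -> Prop) :
  (\forall t \near +oo, P t) -> \forall t \near +oo, P (ln t).
Proof.
move=> /near_pinfty[T hT]; apply/near_pinfty; exists (expR T) => t Tt.
by apply: hT; rewrite -[T]expRK ler_ln// posrE ?expR_gt0// (lt_le_trans (expR_gt0 T)).
Qed.

Lemma near_absurd (P Q : R -> Prop) : (\forall t \near +oo, P t) ->
  (\forall t \near +oo, Q t) -> (forall t, P t -> Q t -> False) -> False.
Proof.
move=> hP hQ h; have [t [Pt Qt]] : exists t : R, P t /\ Q t.
  by apply: (@filter_ex _ (pinfty_nbhs R)); exact: filterI.
exact: h Pt Qt.
Qed.

(** Write t = exp y and z = y / (2 (p+1)). For y >= 4 (p+1)^2 one has y <= z^2 <= (exp z)^2, and the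
    power p + 1 of the right side is t. Using p + 1 avoids a division by zero. *)
Lemma pow_ln_le (p : nat) : \forall t \near (+oo : set_system R), ln t ^+ p <= t.
Proof.
apply/near_pinfty; exists (expR (4 * p.+1%:R ^+ 2)) => t ht.
have t0 : 0 < t by exact: lt_le_trans (expR_gt0 _) ht.
have p0 : (0 : R) < p.+1%:R by [].
set y := ln t; have yE : t = expR y by rewrite lnK.
have y1 : 4 * p.+1%:R ^+ 2 <= y by rewrite -ler_expR -yE.
have p1 : (1 : R) <= p.+1%:R by rewrite ler1n.
have y4 : 1 <= y by nra.
pose z := y / (2 * p.+1%:R).
have z0 : 0 <= z by rewrite divr_ge0//; lra.
have z2 : y <= z ^+ 2.
  have -> : z ^+ 2 = y * (y / (4 * p.+1%:R ^+ 2)) by rewrite /z; field; rewrite gt_eqF.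
  by rewrite ler_peMr//; [lra|rewrite ler_pdivlMr ?mul1r// mulr_gt0// exprn_gt0].
have -> : t = expR z ^+ (2 * p.+1).
  by rewrite -expRM_natl yE /z natrM; congr expR; field; rewrite gt_eqF.
apply: le_trans (_ : y ^+ p.+1 <= _).
  by rewrite ler_weXn2l.
rewrite exprM; apply: lerXn2r; rewrite ?nnegrE ?exprn_ge0 ?expR_ge0//; first lra.
apply: le_trans z2 _; rewrite ler_sqr ?nnegrE ?expR_ge0//.
by have := expR_ge1Dx z; lra.
Qed.

Definition to_inf g := forall A : R, \forall t \near +oo, A <= `|g t|.

(** Nonvanishing is included because L'Hopital's rule compares with [g]; for [to_inf] it is
    automatic. *)
Definition to_zero g := (forall n : nat, \forall t \near +oo, n%:R * `|g t| <= 1) /\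
  (\forall t \near +oo, g t != 0).

(** Landau's u = o(g), without division. *)
Definition osmall u g := forall n : nat, \forall t \near +oo, n%:R * `|u t| <= `|g t|.

Lemma osmall_le u v g : (\forall t \near +oo, `|v t| <= `|u t|) ->
  osmall u g -> osmall v g.
Proof.
move=> vu h n; apply: filterS2 vu (h n) => t vut; apply: le_trans.
exact: ler_wpM2l.
Qed.

Lemma osmall_ler u g h : (\forall t \near +oo, `|g t| <= `|h t|) ->
  osmall u g -> osmall u h.
Proof. by move=> gh o n; apply: filterS2 gh (o n) => t gt ugt; exact: le_trans gt. Qed.

Lemma osmallM (c : nat) u g : osmall u g -> osmall (fun t => c%:R * u t) g.
Proof.
move=> h n; apply: filterS (h (n * c)%N) => t.
by rewrite normrM natrM normr_nat mulrA.
Qed.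

Lemma osmallD u v g : osmall u g -> osmall v g -> osmall (fun t => u t + v t) g.
Proof.
move=> hu hv n; apply: filterS2 (hu (2 * n)%N) (hv (2 * n)%N) => t; rewrite natrM.
have := ler_wpM2l (ler0n R n) (ler_normD (u t) (v t)); lra.
Qed.

Lemma osmall_neqr u g h : (\forall t \near +oo, g t = h t) -> osmall u g -> osmall u h.
Proof. by move=> gh; apply: osmall_ler; apply: filterS gh => t ->. Qed.

Lemma to_inf_osmall1 g : to_inf g -> osmall (fun=> 1) g.
Proof. by move=> h n; apply: filterS (h n%:R) => t; rewrite normr1 mulr1. Qed.

Lemma osmall1_to_inf g : osmall (fun=> 1) g -> to_inf g.
Proof.
move=> h A; apply: filterS (h (Num.truncn A).+1) => t.
rewrite normr1 mulr1; apply: le_trans; exact/ltW/truncnS_gt.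
Qed.

(** * L'Hopital's rule in a Hardy field *)

Section LHopital.
Variables (K : set (R -> R)) (HK : hfield K).

Lemma hf_near_is_derive u : K u -> \forall t \near +oo, is_derive t (1 : R) u (derive1 u t).
Proof. exact: (hf_dv HK). Qed.

Lemma nondecreasing_of_derive u : (\forall t \near +oo, 0 <= derive1 u t) -> K u ->
  exists T, forall s t, T <= s -> s <= t -> u s <= u t.
Proof. by move=> h Ku; apply: near_nondecreasing (hf_near_is_derive Ku) h. Qed.

Lemma derive1N_near u : K u ->
  \forall t \near +oo, derive1 (fun t => - u t) t = - derive1 u t.
Proof.
by move=> Ku; apply: filterS (hf_near_is_derive Ku) => t /is_derive_N1/derive1E_is.
Qed.

Lemma nonincreasing_of_derive u : (\forall t \near +oo, derive1 u t <= 0) -> K u ->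
  exists T, forall s t, T <= s -> s <= t -> u t <= u s.
Proof.
move=> h Ku; have [||T hT] := @nondecreasing_of_derive (fun t => - u t).
- by apply: filterS2 (derive1N_near Ku) h => t ->; rewrite oppr_ge0.
- exact: (hf_N HK).
- by exists T => s t Ts st; rewrite -lerN2; exact: hT.
Qed.

Lemma to_inf_derive_gt0 g : K g -> (\forall t \near +oo, 0 < g t) -> to_inf g ->
  \forall t \near +oo, 0 < derive1 g t.
Proof.
move=> Kg g0 gi.
have bad : (\forall t \near +oo, derive1 g t <= 0) -> False.
  move=> h; have [T hT] := nonincreasing_of_derive h Kg.
  apply: (near_absurd (filterI (near_ge T) g0) (gi (g T + 1))) => t [/= Tt gt0].
  by rewrite gtr0_norm//; have := hT _ _ (lexx T) Tt; lra.
case: (hf_sgn HK (hf_D HK Kg)) => // h; exfalso; apply: bad; apply: filterS h => t.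
  by move=> ->.
exact: ltW.
Qed.

Lemma to_zero_derive_lt0 g : K g -> (\forall t \near +oo, 0 < g t) -> to_zero g ->
  \forall t \near +oo, derive1 g t < 0.
Proof.
move=> Kg g0 [gz _].
have bad : (\forall t \near +oo, 0 <= derive1 g t) -> False.
  move=> h; have [T hT] := nondecreasing_of_derive h Kg.
  have /near_pinfty[T' hT'] := g0.
  pose S := Num.max T T'; have ST : T <= S by rewrite le_max lexx.
  have gS : 0 < g S by apply: hT'; rewrite le_max lexx orbT.
  have gz' := gz (Num.truncn (g S)^-1).+1.
  apply: (near_absurd (filterI (near_ge S) g0) gz') => t [/= Tt gt0].
  rewrite gtr0_norm//; have := hT _ _ ST Tt => gSt.
  apply/negP; rewrite -ltNge.
  have := truncnS_gt (g S)^-1; rewrite -(ltr_pM2r gS) mulVf ?gt_eqF// => h1.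
  apply: lt_le_trans h1 _; exact: ler_wpM2l.
case: (hf_sgn HK (hf_D HK Kg)) => // h; exfalso; apply: bad; apply: filterS h => t.
  by move=> ->.
exact: ltW.
Qed.

(** Every derivative has an eventual sign, so it suffices to exclude the wrong one. If g tends to
    infinity, h = g - n u is at least g / 2, hence unbounded, and cannot decrease. If g tends to 0,
    h = g + n u lies between g / 2 and 2 g, hence is positive and tends to 0, and cannot
    increase. *)
Lemma lhopital_pos u g n : K u -> K g -> (\forall t \near +oo, 0 < g t) ->
  to_inf g \/ to_zero g -> osmall u g ->
  \forall t \near +oo, n%:R * derive1 u t <= `|derive1 g t|.
Proof.
move=> Ku Kg g0 glim ug.
have ug2 := ug (2 * n)%N.
have Knu : K (fun t => n%:R * u t) by apply: (hf_M HK) => //; exact: hf_nat.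
have Dnu : \forall t \near +oo, is_derive t (1 : R) (fun t => n%:R * u t) (n%:R * derive1 u t).
  apply: filterS (hf_near_is_derive Ku) => t h.
  by apply: is_deriveE (is_derive_M1 (is_derive_cst1 n%:R t) h) _; rewrite mul0r add0r.
have Dg := hf_near_is_derive Kg.
case: glim => glim.
- have g'0 := to_inf_derive_gt0 Kg g0 glim.
  pose h t := g t - n%:R * u t; have Kh : K h by exact: (hf_B HK).
  have Dh : \forall t \near +oo, derive1 h t = derive1 g t - n%:R * derive1 u t.
    by apply: filterS2 Dg Dnu => t h1 h2; apply: derive1E_is; exact: is_derive_B1.
  have good : (\forall t \near +oo, 0 <= derive1 h t) ->
      \forall t \near +oo, n%:R * derive1 u t <= `|derive1 g t|.
    move=> hh; near=> t; rewrite gtr0_norm; last exact: (near g'0 t).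
    by rewrite -subr_ge0 -(near Dh t)//; exact: (near hh t).
  case: (hf_sgn HK (hf_D HK Kh)) => hh.
  + by apply: good; apply: filterS hh => t ->.
  + by apply: good; apply: filterS hh => t; exact: ltW.
  + exfalso; have [|T hT] := @nonincreasing_of_derive h _ Kh.
      by apply: filterS hh => t; exact: ltW.
    apply: (near_absurd (filterI (near_ge T) g0)
      (filterI ug2 (glim (2 * h T + 1)))) => t [/= Tt gt0].
    move=> [/= h1 h2]; have := hT _ _ (lexx T) Tt.
    rewrite {1}/h => h3; move: h1 h2.
    rewrite (gtr0_norm gt0) natrM -mulrA.
    have : n%:R * u t <= n%:R * `|u t| by rewrite ler_wpM2l// ler_norm.
    lra.
- have g'0 := to_zero_derive_lt0 Kg g0 glim; case: glim => gz _.
  pose h t := g t + n%:R * u t; have Kh : K h by exact: (hf_add HK).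
  have Dh : \forall t \near +oo, derive1 h t = derive1 g t + n%:R * derive1 u t.
    by apply: filterS2 Dg Dnu => t h1 h2; apply: derive1E_is; exact: is_derive_D1.
  have good : (\forall t \near +oo, derive1 h t <= 0) ->
      \forall t \near +oo, n%:R * derive1 u t <= `|derive1 g t|.
    move=> hh; near=> t; rewrite ltr0_norm; last exact: (near g'0 t).
    by rewrite -subr_le0 opprK addrC -(near Dh t)//; exact: (near hh t).
  case: (hf_sgn HK (hf_D HK Kh)) => hh.
  + by apply: good; apply: filterS hh => t ->.
  + exfalso; have [|T hT] := @nondecreasing_of_derive h _ Kh.
      by apply: filterS hh => t; exact: ltW.
    have /near_pinfty[T' hT'] : \forall t \near +oo,
        0 < g t /\ (2 * n)%:R * `|u t| <= `|g t| by apply: filterS2 g0 ug2.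
    pose S := Num.max T T'; have ST : T <= S by rewrite le_max lexx.
    have [/= gS uS] := hT' S ltac:(by rewrite le_max lexx orbT).
    have hS t : 0 < g t -> (2 * n)%:R * `|u t| <= `|g t| ->
        g t <= 2 * h t /\ h t <= 2 * g t.
      move=> gt0; rewrite (gtr0_norm gt0) natrM -mulrA /h => h1.
      have : `|n%:R * u t| <= n%:R * `|u t| by rewrite normrM normr_nat.
      by rewrite ler_norml => /andP[h2 h3]; split; lra.
    have [hS1 _] := hS _ gS uS.
    (* The factor 4 contradicts g(S) <= 2 h(S) <= 2 h(t) <= 4 g(t). *)
    have gz' := gz (Num.truncn (4 * (g S)^-1)).+1.
    apply: (near_absurd (filterI (near_ge S) (filterI g0 ug2)) gz') => t [/= St [/= gt0 ut]].
    have [_ h1] := hS _ gt0 ut; have h2 := hT _ _ ST St.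
    rewrite gtr0_norm//; apply/negP; rewrite -ltNge.
    have := truncnS_gt (4 * (g S)^-1); rewrite -(ltr_pM2r gS).
    rewrite -mulrA mulVf ?gt_eqF// mulr1; set m : R := _.+1%:R => h4.
    have m0 : 0 < m by rewrite ltr0n.
    nra.
  + by apply: good; apply: filterS hh => t; exact: ltW.
Unshelve. all: by end_near. Qed.

Lemma osmallN u g : osmall u g -> osmall (fun t => - u t) g.
Proof. by apply: osmall_le; near=> t; rewrite normrN.
Unshelve. all: by end_near. Qed.

Lemma osmallNr u g : osmall u g -> osmall u (fun t => - g t).
Proof. by apply: osmall_ler; near=> t; rewrite normrN.
Unshelve. all: by end_near. Qed.

Lemma lhopital_osmall u g : K u -> K g -> to_inf g \/ to_zero g ->
  osmall u g -> osmall (derive1 u) (derive1 g).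
Proof.
move=> Ku Kg glim ug n.
have pos g' : K g' -> (\forall t \near +oo, 0 < g' t) ->
    to_inf g' \/ to_zero g' -> osmall u g' ->
    \forall t \near +oo, n%:R * `|derive1 u t| <= `|derive1 g' t|.
  move=> Kg' g'0 g'lim ug'.
  have h1 := lhopital_pos n Ku Kg' g'0 g'lim ug'.
  have h2 := lhopital_pos n (hf_N HK Ku) Kg' g'0 g'lim (osmallN ug').
  have DN := derive1N_near Ku.
  near=> t; have [u0|u0] := ler0P (derive1 u t).
    by rewrite -(near DN t)//; exact: (near h2 t).
  exact: (near h1 t).
have glim' : to_inf (fun t => - g t) \/ to_zero (fun t => - g t).
  case: glim => [h|[h1 h2]]; [left=> A|right; split=> [m|]].
  - by apply: filterS (h A) => t; rewrite normrN.
  - by apply: filterS (h1 m) => t; rewrite normrN.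
  - by apply: filterS h2 => t; rewrite oppr_eq0.
case: (hf_sgn HK Kg) => g0; [exfalso|exact: pos|].
  case: glim => [h|[_ h]].
    by apply: near_absurd g0 (h 1) _ => t ->; rewrite normr0 ler10.
  by apply: near_absurd g0 h _ => t ->; rewrite eqxx.
have Ng0 : \forall t \near +oo, 0 < - g t.
  by apply: filterS g0 => t; rewrite oppr_gt0.
have DN := derive1N_near Kg.
apply: filterS2 DN (pos _ (hf_N HK Kg) Ng0 glim' (osmallNr ug)) => t ->.
by rewrite normrN.
Unshelve. all: by end_near. Qed.

Lemma derive0_near_cst u : K u -> (\forall t \near +oo, derive1 u t = 0) ->
  exists c, \forall t \near +oo, u t = c.
Proof.
move=> Ku h.
have [|T hT] := @nondecreasing_of_derive u _ Ku; first by apply: filterS h => t ->.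
have [|T' hT'] := @nonincreasing_of_derive u _ Ku; first by apply: filterS h => t ->.
exists (u (Num.max T T')); apply/near_pinfty; exists (Num.max T T') => t Tt.
apply/eqP; rewrite eq_le; apply/andP; split.
  by apply: hT' => //; rewrite le_max lexx orbT.
by apply: hT => //; rewrite le_max lexx.
Qed.

End LHopital.

End Asymptotics.

(** * Iterated logarithms, and the size and domination of derivatives *)

Section Logarithms.
Variable R : realType.
Implicit Types (f g h u v w y : R -> R).

Definition log3 (t : R) : R := ln (log2 t).

Lemma near_ln_ge (A : R) : \forall t \near +oo, A <= ln t.
Proof. exact: (near_ln (near_ge A)). Qed.

Lemma near_log2_ge (A : R) : \forall t \near +oo, A <= log2 t.
Proof. exact: (near_ln (near_ln_ge A)). Qed.

Lemma near_log3_ge (A : R) : \forall t \near +oo, A <= log3 t.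
Proof. exact: (near_ln (near_log2_ge A)). Qed.

Lemma is_derive_ln_comp f t a : 0 < f t -> is_derive t (1 : R) f a ->
  is_derive t (1 : R) (fun s => ln (f s)) (a / f t).
Proof.
move=> f0 hf; have := @is_derive1_comp R (@ln R) f t _ _ (is_derive1_ln f0) hf.
by move=> h; apply: is_deriveE h _; rewrite mulrC.
Qed.

Lemma near_derive_ln : \forall t \near +oo, is_derive t (1 : R) (@ln R) t^-1.
Proof.
apply: filterS (near_ge 1) => t t1; apply: is_derive1_ln.
exact: lt_le_trans t1.
Qed.

Lemma near_derive_log2 :
  \forall t \near +oo, is_derive t (1 : R) (@log2 R) (t * ln t)^-1.
Proof.
near=> t; have t0 : 0 < t by apply: lt_le_trans ltr01 _; near: t; exact: near_ge.
have l0 : 0 < ln t by apply: lt_le_trans ltr01 _; near: t; exact: near_ln_ge.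
apply: is_deriveE (is_derive_ln_comp l0 (is_derive1_ln t0)) _.
by rewrite [RHS]invfM.
Unshelve. all: by end_near. Qed.

Lemma near_derive_log3 :
  \forall t \near +oo, is_derive t (1 : R) log3 (t * ln t * log2 t)^-1.
Proof.
have D := near_derive_log2.
near=> t; have l0 : 0 < log2 t by apply: lt_le_trans ltr01 _; near: t; exact: near_log2_ge.
apply: is_deriveE (is_derive_ln_comp l0 (near D t _)) _ => //.
by rewrite [RHS]invfM.
Unshelve. all: by end_near. Qed.

Record log_field (K : set (R -> R)) : Prop := LogField {
  lf_hf : hfield K;
  lf_id : K (fun t => t);
  lf_ln : K (@ln R);
  lf_log2 : K (@log2 R);
  lf_log3 : K log3 }.

Lemma hfield_logs K : hfield K -> exists2 L, log_field L & K `<=` L.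
Proof.
move=> HK.
have [K0 [HK0 S0 id0]] : exists L, [/\ hfield L, K `<=` L & L (fun t => t)].
  apply: (hfield_primitive HK (hf_1 HK)).
  by near=> t; exact: is_derive_id.
have [K1 [HK1 S1 ln1]] : exists L, [/\ hfield L, K0 `<=` L & L (@ln R)].
  exact: (hfield_primitive HK0 (hf_V HK0 id0) near_derive_ln).
have id1 := S1 _ id0.
have [K2 [HK2 S2 ln2]] : exists L, [/\ hfield L, K1 `<=` L & L (@log2 R)].
  exact: (hfield_primitive HK1 (hf_V HK1 (hf_M HK1 id1 ln1)) near_derive_log2).
have id2 := S2 _ id1; have ln12 := S2 _ ln1.
have [K3 [HK3 S3 ln3]] : exists L, [/\ hfield L, K2 `<=` L & L log3].
  exact: (hfield_primitive HK2
    (hf_V HK2 (hf_M HK2 (hf_M HK2 id2 ln12) ln2)) near_derive_log3).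
exists K3; last by move=> f /S0/S1/S2/S3.
by split=> //; apply: S3.
Unshelve. all: by end_near. Qed.

Lemma log_field_ext K L : log_field K -> hfield L -> K `<=` L -> log_field L.
Proof. by case=> *; split => //; auto. Qed.

Section Growth.
Variables (K : set (R -> R)) (LK : log_field K).
Let HK := lf_hf LK.

Lemma derive1_Xn n : derive1 (fun t : R => t ^+ n.+1) = (fun t => n.+1%:R * t ^+ n).
Proof.
apply/funext => t; apply: derive1E_is.
apply: is_deriveE (is_derive_X1 n (is_derive_id t (1 : R))) _.
by rewrite mulr1.
Qed.

Lemma to_inf_Xn n : to_inf (fun t : R => t ^+ n.+1).
Proof.
move=> A; near=> t.
have t1 : 1 <= t by near: t; exact: near_ge.
have tA : A <= t by near: t; exact: near_ge.
have t0 : 0 <= t by lra.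
rewrite [leRHS]ger0_norm ?exprn_ge0//.
by apply: le_trans tA _; rewrite exprS ler_peMr ?exprn_ege1//; lra.
Unshelve. all: by end_near. Qed.

Record growth_type (j : nat) g : Prop := GrowthType {
  gt_mem : K g;
  gt_gt0 : \forall t \near +oo, 0 < g t;
  gt_lower : osmall (fun t : R => t ^+ j.-1) g;
  gt_upper : osmall g (fun t : R => t ^+ j);
  gt_j : (0 < j)%N }.

Section OneFunction.
Variables (j : nat) (g : R -> R) (G : growth_type j g).

Let Kg i : K (derive1n i g). Proof. exact: (hf_Dn HK i (gt_mem G)). Qed.

Lemma growth_lower i m : (i + m)%N = j.-1 ->
  osmall (fun t : R => t ^+ m) (derive1n i g).
Proof.
elim: i m => [|i IH] m.
  by rewrite add0n derive1n0 => ->; exact: gt_lower G.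
rewrite addSnnS => /IH h; rewrite derive1nS.
apply: (@osmall_le _ (derive1 (fun t : R => t ^+ m.+1))).
  near=> t; rewrite derive1_Xn normrM normr_nat ler_peMl// ler1n//.
apply: (lhopital_osmall HK) => //; first exact: (hf_X HK _ (lf_id LK)).
left; apply: osmall1_to_inf; apply: osmall_le h.
near=> t; rewrite normr1 normrX exprn_ege1//.
apply: le_trans (ler_norm _); near: t; exact: near_ge.
Unshelve. all: by end_near. Qed.

Lemma growth_upper i m : (i + m)%N = j ->
  osmall (derive1n i g) (fun t : R => t ^+ m).
Proof.
elim: i m => [|i IH] m.
  by rewrite add0n derive1n0 => ->; exact: gt_upper G.
rewrite addSnnS => /IH h; rewrite derive1nS.
have : osmall (derive1 (derive1n i g)) (derive1 (fun t : R => t ^+ m.+1)).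
  apply: (lhopital_osmall HK) => //; first exact: (hf_X HK _ (lf_id LK)).
  by left; exact: to_inf_Xn.
rewrite derive1_Xn => h' n; apply: filterS (h' (n * m.+1)%N) => t.
rewrite normrM normr_nat natrM.
by rewrite [n%:R * _]mulrC -mulrA ler_pM2l.
Qed.

(** From order j on, a derivative that is o(1) is also o(t), and L'Hopital's rule against t makes
    the next one o(1). *)
Lemma growth_zero l : (j <= l)%N -> osmall (derive1n l g) (fun=> 1).
Proof.
move=> /subnK <-; elim: (l - j)%N => [|i IH].
  rewrite add0n; apply: osmall_neqr (@growth_upper j 0 (addn0 j)).
  by near=> t; rewrite expr0.
rewrite addSn derive1nS.
have -> : (fun=> 1 : R) = derive1 (fun t : R => t ^+ 1).
  by rewrite derive1_Xn; apply/funext => t; rewrite expr0 mulr1.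
apply: (lhopital_osmall HK) => //; first exact: (hf_X HK _ (lf_id LK)).
  by left; exact: to_inf_Xn.
apply: osmall_ler IH; near=> t; rewrite normr1 expr1.
apply: le_trans (ler_norm _); near: t; exact: near_ge.
Unshelve. all: by end_near. Qed.

Lemma growth_to_inf l : (l < j)%N -> to_inf (derive1n l g).
Proof.
move=> lj; apply: osmall1_to_inf.
apply: osmall_le (@growth_lower l (j.-1 - l)%N _); last by have := gt_j G; lia.
near=> t; rewrite normr1 normrX exprn_ege1//.
apply: le_trans (ler_norm _); near: t; exact: near_ge.
Unshelve. all: by end_near. Qed.

(** Growth strictly between consecutive powers excludes polynomials: if a derivative vanished, the
    preceding one would be constant. Below order j that one is unbounded; from order j on it tends
    to 0 and is nonzero by induction. *)
Lemma growth_neq0 l : \forall t \near +oo, derive1n l g t != 0.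
Proof.
have inf_neq0 i : (i < j)%N -> \forall t \near +oo, derive1n i g t != 0.
  move=> ij; apply: filterS (growth_to_inf ij 1) => t.
  by apply: contraTneq => ->; rewrite normr0 -ltNge.
have [lj|jl] := ltnP l j; first exact: inf_neq0.
elim: l jl => [|l IH] jl; first by have := gt_j G; rewrite ltnNge jl.
have not0 : ~ (\forall t \near +oo, derive1n l.+1 g t = 0).
  rewrite derive1nS => /(derive0_near_cst HK (Kg l))[c hc].
  have [lj|jl'] := ltnP l j.
    apply: (near_absurd hc (growth_to_inf lj (`|c| + 1))) => t ->; lra.
  have c0 : c != 0.
    have [t [/= <- //]] : exists t : R, derive1n l g t = c /\ derive1n l g t != 0.
      by apply: (@filter_ex _ (pinfty_nbhs R)); exact: filterI hc (IH jl').
  apply: (near_absurd hc (growth_zero jl' (Num.truncn `|c|^-1).+1)) => t ->.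
  rewrite normr1; apply/negP; rewrite -ltNge.
  have := truncnS_gt `|c|^-1; rewrite -(ltr_pM2r (_ : 0 < `|c|)) ?normr_gt0//.
  by rewrite mulVf// normr_eq0.
case: (hf_sgn HK (Kg l.+1)) => h; first by [].
- by apply: filterS h => t; rewrite lt0r => /andP[].
- by apply: filterS h => t; rewrite lt_neqAle => /andP[].
Unshelve. all: by end_near. Qed.

Lemma growth_lim l : to_inf (derive1n l g) \/ to_zero (derive1n l g).
Proof.
have [lj|jl] := ltnP l j; [left; exact: growth_to_inf|right].
split; last exact: growth_neq0.
by move=> n; apply: filterS (growth_zero jl n) => t; rewrite normr1.
Qed.

End OneFunction.

(** The square makes the logarithm meaningful for either sign of [h]. *)
Lemma near_derive_ln_sqr h : K h -> (\forall t \near +oo, h t != 0) ->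
  \forall t \near +oo, is_derive t (1 : R) (fun s => ln (h s ^+ 2)) (2 * (derive1 h t / h t)).
Proof.
move=> Kh h0; have Dh := hf_dv HK Kh.
near=> t; have ht0 : h t != 0 by exact: (near h0 t).
have h20 : 0 < h t ^+ 2 by rewrite exprn_even_gt0.
have Dht : is_derive t (1 : R) h (derive1 h t) by exact: (near Dh t).
have := @is_derive_ln_comp (fun s => h s ^+ 2) t _ h20 (is_derive_X1 1 Dht).
by move=> D; apply: is_deriveE D _; field.
Unshelve. all: by end_near. Qed.

Lemma to_inf_ln_sqr h : to_inf h \/ to_zero h -> to_inf (fun t => ln (h t ^+ 2)).
Proof.
case=> [hi A|[hz h0] A].
  apply: filterS (hi (expR (Num.max 0 A))) => t hA.
  apply: le_trans (ler_norm _).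
  have hA0 : 1 <= `|h t|.
    by apply: le_trans hA; rewrite -expR0 ler_expR le_max lexx.
  rewrite -real_normK ?num_real// lnXn ?(lt_le_trans ltr01)//.
  have : Num.max 0 A <= ln `|h t|.
    by rewrite -[Num.max 0 A]expRK ler_ln ?posrE ?expR_gt0// (lt_le_trans ltr01).
  by rewrite ge_max => /andP[? ?]; lra.
near=> t.
have ht0 : 0 < `|h t| by rewrite normr_gt0; near: t.
have : (Num.truncn (expR (Num.max 0 A))).+1%:R * `|h t| <= 1 by near: t; exact: hz.
move=> h1; rewrite -real_normK ?num_real// lnXn//.
have h2 : expR (Num.max 0 A) * `|h t| <= 1.
  by apply: le_trans h1; apply: ler_wpM2r => //; exact/ltW/truncnS_gt.
have h3 : ln `|h t| <= - Num.max 0 A.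
  rewrite -[leRHS]expRK ler_ln ?posrE ?expR_gt0// expRN.
  by rewrite -[leRHS]mul1r ler_pdivlMr ?expR_gt0// mulrC.
rewrite -normrN; apply: le_trans (ler_norm _).
have : A <= Num.max 0 A by rewrite le_max lexx orbT.
have : 0 <= Num.max 0 A by rewrite le_max lexx.
lra.
Unshelve. all: by end_near. Qed.

(* The logarithm of h^2 is a primitive of 2h'/h, so it may be adjoined to the
   field and compared with powers of ln t by L'Hopital's rule. *)
Lemma logderiv_bounds h (A : nat) : K h -> to_inf h \/ to_zero h ->
  (\forall t \near +oo, h t != 0) ->
  (\forall t \near +oo, `|h t| <= t ^+ A) ->
  (\forall t \near +oo, 1 <= t ^+ A * `|h t|) ->
  \forall t \near +oo, `|derive1 h t| * t <= ln t * `|h t| /\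
    `|h t| <= `|derive1 h t| * t * ln t ^+ 2.
Proof.
move=> Kh hlim h0 hA hA'.
pose y t := ln (h t ^+ 2).
have Dy := near_derive_ln_sqr Kh h0.
have K2 : K (fun=> 2) by exact: (hf_nat HK 2).
have Ka : K (fun t => 2 * (derive1 h t / h t)).
  apply: (hf_M HK) => //; apply: (hf_M HK); first exact: (hf_D HK).
  exact: (hf_V HK).
have [L [HL KL Ly]] := hfield_primitive HK Ka Dy.
have LL := log_field_ext LK HL KL.
have yi : to_inf y by exact: to_inf_ln_sqr.
have Dln := near_derive_ln.
have yle : \forall t \near +oo, `|y t| <= (2 * A)%:R * ln t.
  near=> t; have t1 : 1 <= t by near: t; exact: near_ge.
  have t0 : 0 < t by lra.
  have ht0 : 0 < `|h t| by rewrite normr_gt0; near: t.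
  have e1 : y t = 2 * ln `|h t|.
    by rewrite /y -real_normK ?num_real// lnXn// mulr_natl.
  have tA0 : 0 < t ^+ A by exact: exprn_gt0.
  have e2 : ln (t ^+ A) = A%:R * ln t by rewrite lnXn// mulr_natl.
  have h1 : ln `|h t| <= ln (t ^+ A) by rewrite ler_ln ?posrE//; near: t.
  have h2 : - ln (t ^+ A) <= ln `|h t|.
    rewrite -lnV ?posrE// ler_ln ?posrE ?invr_gt0//.
    rewrite -[leLHS]mul1r ler_pdivrMr// mulrC; near: t; exact: hA'.
  by rewrite e1 natrM ler_norml; apply/andP; split; lra.
(* Polynomial bounds on [h] give only y = O(ln t); the next power makes it o(.), and its derivative
   is 2 ln t / t. *)
have o1 : osmall y (fun t : R => ln t ^+ 2).
  move=> n; near=> t.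
  have l1 : 1 <= ln t by near: t; exact: near_ln_ge.
  have l2 : n%:R * (2 * A)%:R <= ln t by near: t; exact: near_ln_ge.
  have l0 : 0 <= ln t by lra.
  rewrite [leRHS]ger0_norm ?exprn_ge0//.
  apply: le_trans (_ : n%:R * ((2 * A)%:R * ln t) <= _).
    by apply: ler_wpM2l => //; exact: (near yle t).
  by rewrite mulrA expr2; apply: ler_wpM2r => //; lra.
have i1 : to_inf (fun t : R => ln t ^+ 2).
  move=> B; apply: filterS2 (near_ln_ge 1) (near_ln_ge B) => t l1 l2.
  have l0 : 0 <= ln t by lra.
  rewrite [leRHS]ger0_norm ?exprn_ge0//.
  by rewrite expr2; nra.
have Kln2 : L (fun t => ln t ^+ 2) by exact: (hf_X HL 2 (lf_ln LL)).
have Klnv : L (fun t => (ln t)^-1) by exact: (hf_V HL (lf_ln LL)).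
have o2 := lhopital_osmall HL Ly Kln2 (or_introl i1) o1 1%N.
(* In the other direction [y] is only known to be unbounded. It is compared with 1 / ln t, whose
   derivative has size 1 / (t ln^2 t). *)
have o3 : osmall (fun t : R => (ln t)^-1) y.
  apply: osmall_le (to_inf_osmall1 yi); near=> t.
  have l1 : 1 <= ln t by near: t; exact: near_ln_ge.
  have l0 : 0 < ln t by lra.
  by rewrite normr1 gtr0_norm ?invr_gt0// invf_le1.
have o4 := lhopital_osmall HL Klnv Ly (or_introl yi) o3 2%N.
near=> t; have t1 : 1 <= t by near: t; exact: near_ge.
have t0 : 0 < t by lra.
have l1 : 1 <= ln t by near: t; exact: near_ln_ge.
have l0 : 0 < ln t by lra.
have Dlnt : is_derive t (1 : R) (@ln R) t^-1 by near: t.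
have ht0 : 0 < `|h t| by rewrite normr_gt0; near: t.
have Dyt : is_derive t (1 : R) y (2 * (derive1 h t / h t)) by near: t.
have E1 := derive1E_is Dyt.
have E2 := derive1E_is (is_derive_X1 1 Dlnt).
have E3 := derive1E_is (is_derive_V1 (lt0r_neq0 l0) Dlnt).
have : 1%:R * `|derive1 y t| <= `|derive1 (fun t => ln t ^+ 2) t| by near: t.
have : 2%:R * `|derive1 (fun t => (ln t)^-1) t| <= `|derive1 y t| by near: t.
rewrite E1 E2 E3 mul1r expr1 !normrM normrN !normfV normr_nat normrX.
rewrite (gtr0_norm t0) (gtr0_norm l0).
set d := `|derive1 h t|; set a := `|h t| => h1 h2; split.
  move: h2; rewrite -mulrA ler_pM2l// ler_pdivrMr// => h2.
  have := ler_wpM2r (ltW t0) h2.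
  by have -> : t^-1 * ln t * a * t = ln t * a by field; rewrite gt_eqF.
move: h1; rewrite ler_pM2l// ler_pdivlMr// => h1.
have tl0 : 0 < t * ln t ^+ 2 by rewrite mulr_gt0// exprn_gt0.
have := ler_wpM2l (ltW tl0) h1.
have -> : t * ln t ^+ 2 * (t^-1 / ln t ^+ 2 * a) = a by field; rewrite !gt_eqF.
by move=> h3; apply: le_trans h3 _; rewrite mulrC mulrA.
Unshelve. all: by end_near. Qed.

(** Supplies the hypotheses of [logderiv_bounds], which in turn gives the next order: a derivative
    costs at most a factor t ln^2 t <= t^2, hence [A + 2]. *)
Lemma poly_bounds j g l : growth_type j g ->
  exists A : nat, (\forall t \near +oo, `|derive1n l g t| <= t ^+ A) /\
    (\forall t \near +oo, 1 <= t ^+ A * `|derive1n l g t|).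
Proof.
move=> G; elim: l => [|l [A [h1 h2]]].
  exists j; rewrite derive1n0; split.
    apply: filterS2 (near_ge 1) (gt_upper G 1%N) => t t1; rewrite mul1r.
    by rewrite (ger0_norm (x := t ^+ j))// exprn_ge0//; lra.
  have lo : osmall (fun=> 1) g.
    by apply: to_inf_osmall1; exact: (growth_to_inf G (gt_j G)).
  apply: filterS2 (near_ge 1) (lo 1%N) => t t1; rewrite normr1 mulr1 => g1.
  by rewrite mulr_ege1// exprn_ege1.
exists (A + 2)%N; rewrite derive1nS.
have B := logderiv_bounds (hf_Dn HK l (gt_mem G)) (growth_lim G l) (growth_neq0 G l) h1 h2.
split.
  apply: filterS3 (filterI (near_ge 1) (near_ln_ge 0)) (filterI (pow_ln_le R 1) h1) B
    => t [/= t1 l0] [/= lt bt] [b1 _].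
  have t0 : 0 < t by lra.
  rewrite -(ler_pM2r t0); apply: le_trans b1 _; rewrite expr1 in lt.
  apply: le_trans (_ : t * t ^+ A <= _); first exact: ler_pM.
  rewrite -exprS -exprSr; apply: ler_weXn2l => //.
  by rewrite addn2 ltnS; exact: leqW (leqnSn A).
apply: filterS3 (filterI (near_ge 1) (near_ln_ge 0)) (filterI (pow_ln_le R 2) h2) B
  => t [/= t1 l0] [/= lt bt] [_ b2].
have t0 : 0 < t by lra.
apply: le_trans bt _; rewrite exprD -mulrA ler_pM2l ?exprn_gt0//.
apply: le_trans b2 _; rewrite -mulrA [leLHS]mulrC ler_wpM2r//.
by rewrite expr2 ler_wpM2l// ltW.
Qed.

Lemma growth_step j g l : growth_type j g ->
  \forall t \near +oo,
    `|derive1n l.+1 g t| * t <= ln t * `|derive1n l g t| /\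
    `|derive1n l g t| <= `|derive1n l.+1 g t| * t * ln t ^+ 2.
Proof.
move=> G; have [A [h1 h2]] := poly_bounds l G; rewrite derive1nS.
exact: logderiv_bounds (hf_Dn HK l (gt_mem G)) (growth_lim G l) (growth_neq0 G l) h1 h2.
Qed.

Lemma growth_size j g l : growth_type j g ->
  \forall t \near +oo,
    `|derive1n l g t| * t ^+ l <= ln t ^+ (2 * l) * `|g t| /\
    `|g t| <= `|derive1n l g t| * t ^+ l * ln t ^+ (2 * l).
Proof.
move=> G; elim: l => [|l IH].
  by near=> t; rewrite derive1n0 muln0 !expr0 !mulr1 mul1r lexx.
have S := growth_step l G.
apply: filterS3 (filterI (near_ge 1) (near_ln_ge 1)) S IH => t [/= t1 l1] [s1 s2] [i1 i2].
have t0 : 0 < t by lra.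
have l0 : 0 < ln t by lra.
have lsq : ln t <= ln t ^+ 2 by rewrite expr2 ler_peMr//; lra.
rewrite mulnS [ln t ^+ (2 + _)]exprD; split.
  have -> : `|derive1n l.+1 g t| * t ^+ l.+1 = `|derive1n l.+1 g t| * t * t ^+ l.
    by rewrite exprS mulrA.
  apply: le_trans (_ : ln t * `|derive1n l g t| * t ^+ l <= _).
    by apply: ler_wpM2r => //; rewrite exprn_ge0// ltW.
  rewrite -mulrA -[leRHS]mulrA; apply: ler_pM => //; first lra.
  by rewrite mulr_ge0// exprn_ge0// ltW.
apply: le_trans i2 _.
have -> : `|derive1n l.+1 g t| * t ^+ l.+1 * (ln t ^+ 2 * ln t ^+ (2 * l)) =
  `|derive1n l.+1 g t| * t * ln t ^+ 2 * t ^+ l * ln t ^+ (2 * l).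
  by rewrite [t ^+ l.+1]exprS; ring.
have lp n : 0 <= ln t ^+ n by rewrite exprn_ge0// ltW.
have tp n : 0 <= t ^+ n by rewrite exprn_ge0// ltW.
by apply: ler_wpM2r => //; apply: ler_wpM2r.
Unshelve. all: by end_near. Qed.

Lemma growth_derive_gt0 j g : growth_type j g ->
  \forall t \near +oo, 0 < derive1 g t.
Proof.
move=> G; apply: (to_inf_derive_gt0 HK) (gt_gt0 G) (growth_to_inf G (gt_j G)).
exact: gt_mem G.
Qed.

(** Differentiating log2 = o(ln g) gives 1 / (t ln t) <= g' / g. This saves one logarithm over
    [growth_size]. *)
Lemma growth_slope j g : growth_type j g -> osmall (@log2 R) (fun t => ln (g t)) ->
  \forall t \near +oo, g t <= derive1 g t * t * ln t.
Proof.
move=> G lg; pose y t := ln (g t).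
have g0 := gt_gt0 G; have Kg := gt_mem G; have Dg := hf_dv HK Kg.
have Dy : \forall t \near +oo, is_derive t (1 : R) y (derive1 g t / g t).
  near=> t; apply: is_derive_ln_comp; first by near: t.
  exact: (near Dg t).
have [L [HL KL Ly]] := hfield_primitive HK (hf_M HK (hf_D HK Kg) (hf_V HK Kg)) Dy.
have yi : to_inf y.
  apply: osmall1_to_inf; apply: osmall_le lg; near=> t.
  rewrite normr1; apply: le_trans (ler_norm _); near: t; exact: near_log2_ge.
have o := lhopital_osmall HL (KL _ (lf_log2 LK)) Ly (or_introl yi) lg 1%N.
have g'0 := growth_derive_gt0 G; have D2 := near_derive_log2.
near=> t; have t0 : 0 < t by near: t; exact: nbhs_pinfty_gt.
have l0 : 0 < ln t by apply: lt_le_trans ltr01 _; near: t; exact: near_ln_ge.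
have gt0 : 0 < g t by near: t.
have g't0 : 0 < derive1 g t by near: t.
have : 1%:R * `|derive1 (@log2 R) t| <= `|derive1 y t| by near: t.
have D2t : is_derive t (1 : R) (@log2 R) (t * ln t)^-1 by near: t.
have Dyt : is_derive t (1 : R) y (derive1 g t / g t) by near: t.
rewrite (derive1E_is D2t) (derive1E_is Dyt) mul1r.
rewrite !gtr0_norm ?invr_gt0 ?mulr_gt0 ?invr_gt0//.
by rewrite ler_pdivlMr// mulrC ler_pdivrMr ?mulr_gt0// mulrA.
Unshelve. all: by end_near. Qed.

Lemma growth_nondecreasing j g : growth_type j g ->
  exists T, forall s t, T <= s -> s <= t -> g s <= g t.
Proof.
move=> G; apply: (nondecreasing_of_derive HK); last exact: gt_mem G.
by apply: filterS (growth_derive_gt0 G) => t; exact: ltW.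
Qed.

(** The quotient is positive and tends to 0, so its derivative is eventually negative. It limits how
    fast [g] changes between two arguments. *)
Lemma growth_ratio_nonincreasing j g : growth_type j g ->
  exists T, forall s t, T <= s -> s <= t -> g t / t ^+ j <= g s / s ^+ j.
Proof.
move=> G; pose u t := g t / t ^+ j.
have Ku : K u.
  by apply: (hf_M HK (gt_mem G)); apply/(hf_V HK)/(hf_X HK)/(lf_id LK).
have u0 : \forall t \near +oo, 0 < u t.
  apply: filterS2 (near_ge 1) (gt_gt0 G) => t t1 g0.
  by rewrite divr_gt0// exprn_gt0//; lra.
apply: (nonincreasing_of_derive HK (u := u)) => //.
apply: filterS (to_zero_derive_lt0 HK Ku u0 _) => [t|]; first exact: ltW.
split; last by apply: filterS u0 => t; rewrite lt0r => /andP[].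
move=> n; apply: filterS2 (near_ge 1) (gt_upper G n) => t t1.
have tj : 0 < t ^+ j by rewrite exprn_gt0//; lra.
by rewrite normrM normfV (gtr0_norm tj) mulrA ler_pdivrMr// mul1r.
Qed.

(* A factor log3^2 is lost at each derivative; any power of log3 is negligible
   against log2, so that the ratio of derivatives still dominates log2^2. *)
Definition weight (p : nat) (t : R) : R := log2 t ^+ 4 * (log3 t)^-1 ^+ (2 * p).

Lemma near_derive_weight p : \forall t \near +oo,
  is_derive t (1 : R) (weight p)
    (weight p t * (t * ln t * log2 t)^-1 * (4 - (2 * p)%:R / log3 t)).
Proof.
have D2 := near_derive_log2; have D3 := near_derive_log3.
near=> t; have t0 : 0 < t by near: t; exact: nbhs_pinfty_gt.
have l0 : 0 < ln t by apply: lt_le_trans ltr01 _; near: t; exact: near_ln_ge.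
have l20 : 0 < log2 t by apply: lt_le_trans ltr01 _; near: t; exact: near_log2_ge.
have l30 : 0 < log3 t by apply: lt_le_trans ltr01 _; near: t; exact: near_log3_ge.
have D2t : is_derive t (1 : R) (@log2 R) (t * ln t)^-1 by near: t.
have D3t : is_derive t (1 : R) log3 (t * ln t * log2 t)^-1 by near: t.
have D3V := is_derive_V1 (lt0r_neq0 l30) D3t.
case: p => [|p].
  have -> : weight 0 = (fun s => log2 s ^+ 4).
    by apply/funext => s; rewrite /weight muln0 expr0 mulr1.
  apply: is_deriveE (is_derive_X1 3 D2t) _.
  by field; rewrite !gt_eqF.
have E : (2 * p.+1)%N = (2 * p).+2 by rewrite mulnS.
have D := is_derive_M1 (is_derive_X1 3 D2t) (is_derive_X1 (2 * p).+1 D3V).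
rewrite /weight E; apply: is_deriveE D _.
rewrite ![(log3 t)^-1 ^+ (2 * p).+2]exprS ![(log3 t)^-1 ^+ (2 * p).+1]exprS.
move: ((log3 t)^-1 ^+ (2 * p)) (2 * p).+2%:R => q m.
by field; rewrite !gt_eqF.
Unshelve. all: by end_near. Qed.

(* Applying L'Hopital's rule to both u w and u w / log3 isolates u' w from the
   term u w' produced by the product rule, at the price of a factor log3^2. *)
Lemma weighted_lhopital u h p : K u -> K h -> to_inf h \/ to_zero h ->
  osmall (fun t => u t * weight p t) h ->
  osmall (fun t => derive1 u t * weight p.+1 t) (derive1 h).
Proof.
move=> Ku Kh hlim o.
have K3V : K (fun t => (log3 t)^-1) by apply: (hf_V HK); exact: lf_log3 LK.
have Kw : K (weight p).
  by apply: (hf_M HK); apply: (hf_X HK) => //; exact: lf_log2 LK.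
have Kuw := hf_M HK Ku Kw; have Kuw3 := hf_M HK Kuw K3V.
have o' : osmall (fun t => u t * weight p t * (log3 t)^-1) h.
  apply: osmall_le o; near=> t.
  have l3 : 1 <= log3 t by near: t; exact: near_log3_ge.
  rewrite normrM ler_piMr// normfV invf_le1 ?normr_gt0 ?gt_eqF//; first by rewrite ger0_norm//; lra.
  by lra.
have a := lhopital_osmall HK Kuw Kh hlim o.
have b := lhopital_osmall HK Kuw3 Kh hlim o'.
(* A bound for the factor [th] in the derivative of the weight, valid where log3 >= 1. *)
pose c := (4 + 2 * p)%N.
have ab : osmall (fun t => `|derive1 (fun t => u t * weight p t) t| +
    (c%:R * `|derive1 (fun t => u t * weight p t) t| +
     c%:R * `|derive1 (fun t => u t * weight p t * (log3 t)^-1) t|)) (derive1 h).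
  have na v : osmall v (derive1 h) -> osmall (fun t => `|v t|) (derive1 h).
    by apply: osmall_le; near=> t; rewrite normr_id.
  by apply: osmallD; [exact: na|apply: osmallD; apply: osmallM; exact: na].
apply: osmall_le ab.
have Du := hf_dv HK Ku; have Dw := near_derive_weight p; have D3 := near_derive_log3.
near=> t.
have l31 : 1 <= log3 t by near: t; exact: near_log3_ge.
have l30 : 0 < log3 t by lra.
have l3n : log3 t != 0 by rewrite gt_eqF.
have Dut : is_derive t (1 : R) u (derive1 u t) by near: t.
have Dwt : is_derive t (1 : R) (weight p)
    (weight p t * (t * ln t * log2 t)^-1 * (4 - (2 * p)%:R / log3 t)) by near: t.
have D3t : is_derive t (1 : R) log3 (t * ln t * log2 t)^-1 by near: t.
have Ea := derive1E_is (is_derive_M1 Dut Dwt).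
have Eb := derive1E_is (is_derive_M1 (is_derive_M1 Dut Dwt) (is_derive_V1 l3n D3t)).
rewrite Ea Eb.
set d := (t * ln t * log2 t)^-1; set th := 4 - (2 * p)%:R / log3 t.
set A := derive1 u t * weight p t + u t * (weight p t * d * th).
set B := A * (log3 t)^-1 + u t * weight p t * (- d / log3 t ^+ 2).
(* The term with the derivative of the weight is eliminated between [A] and [B], since
   [u * weight p * d / log3^2 = A / log3 - B]. *)
have -> : derive1 u t * weight p.+1 t =
    A * (log3 t)^-1 ^+ 2 - (th * (log3 t)^-1) * A + th * B.
  rewrite /weight mulnS exprD -/(weight p t).
  have -> : derive1 u t * (log2 t ^+ 4 * ((log3 t)^-1 ^+ 2 * (log3 t)^-1 ^+ (2 * p))) =
     derive1 u t * weight p t * (log3 t)^-1 ^+ 2 by rewrite /weight; ring.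
  by rewrite /B /A; field.
have v1 : `|(log3 t)^-1| <= 1.
  by rewrite normfV invf_le1 ?normr_gt0// ger0_norm// ltW.
have thc : `|th| <= c%:R.
  rewrite /th /c natrD; apply: le_trans (ler_normB _ _) _.
  rewrite normr_nat lerD2l normrM normr_nat ler_piMr//.
have A0 := normr_ge0 A; have B0 := normr_ge0 B.
rewrite [leRHS]ger0_norm; last by rewrite !addr_ge0// mulr_ge0.
apply: le_trans (ler_normD _ _) _; rewrite addrA; apply: lerD; last first.
  by rewrite normrM ler_wpM2r.
apply: le_trans (ler_normB _ _) _; apply: lerD.
  by rewrite normrM ler_piMr// normrX exprn_ile1.
rewrite normrM ler_wpM2r// normrM -[leRHS]mulr1.
by apply: ler_pM.
Unshelve. all: by end_near. Qed.

Lemma derivative_domination (i j : nat) f g l : growth_type i f -> growth_type j g ->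
  osmall (fun t => f t * log2 t ^+ 4) g ->
  osmall (fun t => derive1n l f t * weight l t) (derive1n l g).
Proof.
move=> F G o; elim: l => [|l IH].
  apply: osmall_le o; near=> t.
  by rewrite !derive1n0 /weight muln0 expr0 mulr1.
rewrite !derive1nS; apply: weighted_lhopital IH.
- exact: (hf_Dn HK l (gt_mem F)).
- exact: (hf_Dn HK l (gt_mem G)).
- exact: growth_lim G l.
Unshelve. all: by end_near. Qed.

(** [pow_ln_le] at log2 t gives log3^(2l) <= log2, so the weight is at least log2^3. *)
Lemma weight_ge (l m : nat) : \forall t \near +oo, m%:R * log2 t ^+ 2 <= weight l t.
Proof.
have P := near_ln (near_ln (pow_ln_le R (2 * l))).
apply: filterS3 P (near_log2_ge (Num.max 1 m%:R)) (near_log3_ge 1) => t.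
rewrite -/(log2 t) -/(log3 t) => h; rewrite ge_max => /andP[l1 lm] l3.
have l30 : 0 < log3 t ^+ (2 * l) by rewrite exprn_gt0//; lra.
rewrite /weight exprVn ler_pdivlMr//.
apply: le_trans (_ : log2 t * log2 t ^+ 2 * log2 t <= _); last first.
  by rewrite le_eqVlt; apply/orP; left; apply/eqP; ring.
apply: ler_pM => //; first by rewrite mulr_ge0// exprn_ge0//; lra.
  exact: ltW.
by rewrite ler_wpM2r// exprn_ge0//; lra.
Qed.

Lemma derivative_domination_log2 (i j : nat) f g l (m : nat) :
  growth_type i f -> growth_type j g ->
  osmall (fun t => f t * log2 t ^+ 4) g ->
  \forall t \near +oo, m%:R * log2 t ^+ 2 * `|derive1n l f t| <= `|derive1n l g t|.
Proof.
move=> F G o; apply: filterS2 (weight_ge l m) (derivative_domination l F G o 1%N) => t w1.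
rewrite mul1r normrM; apply: le_trans; rewrite mulrC ler_wpM2l//.
exact: le_trans w1 (ler_norm _).
Qed.

End Growth.
End Logarithms.

(** * From a Hardy field of germs to one of functions *)

Section GermHardyField.
Variables (R : realType) (H : set (germ R)).
Hypothesis HH : hardy_field H.

Lemma germ_ofB (f g : R -> R) : germ_of (fun t => f t - g t) = germ_of f - germ_of g.
Proof. by rewrite /germ_of -[LHS]/(\pi_(germ R) (f - g))%qT rmorphB. Qed.

Lemma germ_ofM (f g : R -> R) : germ_of (fun t => f t * g t) = germ_of f * germ_of g.
Proof. by rewrite /germ_of -[LHS]/(\pi_(germ R) (f * g))%qT rmorphM. Qed.

Lemma germ_of1 : germ_of (fun=> 1 : R) = 1.
Proof. by rewrite /germ_of -[LHS]/(\pi_(germ R) 1)%qT rmorph1. Qed.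

Lemma germ_of0 : germ_of (fun=> 0 : R) = 0.
Proof. by rewrite /germ_of -[LHS]/(\pi_(germ R) 0)%qT rmorph0. Qed.

Lemma germ_of_repr (x : germ R) : exists f, x = germ_of f.
Proof. by exists (repr x); rewrite /germ_of reprK. Qed.

Lemma germ_inv (f : R -> R) : germ_of f \in H -> germ_of f != 0 ->
  exists2 g, germ_of g \in H & \forall t \near +oo, f t * g t = 1.
Proof.
move=> Hf f0; have [y Hy] := hardy_inv HH Hf f0.
have [g yE] := germ_of_repr y; rewrite yE in Hy *.
by rewrite -germ_ofM -germ_of1 => /germ_ofP h; exists g.
Qed.

Lemma neq0_near_sgn (f f' : R -> R) : (\forall t \near +oo, is_derive t (1 : R) f (f' t)) ->
  (\forall t \near +oo, f t != 0) -> near_sgn f.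
Proof.
move=> /near_pinfty[T1 h1] /near_pinfty[T2 h2].
pose T := Num.max T1 T2.
have TT t : T <= t -> T1 <= t /\ T2 <= t by rewrite ge_max => /andP.
have sgn0 t : T <= t -> f T * f t <= 0 -> False.
  move=> Tt le0.
  have cf : {within `[T, t], continuous f}.
    apply: derivable_within_continuous => x; rewrite in_itv/= => /andP[Tx _].
    by have hx := h1 x (TT _ Tx).1; exact: ex_derive.
  have [|c] := @IVT R f T t 0 Tt cf.
    rewrite ge_min le_max; apply/andP; split; apply/orP.
      by have [?|?] := leP (f T) 0; [left|right; nra].
    by have [?|?] := leP 0 (f T); [left|right; nra].
  rewrite in_itv/= => /andP[Tc _]; apply/eqP; exact: h2 (TT _ Tc).2.
have fT : f T != 0 by apply: h2 (TT _ (lexx T)).2.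
move: fT; rewrite neq_lt => /orP[fT|fT].
  apply: Or33; apply/near_pinfty; exists T => t Tt; rewrite ltNge; apply/negP => ft.
  by apply: (sgn0 t) => //; rewrite nmulr_rle0.
apply: Or32; apply/near_pinfty; exists T => t Tt; rewrite ltNge; apply/negP => ft.
by apply: (sgn0 t) => //; rewrite pmulr_rle0.
Qed.

(** The eventual sign comes from invertibility: a representative of a nonzero germ is eventually
    nonzero, and being differentiable it keeps its sign by the intermediate value theorem. *)
Lemma hardy_hfield : hfield [set f | germ_of f \in H].
Proof.
have [[H1 HB] HM] : (1 \in H /\ {in H &, forall u v, u - v \in H}) /\
    {in H &, forall u v, u * v \in H}.
  by have [h1 h2 h3] := hardy_subring HH.
have H0 : (0 : germ R) \in H by rewrite -(subrr 1); exact: HB.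
have dv f : germ_of f \in H -> \forall t \near +oo, is_derive t (1 : R) f (derive1 f t).
  move=> Hf; have [df _] := hardy_derive HH Hf.
  by apply: filterS df => t dft; rewrite derive1E; exact: DeriveDef.
split=> /=.
- by move=> f g Hf /germ_ofP <-.
- by rewrite germ_of1.
- by move=> f g Hf Hg; rewrite germ_ofB HB.
- by move=> f g Hf Hg; rewrite germ_ofM HM.
- move=> f Hf; have [f0|f0] := eqVneq (germ_of f) 0.
    have -> : germ_of (fun t => (f t)^-1) = 0; last exact: H0.
    move: f0; rewrite -germ_of0 => /germ_ofP h; apply/germ_ofP.
    by apply: filterS h => t ->; rewrite invr0.
  have [g Hg fg] := germ_inv Hf f0.
  have <- : germ_of g = germ_of (fun t => (f t)^-1); last exact: Hg.
  apply/germ_ofP; apply: filterS fg => t fg1.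
  have ft0 : f t != 0.
    by apply/eqP => ft0; move: fg1; rewrite ft0 mul0r => /eqP; rewrite eq_sym oner_eq0.
  by apply: (mulfI ft0); rewrite fg1 divff.
- by move=> f Hf; have [] := hardy_derive HH Hf.
- exact: dv.
- move=> f Hf; have [f0|f0] := eqVneq (germ_of f) 0.
    by apply: Or31; move: f0; rewrite -germ_of0 => /germ_ofP.
  have [g _ fg] := germ_inv Hf f0; apply: neq0_near_sgn (dv f Hf) _.
  apply: filterS fg => t; apply: contra_eq_neq => ->.
  by rewrite mul0r eq_sym oner_neq0.
Qed.

End GermHardyField.

(** * The phase on the window [N / ln N, 2N] *)

Section Core.
Variables (R : realType) (K : set (R -> R)) (LK : log_field K) (k : nat).
Variables (f : 'I_k.+1 -> R -> R) (j : 'I_k.+1 -> nat) (p : 'S_k.+1).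
Hypothesis G : forall i, growth_type K (j i) (f i).
Hypothesis slope : forall i, osmall (@log2 R) (fun t => ln (f i t)).
Hypothesis ord : forall a b : 'I_k.+1, (a < b)%N ->
  osmall (fun t => f (p a) t * log2 t ^+ 4) (f (p b)).

Lemma near_tail (P : R -> Prop) : (\forall t \near +oo, P t) ->
  \forall T \near +oo, forall u, T <= u -> P u.
Proof.
move=> /near_pinfty[T hT]; apply/near_pinfty; exists T => S TS u Su.
by apply: hT; exact: le_trans Su.
Qed.

Lemma near_leq (L : nat) (P : nat -> R -> Prop) :
  (forall l, \forall t \near +oo, P l t) ->
  \forall t \near +oo, forall l, (l <= L)%N -> P l t.
Proof.
move=> h; elim: L => [|L IH].
  by apply: filterS (h 0%N) => t Pt l; rewrite leqn0 => /eqP ->.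
apply: filterS2 (h L.+1) IH => t PL IH l; rewrite leq_eqVlt => /predU1P[->//|].
by rewrite ltnS; exact: IH.
Qed.

(** All eventual facts beyond one threshold, which depends on the functions and on [L] but not on N,
    s, r or tau; this makes the final constant uniform. *)
Record good (L : nat) (T : R) : Prop := Good {
  good_ge1 : 1 <= T;
  good_ln : forall u, T <= u -> 1 <= ln u;
  good_gt0 : forall i u, T <= u -> 0 < f i u;
  good_derive : forall l, (l <= L)%N -> forall i u, T <= u ->
    is_derive u (1 : R) (derive1n l (f i)) (derive1n l.+1 (f i) u);
  good_sgn : forall l, (l <= L)%N -> forall i,
    (forall u, T <= u -> 0 < derive1n l (f i) u) \/
    (forall u, T <= u -> derive1n l (f i) u < 0);
  good_mono : forall i u v, T <= u -> u <= v -> f i u <= f i v;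
  good_ratio : forall i u v, T <= u -> u <= v ->
    f i v / v ^+ j i <= f i u / u ^+ j i;
  good_size : forall l, (l <= L)%N -> forall i u, T <= u ->
    `|derive1n l (f i) u| * u ^+ l <= ln u ^+ (2 * l) * f i u /\
    f i u <= `|derive1n l (f i) u| * u ^+ l * ln u ^+ (2 * l);
  good_slope : forall i u, T <= u ->
    0 < derive1 (f i) u /\ f i u <= derive1 (f i) u * u * ln u;
  good_dom : forall l, (l <= L)%N -> forall a b : 'I_k.+1, (a < b)%N -> forall u,
    T <= u -> (8 * k.+1)%:R * log2 u ^+ 2 * `|derive1n l (f (p a)) u| <=
      `|derive1n l (f (p b)) u|;
  good_power : forall i u, T <= u -> u ^+ (j i).-1 <= f i u /\ f i u <= u ^+ j i }.

Lemma near_good L : \forall T \near +oo, good L T.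
Proof.
have HK := lf_hf LK.
have Kf i : K (f i) := gt_mem (G i).
have t1 := near_ge (1 : R).
have t2 := near_tail (near_ln_ge (1 : R)).
have t3 : \forall T \near +oo, forall i (u : R), T <= u -> 0 < f i u.
  by apply: filter_forall => i; exact: near_tail (gt_gt0 (G i)).
have t4 : \forall T \near +oo, forall l, (l <= L)%N -> forall i (u : R), T <= u ->
    is_derive u (1 : R) (derive1n l (f i)) (derive1n l.+1 (f i) u).
  apply: near_leq => l; apply: filter_forall => i.
  by apply: near_tail; rewrite derive1nS; exact: (hf_dv HK (hf_Dn HK l (Kf i))).
have t5 : \forall T \near +oo, forall l, (l <= L)%N -> forall i,
    (forall u : R, T <= u -> 0 < derive1n l (f i) u) \/
    (forall u : R, T <= u -> derive1n l (f i) u < 0).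
  apply: near_leq => l; apply: filter_forall => i.
  have n0 := growth_neq0 LK (G i) l.
  case: (hf_sgn HK (hf_Dn HK l (Kf i))) => h.
  - by exfalso; apply: near_absurd h n0 _ => t ->; rewrite eqxx.
  - by apply: filterS (near_tail h) => T hT; left.
  - by apply: filterS (near_tail h) => T hT; right.
have t6 : \forall T \near +oo, forall i (u v : R), T <= u -> u <= v -> f i u <= f i v.
  apply: filter_forall => i; have [T hT] := growth_nondecreasing LK (G i).
  apply/near_pinfty; exists T => S TS u v Su uv; apply: hT => //; exact: le_trans Su.
have t7 : \forall T \near +oo, forall i (u v : R), T <= u -> u <= v ->
    f i v / v ^+ j i <= f i u / u ^+ j i.
  apply: filter_forall => i; have [T hT] := growth_ratio_nonincreasing LK (G i).
  apply/near_pinfty; exists T => S TS u v Su uv; apply: hT => //; exact: le_trans Su.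
have t8 : \forall T \near +oo, forall l, (l <= L)%N -> forall i (u : R), T <= u ->
    `|derive1n l (f i) u| * u ^+ l <= ln u ^+ (2 * l) * f i u /\
    f i u <= `|derive1n l (f i) u| * u ^+ l * ln u ^+ (2 * l).
  apply: near_leq => l; apply: filter_forall => i; apply: near_tail.
  by apply: filterS2 (gt_gt0 (G i)) (growth_size LK l (G i)) => t f0; rewrite (gtr0_norm f0).
have t9 : \forall T \near +oo, forall i (u : R), T <= u ->
    0 < derive1 (f i) u /\ f i u <= derive1 (f i) u * u * ln u.
  apply: filter_forall => i; apply: near_tail.
  apply: filterS2 (growth_derive_gt0 LK (G i)) (growth_slope LK (G i) (slope i)) => t.
  by [].
have t10 : \forall T \near +oo, forall l, (l <= L)%N -> forall a b : 'I_k.+1, (a < b)%N ->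
    forall u : R, T <= u -> (8 * k.+1)%:R * log2 u ^+ 2 * `|derive1n l (f (p a)) u| <=
      `|derive1n l (f (p b)) u|.
  apply: near_leq => l; apply: filter_forall => a; apply: filter_forall => b.
  have [ab|_] := boolP (a < b)%N; last by apply: nearW.
  apply: filterS (near_tail (derivative_domination_log2 LK l (8 * k.+1)
    (G (p a)) (G (p b)) (ord ab))) => T hT _.
  exact: hT.
have t11 : \forall T \near +oo, forall i (u : R), T <= u ->
    u ^+ (j i).-1 <= f i u /\ f i u <= u ^+ j i.
  apply: filter_forall => i; apply: near_tail.
  apply: filterS3 (filterI (near_ge 1) (gt_gt0 (G i))) (gt_lower (G i) 1%N)
    (gt_upper (G i) 1%N) => t [/= t0 f0].
  have t00 : 0 <= t by lra.
  by rewrite !mul1r (gtr0_norm f0) !ger0_norm ?exprn_ge0.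
near=> T; split; by near: T.
Unshelve. all: by end_near. Qed.

Section Window.
Variables (L : nat) (T : R).
Hypothesis gT : good L T.
Variables (tau : 'I_k.+1 -> int) (a : 'I_k.+1).
Hypotheses (tau_a : tau (p a) != 0)
  (tau_max : forall b : 'I_k.+1, (a < b)%N -> tau (p b) = 0).

Definition phase (l : nat) (u : R) : R :=
  \sum_i derive1n l (f i) u * (tau i)%:~R.

Lemma tau_a_ge1 : 1 <= `|(tau (p a))%:~R : R|.
Proof.
have : 0 < `|tau (p a)| by rewrite normr_gt0.
by rewrite gtz0_ge1 -(ler_int R) intr_norm.
Qed.

Lemma phase_main l u : (l <= L)%N -> T <= u ->
  (forall i, `|(tau i)%:~R : R| <= 4 * log2 u ^+ 2) ->
  `|phase l u - derive1n l (f (p a)) u * (tau (p a))%:~R| <=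
    2^-1 * `|derive1n l (f (p a)) u|.
Proof.
move=> lL Tu tu; rewrite /phase (bigD1 (p a))//= addrAC subrr add0r.
apply: le_trans (ler_norm_sum _ _ _) _.
set X := `|_|; have X0 : 0 <= X by exact: normr_ge0.
have k0 : (0 : R) < k.+1%:R by [].
(* Faster functions have coefficient 0. A slower one has coefficient at most 4 log2^2 and is
   dominated with the constant 8 (k+1), so its share is 4 / (8 (k+1)). *)
apply: le_trans (_ : \sum_(i < k.+1 | i != p a) (2 * k.+1%:R)^-1 * X <= _).
  apply: ler_sum => i ia; rewrite -(permKV p i); set b := (p^-1)%g i.
  have ba : b != a by apply: contra ia => /eqP <-; rewrite /b permKV.
  have [ab|] := ltnP a b.
    by rewrite tau_max// mulr0 normr0 mulr_ge0// invr_ge0 mulr_ge0.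
  rewrite leq_eqVlt => /orP[/eqP/val_inj/eqP|]; first by rewrite (negPf ba).
  move=> /(good_dom gT lL)/(_ u Tu); rewrite -/X natrM => dom.
  rewrite normrM mulrC; apply: le_trans (ler_wpM2r (normr_ge0 _) (tu _)) _.
  rewrite ler_pdivlMl ?mulr_gt0//; move: dom; set Z := `|_|; lra.
apply: le_trans (_ : \sum_(i < k.+1) (2 * k.+1%:R)^-1 * X <= _).
  by rewrite [leRHS](bigD1 (p a))//= lerDr mulr_ge0// invr_ge0 mulr_ge0.
rewrite sumr_const card_ord -[leLHS]mulr_natl le_eqVlt; apply/orP; left; apply/eqP.
by field; rewrite gt_eqF.
Qed.

Lemma phase_size l u : (l <= L)%N -> T <= u ->
  (forall i, `|(tau i)%:~R : R| <= 4 * log2 u ^+ 2) ->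
  2^-1 * (`|(tau (p a))%:~R : R| * `|derive1n l (f (p a)) u|) <= `|phase l u| /\
  `|phase l u| <= 2 * (`|(tau (p a))%:~R : R| * `|derive1n l (f (p a)) u|).
Proof.
move=> lL Tu tu; have := phase_main lL Tu tu; have := tau_a_ge1.
set d := derive1n l _ u; set q := (tau (p a))%:~R; set P := phase l u => q1 h.
have e1 : `|q| * `|d| = `|d * q| by rewrite mulrC normrM.
have hd : `|d| <= `|d * q| by rewrite -e1 ler_peMl.
have h1 : `|P| <= `|P - d * q| + `|d * q|.
  by have := ler_normD (P - d * q) (d * q); rewrite subrK.
have h2 : `|d * q| <= `|P - d * q| + `|P|.
  by have := ler_normD (d * q - P) P; rewrite subrK distrC.
by rewrite e1; split; lra.
Qed.

Lemma phase_sgn l (w : R) : (l <= L)%N -> T <= w ->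
  (forall u, w <= u -> forall i, `|(tau i)%:~R : R| <= 4 * log2 u ^+ 2) ->
  (forall u, w <= u -> 0 < phase l u) \/ (forall u, w <= u -> phase l u < 0).
Proof.
move=> lL Tw tu.
have q0 : (tau (p a))%:~R != 0 :> R by rewrite intr_eq0.
have main u (wu : w <= u) := phase_main lL (le_trans Tw wu) (tu u wu).
have q1 := tau_a_ge1; move: main q0 q1; set q := (tau (p a))%:~R => main q0 q1.
have d0 u : w <= u -> 0 < `|derive1n l (f (p a)) u|.
  move=> wu; rewrite normr_gt0; case: (good_sgn gT lL (p a)) => /(_ u (le_trans Tw wu)).
    by rewrite lt0r => /andP[].
  by rewrite lt_neqAle => /andP[].
have step u : w <= u -> 2^-1 * `|derive1n l (f (p a)) u| <
    `|derive1n l (f (p a)) u * q|.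
  move=> wu; have := d0 u wu; rewrite normrM => dn.
  apply: lt_le_trans (_ : `|derive1n l (f (p a)) u| <= _); first by lra.
  by rewrite ler_peMr.
have pos u : w <= u -> 0 < derive1n l (f (p a)) u * q -> 0 < phase l u.
  move=> wu dq; have := step u wu; rewrite (gtr0_norm dq) => h1.
  by have := main u wu; rewrite ler_norml => /andP[h2 _]; lra.
have neg u : w <= u -> derive1n l (f (p a)) u * q < 0 -> phase l u < 0.
  move=> wu dq; have := step u wu; rewrite (ltr0_norm dq) => h1.
  by have := main u wu; rewrite ler_norml => /andP[_ h2]; lra.
move: q0; rewrite neq_lt => /orP[q0|q0];
  case: (good_sgn gT lL (p a)) => hd; [right|left|left|right] => u wu;
  have du := hd u (le_trans Tw wu).
- by apply: neg => //; rewrite pmulr_rlt0.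
- by apply: pos => //; rewrite nmulr_rgt0.
- by apply: pos => //; rewrite pmulr_rgt0.
- by apply: neg => //; rewrite nmulr_rlt0.
Qed.

Lemma phase_derive l u : (l <= L)%N -> T <= u ->
  is_derive u (1 : R) (phase l) (phase l.+1 u).
Proof.
move=> lL Tu; rewrite /phase.
have -> : (fun u => \sum_i derive1n l (f i) u * (tau i)%:~R) =
    \sum_i (fun u => derive1n l (f i) u * (tau i)%:~R).
  by apply/funext => v; rewrite fct_sumE.
apply: is_derive_sum => i.
have := is_derive_M1 (good_derive gT lL i Tu) (is_derive_cst1 (tau i)%:~R u).
by move=> h; apply: is_deriveE h _; rewrite mulr0 addr0.
Qed.

Lemma phase_scaled_derive (c s : R) l t : (l <= L)%N -> T <= s * t ->
  is_derive t (1 : R) (fun t => c * (s ^+ l * phase l (s * t)))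
    (c * (s ^+ l.+1 * phase l.+1 (s * t))).
Proof.
move=> lL Tst.
have ds : is_derive t (1 : R) (fun t : R => s * t) s.
  have h := is_derive_M1 (is_derive_cst1 s t) (is_derive_id t (1 : R)).
  by apply: is_deriveE h _; rewrite mul0r add0r mulr1.
have h := @is_derive1_comp R (phase l) (fun t => s * t) t _ _ (phase_derive lL Tst) ds.
have h2 := is_derive_M1 (is_derive_cst1 (s ^+ l) t) h.
have h3 := is_derive_M1 (is_derive_cst1 c t) h2.
by apply: is_deriveE h3 _; rewrite exprS /=; ring.
Qed.

(** * Size and sign of the scaled phase for one large N *)

Section LargeN.
Variables (N : nat) (s r : R).
Local Notation n := (N%:R : R).
Local Notation k0 := (ln n).
Local Notation w := (n / k0).
Local Notation m0 := (p a).
Local Notation J := (j m0).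
Hypotheses (k0_ge4 : 4 <= k0) (wT : T <= w) (s_bd : 1 <= s <= n) (r_bd : 1 <= r <= n).
Hypotheses (tau_bd : forall i, `|(tau i)%:~R : R| <= log2 n ^+ 2)
  (log2w : log2 n <= 2 * log2 w) (LN : (L <= N)%N).

Local Notation F := (f m0 (s * n)).
(* The l-th derivative of the phase is height / n^l up to powers of ln n. *)
Definition height : R := `|(tau m0)%:~R| * F / r.

Lemma k0_gt0 : 0 < k0. Proof. by have := k0_ge4; lra. Qed.

Lemma n_gt1 : 1 < n.
Proof. by rewrite ltNge; apply/negP => /ln_le0; have := k0_ge4; lra. Qed.

Lemma n_gt0 : 0 < n. Proof. by have := n_gt1; lra. Qed.

Lemma w_ge1 : 1 <= w.
Proof. exact: le_trans (good_ge1 gT) wT. Qed.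

Lemma w_le_n : w <= n.
Proof.
rewrite ler_pdivrMr ?k0_gt0// ler_peMr ?(ltW n_gt0)//.
by have := k0_ge4; lra.
Qed.

Lemma k0_le_n : k0 <= n.
Proof. by have := w_ge1; rewrite ler_pdivlMr ?k0_gt0// mul1r. Qed.

Lemma w_scaled t : w <= t -> T <= s * t /\ w <= s * t.
Proof.
move=> wt; have w1 := w_ge1; case/andP: s_bd => s1 _.
have : t <= s * t by rewrite ler_peMl//; lra.
by have := wT; split; lra.
Qed.

(** The coefficients are bounded in terms of N, the domination is stated in terms of u; on the
    window log2 N <= 2 log2 u, whence the factor 4. *)
Lemma tau_window u : w <= u -> forall i, `|(tau i)%:~R : R| <= 4 * log2 u ^+ 2.
Proof.
move=> wu i; apply: le_trans (tau_bd i) _.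
have w1 := w_ge1.
have lw := good_ln gT wT.
have lwu : ln w <= ln u by rewrite ler_ln ?posrE//; lra.
have h : log2 w <= log2 u by rewrite /log2 ler_ln ?posrE//; lra.
have k4 := k0_ge4.
have ln0 : 0 <= log2 n by rewrite /log2 ln_ge0//; lra.
have hw := log2w.
have : log2 n ^+ 2 <= (2 * log2 u) ^+ 2 by rewrite ler_sqr ?nnegrE//; lra.
by rewrite exprMn; lra.
Qed.

(** The argument is at most 2 n^2 <= n^3, and 3 k0 is rounded up to k0^2. *)
Lemma ln_window t : w <= t <= 2 * n -> 1 <= ln (s * t) /\ ln (s * t) <= k0 ^+ 2.
Proof.
move=> /andP[wt tn]; have [Tst _] := w_scaled wt.
split; first exact: (good_ln gT Tst).
have w1 := w_ge1; have n1 := n_gt1; case/andP: s_bd => s1 sn.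
have k4 := k0_ge4; have kn := k0_le_n.
apply: le_trans (_ : ln (n ^+ 3) <= _).
  rewrite ler_ln ?posrE ?mulr_gt0 ?exprn_gt0//; try lra.
  apply: le_trans (_ : n * (2 * n) <= _); first by apply: ler_pM; lra.
  rewrite [_ ^+ 3]exprS expr2 ler_pM2l; last lra.
  by rewrite ler_pM2r; lra.
by rewrite lnXn ?n_gt0// -[leLHS]mulr_natl expr2; apply: ler_wpM2r; lra.
Qed.

Lemma F_gt0 : 0 < F.
Proof. by apply: (good_gt0 gT); have [] := w_scaled w_le_n. Qed.

(** For t < n, monotonicity bounds the value from above and the decrease of f(u) / u^J bounds it
    from below; for t >= n the roles are exchanged. On the window n / t and t / n are at most k0. *)
Lemma value_window t : w <= t <= 2 * n ->
  F <= f m0 (s * t) * k0 ^+ J /\ f m0 (s * t) <= k0 ^+ J * F.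
Proof.
move=> /andP[wt tn]; have [Tst _] := w_scaled wt; have [Tsn _] := w_scaled w_le_n.
have w1 := w_ge1; have n0 := n_gt0; case/andP: s_bd => s1 sn.
have k4 := k0_ge4; have kpos := k0_gt0.
have F0 := F_gt0; have f0 := good_gt0 gT m0 Tst.
have s0 : 0 < s by lra.
have t0 : 0 < t by lra.
have kJ : 1 <= k0 ^+ J by apply: exprn_ege1; lra.
have [tln|/ltW nlt] := leP t n.
  have st : s * t <= s * n by rewrite ler_pM2l.
  split; last first.
    apply: le_trans (good_mono gT m0 Tst st) _.
    by rewrite ler_peMl// ltW.
  have := good_ratio gT m0 Tst st.
  rewrite ler_pdivrMr ?exprn_gt0 ?mulr_gt0// => h; apply: le_trans h _.
  rewrite mulrAC -mulrA ler_pM2l// -exprVn -exprMn.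
  apply: lerXn2r; rewrite ?nnegrE//.
  - by rewrite mulr_ge0 ?invr_ge0 ?mulr_ge0 ?ltW.
  - exact: ltW.
  - have -> : s * n * (s * t)^-1 = n / t by field; rewrite !gt_eqF.
    rewrite ler_pdivrMr// mulrC -ler_pdivrMr//.
have st : s * n <= s * t by rewrite ler_pM2l.
split.
  apply: le_trans (good_mono gT m0 Tsn st) _.
  by rewrite ler_peMr// ltW.
have := good_ratio gT m0 Tsn st.
rewrite ler_pdivrMr ?exprn_gt0 ?mulr_gt0// => h; apply: le_trans h _.
rewrite mulrAC -mulrA [leRHS]mulrC ler_pM2l// -exprVn -exprMn.
apply: lerXn2r; rewrite ?nnegrE//.
- by rewrite mulr_ge0 ?invr_ge0 ?mulr_ge0 ?ltW.
- exact: ltW.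
- have -> : s * t * (s * n)^-1 = t / n by field; rewrite !gt_eqF.
  by rewrite ler_pdivrMr//; nra.
Qed.

(** By the chain rule, the derivative of order l in t of <f(s t), tau> / r. *)
Definition scaled (l : nat) (t : R) : R := r^-1 * (s ^+ l * phase l (s * t)).

Lemma scaled_norm l t : `|scaled l t| = r^-1 * (s ^+ l * `|phase l (s * t)|).
Proof.
case/andP: s_bd => s1 _; case/andP: r_bd => r1 _.
have rv : 0 <= r^-1 by rewrite invr_ge0; lra.
have sl : 0 <= s ^+ l by rewrite exprn_ge0//; lra.
by rewrite /scaled !normrM (ger0_norm rv) (ger0_norm sl).
Qed.

(** The exponent collects J from [value_window], 4 l from ln(s t)^(2l) <= k0^(4l), l from comparing
    t^l with n^l, and 1 to absorb the constant 2 of [phase_size]. *)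
Lemma scaled_size l t : (l <= L)%N -> w <= t <= 2 * n ->
  `|scaled l t| * n ^+ l <= height * k0 ^+ (J + 5 * l + 1) /\
  height <= `|scaled l t| * n ^+ l * k0 ^+ (J + 5 * l + 1).
Proof.
move=> lL tw; have /andP[wt tn] := tw; have [Tst wst] := w_scaled wt.
have [ln1 lnk] := ln_window tw; have [v1 v2] := value_window tw.
have [p1 p2] := phase_size lL Tst (tau_window wst).
have [z1 z2] := good_size gT lL m0 Tst.
have f0 := good_gt0 gT m0 Tst.
rewrite scaled_norm /height.
have w1 := w_ge1; have n0 := n_gt0; case/andP: s_bd => s1 sn.
case/andP: r_bd => r1 _.
have k4 := k0_ge4; have kpos := k0_gt0; have F0 := F_gt0.
have q0 : 0 <= `|(tau m0)%:~R : R| by [].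
move: p1 p2 z1 z2 v1 v2 q0 f0 F0.
set P := `|phase _ _|; set d := `|derive1n _ _ _|; set q := `|_ : R|.
set fu := f m0 (s * t); set F' := f m0 (s * n) => p1 p2 z1 z2 v1 v2 q0 f0 F0.
have d0 : 0 <= d by exact: normr_ge0.
have s0 : 0 < s by lra.
have t0 : 0 < t by lra.
have lnl : ln (s * t) ^+ (2 * l) <= k0 ^+ (4 * l).
  have -> : (4 * l = 2 * (2 * l))%N by rewrite mulnA.
  by rewrite [leRHS]exprM; apply: lerXn2r; rewrite ?nnegrE ?exprn_ge0//; lra.
have nt : n ^+ l <= k0 ^+ l * t ^+ l.
  rewrite -exprMn; apply: lerXn2r; [by rewrite nnegrE ltW|by rewrite nnegrE mulr_ge0// ltW|].
  by rewrite mulrC -ler_pdivrMr.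
have tn' : t ^+ l <= k0 ^+ l * n ^+ l.
  rewrite -exprMn; apply: lerXn2r; [by rewrite nnegrE ltW|by rewrite nnegrE mulr_ge0// ltW|].
  by apply: le_trans tn _; rewrite ler_pM2r//; lra.
have sl0 : 0 < s ^+ l by exact: exprn_gt0.
have tl0 : 0 < t ^+ l by exact: exprn_gt0.
have nl0 : 0 < n ^+ l by exact: exprn_gt0.
have kl x : 0 < k0 ^+ x by exact: exprn_gt0.
have kE : k0 ^+ (J + 5 * l + 1) = k0 ^+ J * k0 ^+ (4 * l) * k0 ^+ l * k0.
  have e5 : k0 ^+ (5 * l) = k0 ^+ (4 * l) * k0 ^+ l by rewrite -exprD -mulSnr.
  by rewrite exprD expr1 exprD e5 mulrA.
have up : s ^+ l * d * n ^+ l <= k0 ^+ J * k0 ^+ (4 * l) * k0 ^+ l * F'.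
  apply: le_trans (_ : s ^+ l * d * (k0 ^+ l * t ^+ l) <= _).
    by apply: ler_wpM2l => //; rewrite mulr_ge0// ltW.
  have -> : s ^+ l * d * (k0 ^+ l * t ^+ l) = k0 ^+ l * (d * (s * t) ^+ l).
    by rewrite exprMn; ring.
  have -> : k0 ^+ J * k0 ^+ (4 * l) * k0 ^+ l * F' =
    k0 ^+ l * (k0 ^+ (4 * l) * (k0 ^+ J * F')) by ring.
  rewrite ler_pM2l//; apply: le_trans z1 _; apply: ler_pM => //; last by lra.
  by rewrite exprn_ge0//; lra.
have lo : F' <= s ^+ l * d * n ^+ l * (k0 ^+ J * k0 ^+ (4 * l) * k0 ^+ l).
  apply: le_trans v1 _.
  have -> : s ^+ l * d * n ^+ l * (k0 ^+ J * k0 ^+ (4 * l) * k0 ^+ l) =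
    d * (s ^+ l * (k0 ^+ l * n ^+ l)) * k0 ^+ (4 * l) * k0 ^+ J by ring.
  rewrite ler_pM2r//; apply: le_trans z2 _; apply: ler_pM.
  - by rewrite mulr_ge0// exprn_ge0// mulr_ge0// ltW.
  - by rewrite exprn_ge0//; lra.
  - by rewrite exprMn; apply: ler_wpM2l => //; rewrite ler_pM2l.
  - exact: lnl.
have rv : 0 < r^-1 by rewrite invr_gt0; lra.
set U := k0 ^+ J * k0 ^+ (4 * l) * k0 ^+ l in kE up lo.
have U0 : 0 < U by rewrite /U !mulr_gt0.
set S := s ^+ l * d * n ^+ l in up lo; rewrite kE; split.
  have -> : r^-1 * (s ^+ l * P) * n ^+ l = r^-1 * (s ^+ l * n ^+ l * P) by ring.
  have -> : q * F' / r * (U * k0) = r^-1 * (k0 * q * (U * F')) by ring.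
  rewrite ler_pM2l//; apply: le_trans (_ : 2 * q * S <= _).
    have -> : 2 * q * S = s ^+ l * n ^+ l * (2 * (q * d)) by rewrite /S; ring.
    by rewrite ler_pM2l// mulr_gt0.
  apply: ler_pM => //; first by rewrite mulr_ge0.
    by rewrite /S !mulr_ge0// ltW.
  by rewrite ler_wpM2r//; lra.
have -> : q * F' / r = r^-1 * (q * F') by ring.
have -> : r^-1 * (s ^+ l * P) * n ^+ l * (U * k0) =
  r^-1 * (s ^+ l * n ^+ l * (U * k0) * P) by ring.
rewrite ler_pM2l//.
apply: le_trans (_ : q * (S * U) <= _); first exact: ler_wpM2l.
apply: le_trans (_ : s ^+ l * n ^+ l * (U * k0) * (2^-1 * (q * d)) <= _); last first.
  by rewrite ler_pM2l// !mulr_gt0.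
have -> : s ^+ l * n ^+ l * (U * k0) * (2^-1 * (q * d)) = q * (S * U) * (2^-1 * k0).
  by rewrite /S; ring.
rewrite ler_peMr//; last by lra.
by rewrite /S !mulr_ge0// ltW.
Qed.

Lemma scaled_derive c l t : (l <= L)%N -> w <= t ->
  is_derive t (1 : R) (fun t => c * scaled l t) (c * scaled l.+1 t).
Proof.
move=> lL wt; have [Tst _] := w_scaled wt.
have h := phase_scaled_derive (c * r^-1) lL Tst.
have E i : (fun t => c * scaled i t) = (fun t => c * r^-1 * (s ^+ i * phase i (s * t))).
  by apply/funext => x; rewrite /scaled; ring.
by rewrite E -[c * scaled _ _]/((fun t => c * scaled l.+1 t) t) E; exact: h.
Qed.

Lemma scaled_sgn l : (l <= L)%N -> (forall t, w <= t -> 0 < scaled l t) \/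
  (forall t, w <= t -> scaled l t < 0).
Proof.
move=> lL; case/andP: s_bd => s1 _; case/andP: r_bd => r1 _.
have s0 : 0 < s by lra.
have c0 : 0 < r^-1 by rewrite invr_gt0; lra.
have sl : 0 < s ^+ l by exact: exprn_gt0.
case: (phase_sgn lL wT tau_window) => h; [left|right] => t wt;
  have := h (s * t) (w_scaled wt).2; rewrite /scaled.
  by move=> hh; apply: mulr_gt0 => //; exact: mulr_gt0.
by move=> hh; rewrite (pmulr_rlt0 _ c0) (pmulr_rlt0 _ sl).
Qed.

(** Conjugating if necessary makes the derivative of order l positive, so bounds on its absolute
    value become bounds on the differences. A difference of order at most L starting at m + M <= N
    only sees arguments up to N + L <= 2N, which is why the window extends to 2N. *)
Lemma window_sequence l M len : (0 < l)%N -> (l < L)%N -> w <= M%:R -> (len + M <= N.+1)%N ->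
  exists g : nat -> R,
  [/\ cmod (\sum_(0 <= m < len) e (r^-1 * phase 0 (s * (m + M)%:R))) =
        cmod (expsum g len),
      forall lo hi, (forall t, w <= t <= 2 * n -> lo <= `|scaled l t| <= hi) ->
        forall m, (m < len)%N -> lo <= iter l (@fdiff R) g m <= hi &
      same_sign len (iter l.+1 (@fdiff R) g)].
Proof.
move=> l_gt0 lL wM lenM.
have range m i (t : R) : (m < len)%N -> (i <= L)%N ->
    (m + M)%:R <= t <= (m + M + i)%:R -> w <= t <= 2 * n.
  move=> mlen iL /andP[h1 h2]; apply/andP; split.
    by apply: le_trans h1; apply: le_trans wM _; rewrite ler_nat leq_addl.
  apply: le_trans h2 _; rewrite -natrM ler_nat mul2n -addnn; apply: leq_add.
    by rewrite -ltnS; apply: leq_trans lenM; rewrite ltn_add2r.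
  exact: leq_trans LN.
have main c : (forall t, w <= t -> c * scaled l t = `|scaled l t|) ->
    (forall lo hi, (forall t, w <= t <= 2 * n -> lo <= `|scaled l t| <= hi) ->
        forall m, (m < len)%N -> lo <= iter l (@fdiff R)
         (fun m => c * scaled 0 (m + M)%:R) m <= hi) /\
    same_sign len (iter l.+1 (@fdiff R) (fun m => c * scaled 0 (m + M)%:R)).
  move=> hc; pose D i t := c * scaled i t.
  have DD m i i' (t : R) : (m < len)%N -> (i < i')%N -> (i' <= L)%N ->
      (m + M)%:R <= t <= (m + M + i')%:R -> is_derive t (1 : R) (D i) (D i.+1 t).
    move=> mlen ii' i'L ht; have /andP[wt _] := range m i' t mlen i'L ht.
    by apply: scaled_derive => //; exact/ltnW/(leq_trans ii').
  have shift i m := iter_fdiff_addn (fun x => D 0%N x%:R) M i m.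
  split.
    move=> lo hi hlh m mlen; rewrite shift.
    apply: (@iter_fdiff_derive R D l (m + M) (fun x => lo <= x <= hi)).
      by move=> i t il ht; apply: (DD m i l t mlen il (ltnW lL)).
    move=> t /(range m l t mlen (ltnW lL)) ht; rewrite /D hc ?hlh//.
    by case/andP: ht.
  have sg : (forall t, w <= t -> 0 <= D l.+1 t) \/ (forall t, w <= t -> D l.+1 t <= 0).
    have [c0|c0] := leP 0 c; case: (scaled_sgn lL) => h; [left|right|right|left] => t wt;
      have ht := h t wt; rewrite /D.
    - by rewrite mulr_ge0// ltW.
    - by rewrite mulr_ge0_le0// ltW.
    - by rewrite mulr_le0_ge0// ltW.
    - by rewrite mulr_le0// ltW.
  case: sg => sg; [left|right] => m mlen; rewrite shift.
    apply: (@iter_fdiff_derive R D l.+1 (m + M) (fun x => 0 <= x)).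
      by move=> i t il ht; apply: (DD m i l.+1 t mlen il lL).
    by move=> t /(range m l.+1 t mlen lL)/andP[wt _]; exact: sg.
  apply: (@iter_fdiff_derive R D l.+1 (m + M) (fun x => x <= 0)).
    by move=> i t il ht; apply: (DD m i l.+1 t mlen il lL).
  by move=> t /(range m l.+1 t mlen lL)/andP[wt _]; exact: sg.
have s0E m : r^-1 * phase 0 (s * (m + M)%:R) = scaled 0 (m + M)%:R.
  by rewrite /scaled expr0 mul1r.
case: (scaled_sgn (ltnW lL)) => sg.
  have [|h1 h2] := main 1; first by move=> t wt; rewrite mul1r gtr0_norm// sg.
  exists (fun m => 1 * scaled 0 (m + M)%:R); split => //.
  by congr cmod; apply: eq_bigr => m _; rewrite mul1r s0E.
have [|h1 h2] := main (- 1); first by move=> t wt; rewrite mulN1r ltr0_norm// sg.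
exists (fun m => - 1 * scaled 0 (m + M)%:R); split => //.
rewrite -cmod_expsumN; congr cmod; apply: eq_bigr => m _.
by rewrite mulN1r opprK s0E.
Qed.

End LargeN.

End Window.
End Core.

(** * The exponential sum for one large N *)

Section ExponentialSumBound.
Variable R : realType.

(** One exponent and one constant for finitely many orders: since K >= 1, a larger exponent only
    strengthens the hypotheses of each test. *)
Lemma derivative_test_leq (m : nat) : exists (q : nat) (c : R), 0 <= c /\
  forall l, (l <= m)%N ->
  forall (g : nat -> R) n N (K lam Lam : R), 2 <= K -> (n <= N)%N -> 0 < lam -> lam <= Lam ->
    K ^+ q * Lam <= 1 -> K ^+ q * Lam <= (N%:R * lam) ^+ 2 ->
    (forall m, (m < n)%N -> lam <= iter l.+2 (@fdiff R) g m <= Lam) ->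
    same_sign n (iter l.+3 (@fdiff R) g) ->
    cmod (expsum g n) <= c * N%:R / K.
Proof.
elim: m => [|m [q [c [c0 IH]]]].
  have [q [c [c0 h]]] := derivative_test R 0.
  by exists q, c; split=> // l; rewrite leqn0 => /eqP ->.
have [q' [c' [c'0 h]]] := derivative_test R m.+1.
exists (maxn q q'), (c + c'); split; first by rewrite addr_ge0.
move=> l lm g n N K lam Lam K2 nN lam0 lamL H1 H2 hg hs.
have K0 : 0 < K by lra.
have L0 : 0 <= Lam by lra.
have Kq i : (i <= maxn q q')%N -> K ^+ i * Lam <= K ^+ maxn q q' * Lam.
  by move=> ?; apply: ler_wpM2r => //; apply: ler_weXn2l => //; lra.
move: lm; rewrite leq_eqVlt => /predU1P[lE|lm].
  subst l; apply: le_trans (h g n N K lam Lam K2 nN lam0 lamL _ _ hg hs) _.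
  - by apply: le_trans H1; apply: Kq; rewrite leq_maxr.
  - by apply: le_trans H2; apply: Kq; rewrite leq_maxr.
  - by rewrite ler_pM2r ?invr_gt0// ler_wpM2r//; lra.
apply: le_trans (IH l lm g n N K lam Lam K2 nN lam0 lamL _ _ hg hs) _.
- by apply: le_trans H1; apply: Kq; rewrite leq_maxl.
- by apply: le_trans H2; apply: Kq; rewrite leq_maxl.
- by rewrite ler_pM2r ?invr_gt0// ler_wpM2r//; lra.
Qed.

Lemma odd_power_bracket (n y : R) (m : nat) : n < y -> y <= n ^+ (2 * m + 3) ->
  exists2 l, (l <= m)%N & n ^+ (2 * l + 1) <= y /\ y <= n ^+ (2 * l + 3).
Proof.
move=> ny; elim: m => [|m IH] ym.
  by exists 0%N => //; split; rewrite // expr1 ltW.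
have [/IH[l lm h]|h] := leP y (n ^+ (2 * m + 3)); first by exists l => //; exact: leqW.
exists m.+1 => //; split => //.
have -> : (2 * m.+1 + 1 = 2 * m + 3)%N by rewrite mulnS; lia.
exact: ltW.
Qed.

Section Window.
Variables (k : nat) (f : 'I_k.+1 -> R -> R) (j : 'I_k.+1 -> nat) (p : 'S_k.+1).
Variables (L : nat) (T : R).
Hypothesis gT : good f j p L T.
Variables (tau : 'I_k.+1 -> int) (a : 'I_k.+1).
Hypotheses (tau_a : tau (p a) != 0)
  (tau_max : forall b : 'I_k.+1, (a < b)%N -> tau (p b) = 0).
Variables (N : nat) (s r : R).
Local Notation n := (N%:R : R).
Local Notation k0 := (ln n).
Local Notation w := (n / k0).
Local Notation m0 := (p a).
Local Notation J := (j m0).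
Local Notation F := (f m0 (s * n)).
Hypotheses (k0_ge4 : 4 <= k0) (wT : T <= w) (s_bd : 1 <= s <= n) (r_bd : 1 <= r <= n).
Hypotheses (tau_bd : forall i, `|(tau i)%:~R : R| <= log2 n ^+ 2)
  (log2w : log2 n <= 2 * log2 w) (LN : (L <= N)%N).
Hypothesis r_le : r * k0 ^+ 5 <= f m0 n.

Local Notation Y := (height f p tau a N s r).
Local Notation block len M :=
  (cmod (\sum_(0 <= m < len) e (r^-1 * phase f tau 0 (s * (m + M)%:R)))).

Lemma Y_gt0 : 0 < Y.
Proof.
case/andP: r_bd => r1 _.
have F0 := F_gt0 gT a k0_ge4 wT s_bd.
have q0 : 0 < `|(tau m0)%:~R : R| by exact: (lt_le_trans ltr01 (tau_a_ge1 R tau_a)).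
rewrite /height; apply: divr_gt0; first exact: mulr_gt0.
exact: lt_le_trans ltr01 r1.
Qed.

Lemma fn_le_F : f m0 n <= F.
Proof.
have n0 := n_gt0 k0_ge4; case/andP: s_bd => s1 _.
apply: (good_mono gT); last by rewrite ler_peMl// ltW.
exact: le_trans wT (w_le_n k0_ge4).
Qed.

Lemma F_le_rY : F <= r * Y.
Proof.
case/andP: r_bd => r1 _; have F0 := F_gt0 gT a k0_ge4 wT s_bd.
have -> : r * Y = `|(tau m0)%:~R| * F by rewrite /height; field; lra.
apply: ler_peMl; [exact: ltW|exact: (tau_a_ge1 R tau_a)].
Qed.

(* When f m0 grows at least like n^2, the height is at least n, so only the
   growth types 1 and 2 occur here. *)
Lemma block_low M len : (1 < L)%N -> k0 ^+ (2 * (J + 6) + 4) <= n -> Y ^+ 2 <= n ->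
  w <= M%:R -> (len + M <= N.+1)%N -> block len M <= 20 * n / k0.
Proof.
move=> L1 kn Yn wM lenM.
have n0 := n_gt0 k0_ge4; have n1 := n_gt1 k0_ge4; have kpos := k0_gt0 k0_ge4.
have Y0 := Y_gt0; case/andP: (r_bd) => r1 rn; case/andP: (s_bd) => s1 _.
have J2 : (J <= 2)%N.
  rewrite leqNgt; apply/negP => J3.
  have h1 : n ^+ J.-1 <= f m0 n.
    by have [] := good_power gT m0 (le_trans wT (w_le_n k0_ge4)).
  have h2 : n ^+ 2 <= n ^+ J.-1.
    by apply: ler_weXn2l; [exact: ltW|rewrite -ltnS prednK// (leq_trans _ J3)].
  have h3 : n ^+ 2 <= n * Y.
    apply: le_trans h2 _; apply: le_trans h1 _; apply: le_trans fn_le_F _.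
    by apply: le_trans F_le_rY _; rewrite ler_pM2r.
  have h4 : n <= Y by move: h3; rewrite expr2 ler_pM2l.
  have : n ^+ 2 <= Y ^+ 2 by apply: lerXn2r h4; rewrite nnegrE; exact: ltW.
  by rewrite expr2; nra.
have [g [-> hg hs]] := window_sequence gT tau_a tau_max k0_ge4 wT s_bd r_bd
  tau_bd log2w LN (isT : 0 < 1)%N L1 wM lenM.
have -> : 20 * n / k0 = 5 / (k0 / (4 * n)) by field; rewrite !gt_eqF.
apply: kusmin_landau => //; first by rewrite divr_gt0// mulr_gt0.
move=> m mlen; apply: (hg _ _ _ m mlen) => t tw.
have /andP[wt tn] := tw.
have [Tst wst] := w_scaled gT wT s_bd wt.
have [lnu1 lnu2] := ln_window gT k0_ge4 wT s_bd tw.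
have [v1 _] := value_window gT a k0_ge4 wT s_bd tw.
have [X1 _] := scaled_size gT tau_a tau_max k0_ge4 wT s_bd r_bd tau_bd log2w (ltnW L1) tw.
apply/andP; split; last first.
  set X := `|_| in X1 *; rewrite expr1 muln1 -addnA in X1.
  set U := k0 ^+ (J + (5 + 1)) in X1.
  (* After squaring, Y^2 <= n leaves U^2 * 256 <= n to show; with U = k0^(J+6) and 256 = 4^4 <= k0^4
     this is the assumed power of k0. *)
  have YU : Y * U <= 16^-1 * n.
    apply: le_sqr_le; first by rewrite mulr_ge0 ?ltW//; lra.
    rewrite exprMn [_ ^+ 2 as X in _ <= X]exprMn.
    have -> : 16^-1 ^+ 2 * n ^+ 2 = n * (n / 256) by field.
    have UU : U ^+ 2 * 256 <= n.
      apply: le_trans kn; rewrite /U -exprM mulnC exprD ler_pM2l ?exprn_gt0//.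
      have -> : 256 = 4 ^+ 4 :> R by ring.
      by apply: lerXn2r; rewrite ?nnegrE//; lra.
    apply: ler_pM => //; rewrite ?sqr_ge0//.
    by rewrite ler_pdivlMr.
  by rewrite -(ler_pM2r n0); exact: le_trans X1 YU.
have w1 := w_ge1 gT wT.
have t0 : 0 < t by lra.
have s0 : 0 < s by lra.
have [p1 _] := phase_size gT tau_a tau_max (ltnW L1) Tst
  (tau_window gT k0_ge4 wT tau_bd log2w wst).
have [d0 slope] := good_slope gT m0 Tst.
rewrite derive1n1 in p1; rewrite (scaled_norm f tau s_bd r_bd) expr1.
move: p1 d0 slope v1; set P := `|phase _ _ _ _|; set d := derive1 _ _.
set fu := f m0 (s * t) => p1 d0 slope v1.
have q1 := tau_a_ge1 R tau_a; rewrite (gtr0_norm d0) in p1.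
have dP : d <= 2 * P.
  have : d <= `|(tau m0)%:~R| * d by apply: ler_peMl => //; exact: ltW.
  lra.
have k1 : 1 <= k0 by have := k0_ge4; lra.
(* Growth type at most 2 caps the loss of [value_window] at two logarithms. *)
have kJ : k0 ^+ J <= k0 ^+ 2 by exact: (ler_weXn2l k1 J2).
have fu0 : 0 < fu by apply: (good_gt0 gT m0 Tst).
have A1 : r * k0 ^+ 5 <= fu * k0 ^+ 2.
  apply: le_trans r_le _; apply: le_trans fn_le_F _; apply: le_trans v1 _.
  by rewrite ler_pM2l.
have A2 : r * k0 ^+ 3 <= fu.
  rewrite -(ler_pM2r (_ : 0 < k0 ^+ 2)) ?exprn_gt0//.
  by rewrite -mulrA -exprD.
have A3 : fu <= 2 * P * (s * (2 * n)) * k0 ^+ 2.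
  have st0 : 0 <= s * t by rewrite mulr_ge0// ltW.
  apply: le_trans slope _; apply: ler_pM lnu2.
  - by rewrite mulr_ge0// ltW.
  - exact: le_trans ler01 lnu1.
  - by apply: ler_pM dP _ => //; [exact: ltW|rewrite (ler_pM2l s0)].
have A4 : r * k0 <= 4 * P * s * n.
  rewrite -(ler_pM2r (_ : 0 < k0 ^+ 2)) ?exprn_gt0//.
  have -> : r * k0 * k0 ^+ 2 = r * k0 ^+ 3 by ring.
  by apply: le_trans A2 _; apply: le_trans A3 _; rewrite le_eqVlt; apply/orP; left; apply/eqP; ring.
rewrite ler_pdivrMr ?mulr_gt0// mulrC -(ler_pM2l (_ : 0 < r)); last by lra.
apply: le_trans A4 _; rewrite le_eqVlt; apply/orP; left; apply/eqP; field; lra.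
Qed.

(** The coefficient is at most n and F <= (s n)^J <= n^(2J), so Y <= n^(2J+1). This bounds the order
    of differentiation in terms of J alone. *)
Lemma Y_le : k0 ^+ 2 <= n -> Y ^+ 2 <= n ^+ (2 * (2 * J) + 2).
Proof.
move=> kn; have n0 := n_gt0 k0_ge4; have n1 := n_gt1 k0_ge4; have kpos := k0_gt0 k0_ge4.
have Y0 := Y_gt0; case/andP: (r_bd) => r1 rn; case/andP: (s_bd) => s1 sn.
have F0 := F_gt0 gT a k0_ge4 wT s_bd.
have -> : (2 * (2 * J) + 2 = (2 * J + 1) * 2)%N by rewrite mulnDl mulnC.
rewrite exprM; apply: lerXn2r; first by rewrite nnegrE ltW.
  by rewrite nnegrE exprn_ge0// ltW.
have q_le : `|(tau m0)%:~R : R| <= n.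
  apply: le_trans (tau_bd m0) _; apply: le_trans kn.
  have l0 : 0 <= log2 n by rewrite /log2 ln_ge0//; have := k0_ge4; lra.
  apply: lerXn2r; rewrite ?nnegrE ?(ltW kpos)//.
  by apply/ltW; rewrite /log2; apply: ln_sublinear.
have F_le : F <= n ^+ (2 * J).
  have [_ h] := good_power gT m0 (w_scaled gT wT s_bd (w_le_n k0_ge4)).1.
  apply: le_trans h _; rewrite exprM.
  apply: lerXn2r; rewrite ?nnegrE ?exprn_ge0 ?mulr_ge0//; try lra.
  by rewrite expr2 ler_pM2r.
rewrite /height exprD expr1 [leRHS]mulrC ler_pdivrMr; last lra.
apply: le_trans (_ : n * n ^+ (2 * J) <= _); first by apply: ler_pM => //; exact: ltW.
by rewrite ler_peMr// mulr_ge0// ?exprn_ge0// ltW.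
Qed.

(** Both conditions of the test are checked after squaring, so that Y^2 meets integer powers of n.
    The exponent of k0 collects 2 q + 2 B from the square of [k0^q * Lam] and 4 B from the fourth
    power of [lam], where B is the exponent of [scaled_size]. *)
Lemma block_high M len l q (c : R) : (l.+2 < L)%N ->
  (forall (g : nat -> R) n N (K lam Lam : R), 2 <= K -> (n <= N)%N -> 0 < lam -> lam <= Lam ->
    K ^+ q * Lam <= 1 -> K ^+ q * Lam <= (N%:R * lam) ^+ 2 ->
    (forall m, (m < n)%N -> lam <= iter l.+2 (@fdiff R) g m <= Lam) ->
    same_sign n (iter l.+3 (@fdiff R) g) ->
    cmod (expsum g n) <= c * N%:R / K) ->
  k0 ^+ (2 * q + 6 * (J + 5 * l.+2 + 1)) <= n ->
  n ^+ (2 * l + 1) <= Y ^+ 2 -> Y ^+ 2 <= n ^+ (2 * l + 3) ->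
  w <= M%:R -> (0 < M)%N -> (len + M <= N.+1)%N -> block len M <= c * n / k0.
Proof.
move=> lL test kn Ylo Yhi wM M0 lenM.
have n0 := n_gt0 k0_ge4; have kpos := k0_gt0 k0_ge4; have Y0 := Y_gt0.
have [g [-> hg hs]] := window_sequence gT tau_a tau_max k0_ge4 wT s_bd r_bd
  tau_bd log2w LN (isT : 0 < l.+2)%N lL wM lenM.
set B := (J + 5 * l.+2 + 1)%N in kn.
have k1 : 1 <= k0 by have := k0_ge4; lra.
have kx x : 0 < k0 ^+ x by exact: exprn_gt0.
have nx x : 0 < n ^+ x by exact: exprn_gt0.
have kn' x : (x <= 2 * q + 6 * B)%N -> k0 ^+ x <= n.
  by move=> hx; apply: le_trans kn; exact: ler_weXn2l.
pose lam := Y / (n ^+ l.+2 * k0 ^+ B); pose Lam := Y * k0 ^+ B / n ^+ l.+2.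
have kB : 1 <= k0 ^+ B by exact: exprn_ege1.
have nk : 0 < n ^+ l.+2 * k0 ^+ B by apply: mulr_gt0; [exact: nx|exact: kx].
have n2l := nx (2 * l.+2)%N.
have nnk : 0 < n ^+ (2 * l.+2) * n ^+ (2 * l.+2) * k0 ^+ (4 * B).
  by apply: mulr_gt0; [exact: mulr_gt0|exact: kx].
apply: (test g len N k0 lam Lam) => //.
- by have := k0_ge4; lra.
- by rewrite -ltnS; apply: leq_trans lenM; rewrite -[len.+1]addn1 leq_add2l.
- by rewrite divr_gt0// mulr_gt0.
- rewrite /lam /Lam (ler_pdivrMr _ _ nk).
  have -> : Y * k0 ^+ B / n ^+ l.+2 * (n ^+ l.+2 * k0 ^+ B) = Y * (k0 ^+ B * k0 ^+ B).
    by field; rewrite gt_eqF.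
  by apply: ler_peMr; [exact: ltW|exact: mulr_ege1].
- apply: le_sqr_le; first exact: ler01.
  have -> : (k0 ^+ q * Lam) ^+ 2 = k0 ^+ (2 * q + 2 * B) * Y ^+ 2 / n ^+ (2 * l.+2).
    by rewrite /Lam exprD ![(2 * _)%N]mulnC !exprM; field; rewrite gt_eqF.
  rewrite expr1n (ler_pdivrMr _ _ n2l) mul1r.
  have -> : (2 * l.+2 = 1 + (2 * l + 3))%N by clear; lia.
  rewrite [n ^+ (1 + _)]exprD expr1; apply: ler_pM => //; [exact: ltW|exact: sqr_ge0|].
  by apply: kn'; rewrite leq_add2l leq_mul.
- apply: le_sqr_le; first exact: sqr_ge0.
  have -> : (k0 ^+ q * Lam) ^+ 2 = k0 ^+ (2 * q + 2 * B) * Y ^+ 2 / n ^+ (2 * l.+2).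
    by rewrite /Lam exprD ![(2 * _)%N]mulnC !exprM; field; rewrite gt_eqF.
  have -> : ((n * lam) ^+ 2) ^+ 2 =
      n ^+ 4 * Y ^+ 2 * Y ^+ 2 / (n ^+ (2 * l.+2) * n ^+ (2 * l.+2) * k0 ^+ (4 * B)).
    rewrite /lam [(2 * l.+2)%N]mulnC [(4 * B)%N]mulnC !exprM; field.
    by rewrite !gt_eqF.
  rewrite (ler_pdivrMr _ _ n2l) mulrAC (ler_pdivlMr _ _ nnk).
  have -> : k0 ^+ (2 * q + 2 * B) * Y ^+ 2 * (n ^+ (2 * l.+2) * n ^+ (2 * l.+2) * k0 ^+ (4 * B)) =
     k0 ^+ (2 * q + 6 * B) * n ^+ (2 * l.+2) * (Y ^+ 2 * n ^+ (2 * l.+2)).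
    have -> : (2 * q + 6 * B = 2 * q + 2 * B + 4 * B)%N by rewrite -addnA -mulnDl.
    by rewrite [in RHS]exprD; ring.
  have -> : n ^+ 4 * Y ^+ 2 * Y ^+ 2 * n ^+ (2 * l.+2) =
    n ^+ 4 * Y ^+ 2 * (Y ^+ 2 * n ^+ (2 * l.+2)) by ring.
  rewrite ler_pM2r; last by apply: mulr_gt0 => //; exact: exprn_gt0.
  (* Here too the logarithms cost one factor n, and n^(2l+5) = n^4 * n^(2l+1) is what the lower end
     of the bracket provides. *)
  apply: le_trans (_ : n * n ^+ (2 * l.+2) <= _); first by rewrite (ler_pM2r n2l).
  rewrite -exprS; have -> : ((2 * l.+2).+1 = 4 + (2 * l + 1))%N by clear; lia.
  by rewrite [n ^+ (4 + _)]exprD (ler_pM2l (nx 4%N)).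
- move=> m mlen; apply: (hg _ _ _ m mlen) => t tw.
  have [h1 h2] := scaled_size gT tau_a tau_max k0_ge4 wT s_bd r_bd tau_bd log2w (ltnW lL) tw.
  rewrite -/B in h1 h2; rewrite /lam /Lam (ler_pdivrMr _ _ nk) mulrA h2/=.
  by rewrite (ler_pdivlMr _ _ (nx _)).
Qed.

(** [L] is the highest order met: l <= 2 Jm, and the test of order l + 2 also looks at the sign of
    the next difference. *)
Lemma window_bound Jm q (c : R) : (J <= Jm)%N -> L = (2 * Jm + 3)%N -> 0 <= c ->
  (forall l, (l <= 2 * Jm)%N ->
    forall (g : nat -> R) n N (K lam Lam : R), 2 <= K -> (n <= N)%N -> 0 < lam -> lam <= Lam ->
    K ^+ q * Lam <= 1 -> K ^+ q * Lam <= (N%:R * lam) ^+ 2 ->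
    (forall m, (m < n)%N -> lam <= iter l.+2 (@fdiff R) g m <= Lam) ->
    same_sign n (iter l.+3 (@fdiff R) g) ->
    cmod (expsum g n) <= c * N%:R / K) ->
  k0 ^+ (2 * q + 6 * (Jm + 5 * (2 * Jm).+2 + 1)) <= n ->
  cmod (\sum_(1 <= m < N.+1) e (r^-1 * inner (fun i => f i (s * m%:R)) tau)) <=
    (c + 21) * n / k0.
Proof.
move=> JJ LE c0 test kn.
have n0 := n_gt0 k0_ge4; have n1 := n_gt1 k0_ge4; have kpos := k0_gt0 k0_ge4.
have k1 : 1 <= k0 by have := k0_ge4; lra.
have kn' x : (x <= 2 * q + 6 * (Jm + 5 * (2 * Jm).+2 + 1))%N -> k0 ^+ x <= n.
  by move=> hx; apply: le_trans kn; exact: ler_weXn2l.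
have w0 : 0 <= w by rewrite divr_ge0// ltW.
(* The first integer beyond w, so that at most w terms precede it. *)
pose M := (Num.truncn w).+1.
have /andP[Mw wM] := truncn_itv w0.
have MN : (M <= N.+1)%N.
  by rewrite ltnS -(ler_nat R); apply: le_trans Mw _; exact: w_le_n.
rewrite (@big_cat_nat _ _ _ M)//=; apply: le_trans (cmodD _ _) _.
(* One unit for the terms before the window; 20 is the constant of [block_low] and [c] that of
   [block_high]. *)
have -> : (c + 21) * n / k0 = w + (c + 20) * n / k0 by field; rewrite gt_eqF.
apply: lerD.
  apply: le_trans (cmod_sum _ _ _) _.
  under eq_bigr do rewrite cmod_e.
  by rewrite sumr_const_nat subn1.
rewrite -{1}[M]add0n big_addn.
have -> : \sum_(0 <= i < N.+1 - M) e (r^-1 * inner (fun i0 => f i0 (s * (i + M)%:R)) tau) =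
  \sum_(0 <= i < N.+1 - M) e (r^-1 * phase f tau 0 (s * (i + M)%:R)) by [].
have lenM : (N.+1 - M + M <= N.+1)%N by rewrite subnK.
have wM' : w <= M%:R by exact: ltW.
have le_c x : x <= c + 20 -> x * n / k0 <= (c + 20) * n / k0.
  by move=> hx; rewrite ler_pM2r ?invr_gt0// ler_pM2r.
have [Yn|Yn] := leP (Y ^+ 2) n.
  apply: le_trans (block_low _ _ Yn wM' lenM) _.
  - by rewrite LE addn3.
  - by apply: kn'; move: JJ; clear; lia.
  - by apply: le_c; lra.
have Yhi : Y ^+ 2 <= n ^+ (2 * (2 * Jm) + 3).
  apply: le_trans (Y_le _) _; first by apply: kn'; clear; lia.
  by apply: ler_weXn2l; [exact: ltW|move: JJ; clear; lia].
have [l lJ [h1 h2]] := odd_power_bracket Yn Yhi.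
apply: le_trans (block_high _ (test l lJ) _ h1 h2 wM' _ lenM) _ => //.
- by rewrite LE; move: lJ; clear; lia.
- by apply: kn'; move: JJ lJ; clear; lia.
- by apply: le_c; lra.
Qed.

End Window.
End ExponentialSumBound.

(** * Translating the assumptions, and the theorem *)

Section Preliminaries.
Variable R : realType.
Implicit Types (f g u v : R -> R).

Lemma prec_near u v : (\forall t \near +oo, 0 < u t) -> u ≺ v ->
  forall A : R, \forall t \near +oo, A * u t <= v t.
Proof.
move=> u0 /cvgryPge uv A; apply: filterS2 u0 (uv A) => t ut0.
by rewrite ler_pdivlMr.
Qed.

Lemma prec_osmall u v : (\forall t \near +oo, 0 < u t) -> u ≺ v -> osmall u v.
Proof.
move=> u0 uv n; apply: filterS2 u0 (prec_near u0 uv n%:R) => t ut0 h.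
by rewrite gtr0_norm//; apply: le_trans h (ler_norm _).
Qed.

Lemma prec_gt0 u v : (\forall t \near +oo, 0 < u t) -> u ≺ v ->
  \forall t \near +oo, 0 < v t.
Proof.
move=> u0 uv; apply: filterS2 u0 (prec_near u0 uv 1) => t ut0.
by rewrite mul1r; exact: lt_le_trans.
Qed.

Lemma near_Xn_gt0 m : \forall t \near +oo, 0 < (t : R) ^+ m.
Proof. by apply: filterS (near_ge 1) => t t1; rewrite exprn_gt0//; lra. Qed.

Lemma osmall_log2_trans u v w : osmall (fun t => u t * log2 t ^+ 4) v ->
  osmall (fun t => v t * log2 t ^+ 4) w -> osmall (fun t => u t * log2 t ^+ 4) w.
Proof.
move=> uv; apply: osmall_le; apply: filterS2 (uv 1%N) (near_log2_ge 1) => t + l1.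
rewrite mul1r => h; apply: le_trans h _.
rewrite normrM ler_peMr// ger0_norm ?exprn_ge0 ?exprn_ege1//; lra.
Qed.

Lemma near_large (T : R) (L Q : nat) : \forall x \near +oo,
  [/\ 4 <= ln x, T <= x / ln x, log2 x <= 2 * log2 (x / ln x), ln x ^+ Q <= x & L%:R <= x].
Proof.
apply: filterS3 (filterI (near_ge L%:R) (near_ln_ge 4)) (filterI (near_ge 1) (near_ln_ge T))
  (filterI (pow_ln_le R Q) (pow_ln_le R 2)) => x [/= xL l4] [/= x1 lT] [/= xQ x2].
have l0 : 0 < ln x by lra.
have x0 : 0 < x by lra.
have lx : ln x <= x / ln x by rewrite ler_pdivlMr// -expr2.
have y0 : 0 < x / ln x by lra.
split => //; first by lra.
have h1 : ln x <= 2 * ln (x / ln x).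
  have -> : 2 * ln (x / ln x) = ln ((x / ln x) ^+ 2) by rewrite lnXn// mulr_natl.
  rewrite ler_ln ?posrE ?exprn_gt0// expr_div_n ler_pdivlMr ?exprn_gt0//.
  by rewrite expr2 ler_pM2l.
set y := ln (x / ln x) in h1.
(* As ln x >= 4 forces y >= 2, ln x <= 2 y <= y^2; taking logarithms gives the claim on log2. *)
have y2 : ln x <= y ^+ 2 by nra.
have yp : 0 < y by lra.
have -> : 2 * log2 (x / ln x) = ln (y ^+ 2) by rewrite lnXn// mulr_natl.
by rewrite /log2 ler_ln ?posrE ?exprn_gt0.
Qed.

Lemma chain_osmall k (g : 'I_k.+1 -> R -> R) :
  (forall a b : 'I_k.+1, b = a.+1 :> nat -> osmall (fun t => g a t * log2 t ^+ 4) (g b)) ->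
  forall a b : 'I_k.+1, (a < b)%N -> osmall (fun t => g a t * log2 t ^+ 4) (g b).
Proof.
move=> step a [b bk]; elim: b bk => [|b IH] bk; first by rewrite ltn0.
rewrite /= ltnS leq_eqVlt => /orP[/eqP ab|ab]; first by apply: step; rewrite /= ab.
have bk' : (b < k.+1)%N by exact: ltnW.
by apply: osmall_log2_trans (IH bk' ab) _; exact: step.
Qed.

Lemma trivial_bound (h : nat -> R) N : cmod (\sum_(1 <= i < N.+1) e (h i)) <= N%:R.
Proof.
apply: le_trans (cmod_sum _ _ _) _.
under eq_bigr do rewrite cmod_e.
by rewrite sumr_const_nat subn1.
Qed.

End Preliminaries.

Theorem theorem4p2 (R : realType) (H : set (germ R)) (k : nat)
    (f : 'I_k.+1 -> R -> R) :
  hardy_field H ->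
  (forall i, germ_of (f i) \in H) ->
  (forall i, exists2 j : nat, (1 <= j)%N &
     (fun t : R => t ^+ j.-1) ≺ f i /\ f i ≺ (fun t : R => t ^+ j)) ->
  (forall i, @log2 R ≺ (fun t => ln (f i t))) ->
  (exists p : 'S_k.+1, forall i j : 'I_k.+1, j = i.+1 :> nat ->
     (fun t : R => log2 t ^+ 4) ≺ (fun t => f (p j) t / f (p i) t)) ->
  exists2 C : R, 0 < C &
    forall N : nat, (1 <= N)%N ->
    forall r s : R,
      r \in `[1, Num.min N%:R (minabs f N%:R / ln N%:R ^+ 5)] ->
      s \in `[1, Num.min N%:R (minabs f N%:R / ln N%:R ^+ 5)] ->
      s <= r ->
    forall tau : 'I_k.+1 -> int,
      (forall i, (tau i)%:~R \in `[- log2 (N%:R : R) ^+ 2, log2 (N%:R : R) ^+ 2]) ->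
      (exists i, tau i != 0) ->
      `| \sum_(1 <= n < N.+1) e (r^-1 * inner (fun i => f i (s * n%:R)) tau) |
        <= (C * N%:R / ln N%:R)%:C.
Proof.
move=> HH Hf type_f log_f [p ratio_f].
have [K LK HK] := hfield_logs (hardy_hfield HH).
have type_ex i : exists m : nat, (1 <= m)%N /\
    ((fun t : R => t ^+ m.-1) ≺ f i /\ f i ≺ (fun t : R => t ^+ m)).
  by have [m m1 hm] := type_f i; exists m.
pose j i := projT1 (cid (type_ex i)); have hj i : (1 <= j i)%N /\
    ((fun t : R => t ^+ (j i).-1) ≺ f i /\ f i ≺ (fun t : R => t ^+ j i)).
  exact: projT2 (cid (type_ex i)).
have f_gt0 i : \forall t \near +oo, 0 < f i t.
  by apply: prec_gt0 (near_Xn_gt0 R (j i).-1) _; have [_ []] := hj i.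
have G i : growth_type K (j i) (f i).
  have [j1 [lo up]] := hj i; split => //.
  - by apply: HK; exact: Hf.
  - by apply: prec_osmall lo; exact: near_Xn_gt0.
  - exact: prec_osmall up.
have log2_gt0 : \forall t \near +oo, 0 < log2 (t : R).
  by apply: filterS (near_log2_ge (1 : R)) => t t1; lra.
have slope i : osmall (@log2 R) (fun t => ln (f i t)) by exact: prec_osmall.
have ord : forall a b : 'I_k.+1, (a < b)%N ->
    osmall (fun t => f (p a) t * log2 t ^+ 4) (f (p b)).
  apply: (@chain_osmall R k (fun a => f (p a))) => a b ab.
  have l4 : \forall t \near +oo, 0 < log2 (t : R) ^+ 4.
    by apply: filterS log2_gt0 => t; exact: exprn_gt0.
  move=> n; apply: filterS3 (f_gt0 (p a)) (filterI (f_gt0 (p b)) l4)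
    (prec_near l4 (ratio_f a b ab) n%:R) => t fa [/= fb lt0].
  rewrite ler_pdivlMr// => h; rewrite (gtr0_norm fb) (gtr0_norm (mulr_gt0 fa lt0)).
  by rewrite [f _ t * _]mulrC mulrA.
pose Jm := \max_i j i; pose L := (2 * Jm + 3)%N.
have [q [c [c0 test]]] := derivative_test_leq R (2 * Jm).
pose Q := (2 * q + 6 * (Jm + 5 * (2 * Jm).+2 + 1))%N.
have /near_pinfty[T hT] := near_good LK G slope ord L.
have gT := hT T (lexx T).
have /near_pinfty[X hX] := near_large T L Q.
pose X1 := Num.max X 1.
have lX0 : 0 <= ln X1 by rewrite ln_ge0// le_max lexx orbT.
(* Beyond X1 the constant c + 21 of [window_bound] suffices; below X1 the trivial bound N does,
   because ln N <= ln X1. *)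
exists (c + 22 + ln X1); first by lra.
move=> N N1 r s; rewrite !in_itv/= !le_min => /andP[r1 /andP[rN rE]] /andP[s1 /andP[sN _]] _.
move=> tau tau_itv [i0 tau_i0].
rewrite cmodE lecR; set S := cmod _.
have N0 : (0 : R) < N%:R by rewrite ltr0n.
have lnN : 0 < ln (N%:R : R).
  rewrite lt_neqAle ln_ge0 ?ler1n// andbT eq_sym; apply/eqP => lN0.
  by move: rE; rewrite lN0 expr0n invr0 mulr0; lra.
have [NX|XN] := ltP (N%:R : R) X1.
  apply: le_trans (trivial_bound _ _) _.
  rewrite ler_pdivlMr// mulrC ler_pM2r//.
  have : ln (N%:R : R) <= ln X1 by rewrite ler_ln ?posrE ?(lt_trans N0 NX) ?(ltW NX).
  lra.
have [k4 wT l2 kQ LN] : [/\ 4 <= ln (N%:R : R), T <= N%:R / ln N%:R,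
    log2 (N%:R : R) <= 2 * log2 (N%:R / ln N%:R), ln (N%:R : R) ^+ Q <= N%:R &
    (L%:R : R) <= N%:R].
  by apply: hX; apply: le_trans XN; rewrite le_max lexx.
rewrite ler_nat in LN.
have tau_bd i : `|(tau i)%:~R : R| <= log2 (N%:R : R) ^+ 2.
  by have := tau_itv i; rewrite in_itv/= ler_norml.
have P0 : tau (p ((p^-1)%g i0)) != 0 by rewrite permKV.
(* The maximum is taken over positions in the order of growth, so every function growing faster than
   [f (p a)] has coefficient 0. *)
case: (@arg_maxnP _ ((p^-1)%g i0) (fun a => tau (p a) != 0) (fun a => val a) P0) => a tau_a amax.
have tau_max (b : 'I_k.+1) : (a < b)%N -> tau (p b) = 0.
  move=> ab; apply/eqP; apply: contraTT ab => tb; rewrite -leqNgt; exact: amax.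
have rE' : r * ln (N%:R : R) ^+ 5 <= f (p a) N%:R.
  rewrite -ler_pdivlMr ?exprn_gt0//; apply: le_trans rE _.
  rewrite ler_pM2r ?invr_gt0 ?exprn_gt0//.
  have fa0 : 0 < f (p a) N%:R.
    by apply: (good_gt0 gT); apply: le_trans wT (w_le_n k4).
  by rewrite -[leRHS](gtr0_norm fa0); exact: bigmin_le.
have := @window_bound R k f j p L T gT tau a tau_a tau_max N s r k4 wT _ _ tau_bd l2 LN rE'
  Jm q c (leq_bigmax (p a)) erefl c0 test kQ.
rewrite s1 sN r1 rN => /(_ isT isT) h; apply: le_trans h _.
by rewrite ler_pM2r ?invr_gt0// ler_pM2r//; lra.
Qed.
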